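(* For $a=(D,F)\in\mathbb{R}^2$ consider the dehomogenized Loud vector field \[ L_a=(-v+uv)\,\partial_u+(u+Du^2+Fv^2)\,\partial_v , \] which has a center at the origin, and consider the period function of this center on its period annulus. Then every parameter $a_0=(D_0,0)$ with $D_0\in(-1,0)$ is a local regular value of the period function at the outer boundary of the period annulus: there exist $\delta>0$ and a neighbourhood $W$ (in the Poincaré disc) of the outer boundary of the period annulus of $L_{a_0}$ such that, for every $a=(D,F)$ with $|D-D_0|<\delta$ and $|F|<\delta$, no periodic orbit of the period annulus of $L_a$ lying in $W$ is a critical point of the period function (i.e. no critical period bifurcates from the outer boundary as $a\to a_0$).
   Context: The period annulus $\mathscr P$ of a center is the largest punctured neighbourhood of it consisting of periodic orbits; the period function assigns to each periodic orbit in $\mathscr P$ its period, and critical periods are critical points of this function with respect to any analytic parametrization $s\mapsto\gamma_s$ of the periodic orbits. Compactifying $\mathbb{R}^2$ to the Poincaré disc, the outer boundary of $\mathscr P$ is a polycycle; for $F=0$ and $D\in(-1,0)$ this polycycle contains a saddle-node singularity located at infinity at the intersection of the line at infinity with $u=1$. *)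

(* Defs.v *)
From Stdlib Require Import Reals ClassicalEpsilon.
From Coquelicot Require Import Coquelicot.
Open Scope R_scope.

Definition loud (D F : R) (p : R * R) : R * R :=
  let u := fst p in let v := snd p in
  (- v + u * v, u + D * u ^ 2 + F * v ^ 2).

Definition is_solution (D F : R) (g : R -> R * R) : Prop :=
  forall t, is_derive (fun s => fst (g s)) t (fst (loud D F (g t))) /\
            is_derive (fun s => snd (g s)) t (snd (loud D F (g t))).

Definition on_orbit (D F : R) (p q : R * R) : Prop :=
  exists g, is_solution D F g /\ g 0 = p /\ exists t, g t = q.

Definition is_period (D F : R) (p : R * R) (T : R) : Prop :=
  loud D F p <> (0, 0) /\ 0 < T /\
  exists g, is_solution D F g /\ g 0 = p /\
    (forall t, g (t + T) = g t) /\ (forall s, 0 < s < T -> g s <> p).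

Definition periodic (D F : R) (p : R * R) : Prop := exists T, is_period D F p T.

Definition dist2 (x y : R * R) : R := (fst x - fst y) ^ 2 + (snd x - snd y) ^ 2.

Definition openR2 (U : R * R -> Prop) : Prop :=
  forall x, U x -> exists e, 0 < e /\ forall y, dist2 x y < e ^ 2 -> U y.

Definition connectedR2 (U : R * R -> Prop) : Prop :=
  forall A B : R * R -> Prop, openR2 A -> openR2 B ->
    (forall x, U x -> A x \/ B x) ->
    (exists x, U x /\ A x) -> (exists x, U x /\ B x) ->
    exists x, U x /\ A x /\ B x.

Definition closureR2 (S : R * R -> Prop) (x : R * R) : Prop :=
  forall e, 0 < e -> exists y, S y /\ dist2 x y < e ^ 2.

(* Period annulus: the largest punctured neighbourhood of the origin consisting
   of periodic orbits = union of all connected open neighbourhoods U of the origin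
   such that every point of U \ {0} lies on a periodic orbit. *)
Definition in_period_annulus (D F : R) (p : R * R) : Prop :=
  p <> (0, 0) /\
  exists U : R * R -> Prop, openR2 U /\ connectedR2 U /\ U (0, 0) /\ U p /\
    forall q, U q -> q <> (0, 0) -> periodic D F q.

(* The period function (value of the unique minimal period; junk outside the annulus) *)
Definition period (D F : R) (p : R * R) : R :=
  epsilon (inhabits 0) (fun T => is_period D F p T).

(* The periodic orbit through p (in the period annulus) is a critical period:
   along a (straight, hence analytic) transversal parametrization s |-> p + s w
   of the periodic orbits near the one through p, the period function has
   zero derivative at s = 0. *)
Definition critical_period (D F : R) (p : R * R) : Prop :=
  in_period_annulus D F p /\
  exists w : R * R,
    fst w * snd (loud D F p) - snd w * fst (loud D F p) <> 0 /\
    is_derive (fun s => period D F (fst p + s * fst w, snd p + s * snd w)) 0 0.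

(* Poincare compactification: R^2 -> open unit disc; its closure (the Poincare
   disc) adds the circle at infinity. *)
Definition poincare (p : R * R) : R * R :=
  let r := sqrt (1 + fst p ^ 2 + snd p ^ 2) in (fst p / r, snd p / r).

Definition annulus_image (D F : R) (q : R * R) : Prop :=
  exists p, in_period_annulus D F p /\ poincare p = q.

(* Outer boundary of the period annulus in the Poincare disc: boundary of the
   (open) image of the annulus, minus the centre. *)
Definition outer_boundary (D F : R) (q : R * R) : Prop :=
  closureR2 (annulus_image D F) q /\ ~ annulus_image D F q /\ q <> (0, 0).

(* Main.v *)
Require Import Defs.
From Stdlib Require Import Reals Lra Lia Psatz ClassicalEpsilon.
From Coquelicot Require Import Coquelicot.
Open Scope R_scope.

(** Put [x = - ln (1 - u)].  Then [x' = - v] and [x'' + F x'^2 + g(x) = 0] with [g = force D],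
    and [(exp (F x) v)^2 + 2 V(x) = r^2] is a first integral, where [V' = exp (2 F x) g].
    Let [w = amp x] be the signed square root of [2 V(x)].  On the circle of radius [r] in the
    [(w, - exp (F x) v)]-plane the flow turns at speed [1 / N(w)], so the period is
    [T(r) = int_0^{2 pi} N(r sin th) dth].

    For [F > 0] and [x -> +oo] the system is close to half of a harmonic oscillator in
    [z = exp (F x)], whose period does not depend on [r]; the sign of [T'] is therefore
    decided by subtracting that oscillator.  With
    [q = 2 F V + kappa - exp (2 F x) g] ([corr] below), integration by parts gives
    [(F r^2 + kappa) T(r) = 2 J(r) + E(r)], [J'(r) = F r T(r)] and
    [E(r) = int N q (r sin th) dth], so that [(F r^2 + kappa) T' = E'].  The integrand of [E]
    has derivative [slope], which is exponentially small for [x >> 0] and at most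
    [- c exp (F x)] for [x << 0]; hence [E' > 0] for large [r], uniformly for [F] near [0].
    At [F = 0] every orbit of [u < 1] is periodic, so a compact segment of the [u]-axis
    separates the small orbits from the outer boundary. *)

(** * Calculus on the line and uniqueness of solutions *)

(** The obstacle is uniformity in [F], since the period behaves differently in three regimes: it
    grows linearly in [r] for [F = 0], tends to a finite limit for [F > 0], and for [F < 0] the
    radius itself is bounded, with [F r^2 + kappa] tending to 0 at its supremum. The identity for
    [E] is exact in all of them, and a crude lower bound of order [1 / r] for the growth of [E]
    serves them all. The constant [kappa] is the one for which [q] decays at [+oo]: its closed form
    is a sum of two decaying exponentials without constant term. Two things are deliberately
    avoided. Neither [N] nor [E] is differentiated under the integral, because [slope] is [0 / 0] at
    the center: [J] involves only [exp (F x)], and [E] is controlled by increments. Nor is anything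
    divided by [F r^2 + kappa]: it is only shown that [T'] cannot vanish. *)

Lemma ball_Rabs_lt (x y : R) (e : posreal) : ball x e y -> Rabs (y - x) < e.
Proof. exact (fun H => H). Qed.

(** Monotonicity of [f] traps [h (f x + t)] near [x], so no continuity of [h] has to be assumed. The
    inverse relation is only local because [amp] need not be onto. *)
Lemma is_derive_inverse (f h : R -> R) (x l : R) :
  (forall a b, a < b -> f a < f b) -> is_derive f x l -> l <> 0 ->
  locally (f x) (fun y => f (h y) = y) -> is_derive h (f x) (/ l).
Proof.
  intros Hinc Hd Hl [d0 Hd0].
  assert (Hrefl : forall a b, f a < f b -> a < b).
  { intros a b Hab. destruct (Rtotal_order a b) as [H|[H|H]]; auto.
    - subst; lra.
    - apply Hinc in H; lra. }
  assert (Hinj : forall a b, f a = f b -> a = b).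
  { intros a b Hab. destruct (Rtotal_order a b) as [H|[H|H]]; auto;
      apply Hinc in H; lra. }
  assert (Hx : h (f x) = x) by (apply Hinj, Hd0, ball_center).
  apply is_derive_Reals in Hd. apply is_derive_Reals.
  intros eps Heps.
  assert (Hal : 0 < Rabs l) by now apply Rabs_pos_lt.
  (* The first bound keeps [|l + e| >= |l| / 2], the second then makes [|e| / (|l| |l + e|)] smaller
     than [eps]. *)
  set (eta := Rmin (Rabs l / 2) (eps * (Rabs l * Rabs l) / 4)).
  assert (Heta : 0 < eta).
  { unfold eta. apply Rmin_pos; [lra|]. apply Rmult_lt_0_compat; [|lra].
    apply Rmult_lt_0_compat; auto. apply Rmult_lt_0_compat; auto. }
  destruct (Hd eta Heta) as [d Hdd].
  assert (Hfl : f (x - d / 2) < f x) by (apply Hinc; destruct d; simpl; lra).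
  assert (Hfr : f x < f (x + d / 2)) by (apply Hinc; destruct d; simpl; lra).
  set (m := Rmin d0 (Rmin (f x - f (x - d / 2)) (f (x + d / 2) - f x))).
  assert (Hm : 0 < m).
  { unfold m. repeat apply Rmin_pos; try lra. apply cond_pos. }
  exists (mkposreal m Hm). intros t Ht0 Ht. simpl in Ht.
  assert (Ht1 : Rabs t < d0) by (eapply Rlt_le_trans; [exact Ht|apply Rmin_l]).
  assert (Ht2 : Rabs t < f x - f (x - d / 2)).
  { eapply Rlt_le_trans; [exact Ht|]. unfold m.
    eapply Rle_trans; [apply Rmin_r|apply Rmin_l]. }
  assert (Ht3 : Rabs t < f (x + d / 2) - f x).
  { eapply Rlt_le_trans; [exact Ht|]. unfold m.
    eapply Rle_trans; [apply Rmin_r|apply Rmin_r]. }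
  assert (Hfz : f (h (f x + t)) = f x + t).
  { apply Hd0. unfold ball; simpl; unfold AbsRing_ball, abs, minus, plus, opp; simpl.
    replace (f x + t + - f x) with t by ring. exact Ht1. }
  set (z := h (f x + t)) in *. rewrite Hx.
  apply Rabs_def2 in Ht2. apply Rabs_def2 in Ht3.
  assert (Hz1 : x - d / 2 < z) by (apply Hrefl; lra).
  assert (Hz2 : z < x + d / 2) by (apply Hrefl; lra).
  assert (Hzx : z - x <> 0).
  { intro He. apply Ht0. replace z with x in Hfz by lra. lra. }
  specialize (Hdd (z - x) Hzx).
  assert (Hzd : Rabs (z - x) < d) by (apply Rabs_def1; destruct d; simpl in *; lra).
  specialize (Hdd Hzd).
  replace (x + (z - x)) with z in Hdd by ring.
  set (e := (f z - f x) / (z - x) - l) in *.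
  assert (Hte : t = (z - x) * (l + e)) by (unfold e; rewrite Hfz; field; exact Hzx).
  assert (He1 : Rabs e < Rabs l / 2) by (eapply Rlt_le_trans; [exact Hdd|apply Rmin_l]).
  assert (He2 : Rabs e < eps * (Rabs l * Rabs l) / 4)
    by (eapply Rlt_le_trans; [exact Hdd|apply Rmin_r]).
  assert (Hle : Rabs l / 2 <= Rabs (l + e)).
  { pose proof (Rabs_triang_inv l (- e)) as Hti. rewrite Rabs_Ropp in Hti.
    replace (l - - e) with (l + e) in Hti by ring. lra. }
  assert (Hle0 : l + e <> 0) by (intro H0; rewrite H0, Rabs_R0 in Hle; lra).
  replace ((z - x) / t - / l) with (- e / (l * (l + e))).
  2:{ rewrite Hte. field. repeat split; auto. }
  unfold Rdiv. rewrite Rabs_mult, Rabs_Ropp, Rabs_inv, Rabs_mult.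
  assert (Hp : 0 < Rabs l * Rabs (l + e)) by (apply Rmult_lt_0_compat; lra).
  apply (Rmult_lt_reg_r (Rabs l * Rabs (l + e))); auto.
  rewrite Rmult_assoc, Rinv_l, Rmult_1_r by lra.
  eapply Rlt_le_trans; [exact He2|].
  assert (Rabs l * (Rabs l / 2) <= Rabs l * Rabs (l + e)) by (apply Rmult_le_compat_l; lra).
  assert (eps * (Rabs l * (Rabs l / 2)) <= eps * (Rabs l * Rabs (l + e)))
    by (apply Rmult_le_compat_l; lra).
  assert (0 < eps * (Rabs l * Rabs l)) by (repeat apply Rmult_lt_0_compat; auto).
  lra.
Qed.

(** Derivatives are required only in the open interval, since it is applied to [wcorr] on intervals
    starting at [w = 0], where only continuity is available. *)
Lemma increment_ge (f f' : R -> R) (a b c : R) :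
  a <= b -> (forall x, a < x < b -> is_derive f x (f' x)) ->
  (forall x, a <= x <= b -> continuous f x) ->
  (forall x, a < x < b -> c <= f' x) -> c * (b - a) <= f b - f a.
Proof.
  intros Hab Hd Hc Hl.
  destruct (Req_dec a b) as [<-|Hne]; [lra|].
  assert (pr1 : forall x, a < x < b -> derivable_pt f x).
  { intros x Hx. exists (f' x). now apply is_derive_Reals, Hd. }
  assert (pr2 : forall x, a < x < b -> derivable_pt id x)
    by (intros; apply derivable_pt_id).
  destruct (MVT f id a b pr1 pr2) as [x [Hx Heq]].
  - lra.
  - intros x Hx. now apply continuity_pt_filterlim, Hc.
  - intros x Hx. apply derivable_continuous_pt, derivable_pt_id.
  - rewrite (derive_pt_eq_0 id x 1 (pr2 x Hx)) in Heq by apply derivable_pt_lim_id.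
    rewrite (derive_pt_eq_0 f x (f' x) (pr1 x Hx)) in Heq by now apply is_derive_Reals, Hd.
    unfold id in Heq. specialize (Hl x Hx). nra.
Qed.

Lemma increment_ge_everywhere (f f' : R -> R) (a b c : R) :
  a <= b -> (forall x, a <= x <= b -> is_derive f x (f' x)) ->
  (forall x, a <= x <= b -> c <= f' x) -> c * (b - a) <= f b - f a.
Proof.
  intros Hab Hd Hl. apply (increment_ge f f'); auto.
  - intros x Hx; apply Hd; lra.
  - intros x Hx. apply (ex_derive_continuous f). exists (f' x). now apply Hd.
  - intros x Hx; apply Hl; lra.
Qed.

Lemma increment_le_everywhere (f f' : R -> R) (a b c : R) :
  a <= b -> (forall x, a <= x <= b -> is_derive f x (f' x)) ->
  (forall x, a <= x <= b -> f' x <= c) -> f b - f a <= c * (b - a).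
Proof.
  intros Hab Hd Hl.
  assert (H := increment_ge_everywhere (fun x => - f x) (fun x => - f' x) a b (- c) Hab).
  assert (- c * (b - a) <= - f b - - f a).
  { apply H.
    - intros x Hx. apply (is_derive_opp f x (f' x)). now apply Hd.
    - intros x Hx. specialize (Hl x Hx). lra. }
  lra.
Qed.

Lemma abs_increment_le (f f' : R -> R) (x c : R) :
  (forall y, Rabs y <= Rabs x -> is_derive f y (f' y)) ->
  (forall y, Rabs y <= Rabs x -> Rabs (f' y) <= c) -> Rabs (f x - f 0) <= c * Rabs x.
Proof.
  intros Hd Hl.
  destruct (Rle_dec 0 x) as [Hx|Hx].
  - rewrite (Rabs_right x) in * by lra.
    assert (Hy : forall y, 0 <= y <= x -> Rabs y <= x) by (intros; rewrite Rabs_right; lra).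
    assert (H1 := increment_ge_everywhere f f' 0 x (- c) Hx).
    assert (H2 := increment_le_everywhere f f' 0 x c Hx).
    assert (- c * (x - 0) <= f x - f 0).
    { apply H1; intros y Hy'; [now apply Hd, Hy|].
      pose proof (Hl y (Hy y Hy')) as H. apply Rabs_le_between in H. lra. }
    assert (f x - f 0 <= c * (x - 0)).
    { apply H2; intros y Hy'; [now apply Hd, Hy|].
      pose proof (Hl y (Hy y Hy')) as H0. apply Rabs_le_between in H0. lra. }
    apply Rabs_le. lra.
  - rewrite (Rabs_left x) in * by lra.
    assert (Hy : forall y, x <= y <= 0 -> Rabs y <= - x)
      by (intros; rewrite Rabs_left1; lra).
    assert (H1 := increment_ge_everywhere f f' x 0 (- c)).
    assert (H2 := increment_le_everywhere f f' x 0 c).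
    assert (- c * (0 - x) <= f 0 - f x).
    { apply H1; [lra| |]; intros y Hy'; [now apply Hd, Hy|].
      pose proof (Hl y (Hy y Hy')) as H. apply Rabs_le_between in H. lra. }
    assert (f 0 - f x <= c * (0 - x)).
    { apply H2; [lra| |]; intros y Hy'; [now apply Hd, Hy|].
      pose proof (Hl y (Hy y Hy')) as H0. apply Rabs_le_between in H0. lra. }
    apply Rabs_le. lra.
Qed.

Lemma zero_derivative_const (f : R -> R) :
  (forall t, is_derive f t 0) -> forall t, f t = f 0.
Proof.
  intros Hd t.
  assert (H := abs_increment_le f (fun _ => 0) t 0 (fun y _ => Hd y)).
  assert (Rabs (f t - f 0) <= 0 * Rabs t) as H1.
  { apply H. intros; rewrite Rabs_R0; lra. }
  rewrite Rmult_0_l in H1. pose proof (Rabs_pos (f t - f 0)).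
  assert (Rabs (f t - f 0) = 0) as H2 by lra. apply Rabs_eq_0 in H2. lra.
Qed.

(** Integrating factors: [f t * exp (- K t)] decreases forward from 0 and [f t * exp (K t)]
    increases towards 0, so nonnegativity leaves only zero. *)
Lemma gronwall_zero (f f' : R -> R) (a K : R) :
  0 <= a -> (forall t, - a <= t <= a -> is_derive f t (f' t)) ->
  (forall t, - a <= t <= a -> Rabs (f' t) <= K * f t) ->
  (forall t, 0 <= f t) -> f 0 = 0 -> f a = 0 /\ f (- a) = 0.
Proof.
  intros Ha Hd HK Hp H0.
  assert (H1 := increment_le_everywhere (fun t => f t * exp (- K * t))
    (fun t => f' t * exp (- K * t) + f t * (- K * exp (- K * t))) 0 a 0 Ha).
  assert (H2 := increment_ge_everywhere (fun t => f t * exp (K * t))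
    (fun t => f' t * exp (K * t) + f t * (K * exp (K * t))) (- a) 0 0).
  split.
  - assert (f a * exp (- K * a) - f 0 * exp (- K * 0) <= 0 * (a - 0)) as H.
    { apply H1; intros t Ht.
      - apply (is_derive_mult (K := R_AbsRing) f (fun t => exp (- K * t)) t (f' t)
          (- K * exp (- K * t))).
        + apply Hd; lra.
        + auto_derive; [trivial|ring].
        + intros; apply Rmult_comm.
      - assert (Hk := HK t). assert (Rabs (f' t) <= K * f t) as Hk' by (apply Hk; lra).
        apply Rabs_le_between in Hk'. pose proof (exp_pos (- K * t)). nra. }
    rewrite H0 in H. pose proof (exp_pos (- K * a)). pose proof (Hp a). nra.
  - assert (0 * (0 - - a) <= f 0 * exp (K * 0) - f (- a) * exp (K * - a)) as H.
    { apply H2; [lra| |]; intros t Ht.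
      - apply (is_derive_mult (K := R_AbsRing) f (fun t => exp (K * t)) t (f' t)
          (K * exp (K * t))).
        + apply Hd; lra.
        + auto_derive; [trivial|ring].
        + intros; apply Rmult_comm.
      - assert (Hk := HK t). assert (Rabs (f' t) <= K * f t) as Hk' by (apply Hk; lra).
        apply Rabs_le_between in Hk'. pose proof (exp_pos (K * t)). nra. }
    rewrite H0 in H. pose proof (exp_pos (K * - a)). pose proof (Hp (- a)). nra.
Qed.

Lemma solution_continuous (D F : R) (g : R -> R * R) (t : R) : is_solution D F g ->
  continuous (fun s => fst (g s)) t /\ continuous (fun s => snd (g s)) t.
Proof.
  intros Hs. destruct (Hs t) as [H1 H2]. split.
  - apply (ex_derive_continuous (fun s => fst (g s))). eexists; eassumption.
  - apply (ex_derive_continuous (fun s => snd (g s))). eexists; eassumption.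
Qed.

(** The field is only locally Lipschitz, so Gronwall is applied to the squared distance on each
    [[-a, a]], where [B] bounds both solutions. Uniqueness is what makes the minimal period
    independent of the solution chosen in [is_period]. *)
Lemma loud_solution_unique (D F : R) (g1 g2 : R -> R * R) :
  is_solution D F g1 -> is_solution D F g2 -> g1 0 = g2 0 -> forall t, g1 t = g2 t.
Proof.
  intros S1 S2 H0.
  assert (Hmain : forall a, 0 <= a -> g1 a = g2 a /\ g1 (- a) = g2 (- a)).
  { intros a Ha.
    set (u1 := fun t => fst (g1 t)). set (v1 := fun t => snd (g1 t)).
    set (u2 := fun t => fst (g2 t)). set (v2 := fun t => snd (g2 t)).
    assert (Cu1 : forall t, continuous u1 t)
      by (intro t; exact (proj1 (solution_continuous D F _ t S1))).
    assert (Cv1 : forall t, continuous v1 t)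
      by (intro t; exact (proj2 (solution_continuous D F _ t S1))).
    assert (Cu2 : forall t, continuous u2 t)
      by (intro t; exact (proj1 (solution_continuous D F _ t S2))).
    assert (Cv2 : forall t, continuous v2 t)
      by (intro t; exact (proj2 (solution_continuous D F _ t S2))).
    set (S := fun t => Rabs (u1 t) + Rabs (v1 t) + (Rabs (u2 t) + Rabs (v2 t))).
    assert (CS : forall t, continuity_pt S t).
    { intro t. apply continuity_pt_filterlim. unfold S.
      apply (continuous_plus (fun t => Rabs (u1 t) + Rabs (v1 t))
        (fun t => Rabs (u2 t) + Rabs (v2 t))).
      - apply (continuous_plus (fun t => Rabs (u1 t)) (fun t => Rabs (v1 t)));
          apply continuous_comp; auto; apply continuous_Rabs.
      - apply (continuous_plus (fun t => Rabs (u2 t)) (fun t => Rabs (v2 t)));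
          apply continuous_comp; auto; apply continuous_Rabs. }
    destruct (continuity_ab_maj S (- a) a) as [M [HM _]]; [lra|intros; apply CS|].
    set (B := S M) in *.
    set (f := fun t => (u1 t - u2 t) ^ 2 + (v1 t - v2 t) ^ 2).
    set (f' := fun t => 2 * (u1 t - u2 t) * (fst (loud D F (g1 t)) - fst (loud D F (g2 t)))
       + 2 * (v1 t - v2 t) * (snd (loud D F (g1 t)) - snd (loud D F (g2 t)))).
    set (K := 2 * (2 + B * (2 + Rabs D + Rabs F))).
    assert (Hz : f a = 0 /\ f (- a) = 0).
    { apply (gronwall_zero f f' a K); auto.
      - intros t _. unfold f, f'. destruct (S1 t) as [A1 A2]. destruct (S2 t) as [A3 A4].
        change (is_derive u1 t (fst (loud D F (g1 t)))) in A1.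
        change (is_derive v1 t (snd (loud D F (g1 t)))) in A2.
        change (is_derive u2 t (fst (loud D F (g2 t)))) in A3.
        change (is_derive v2 t (snd (loud D F (g2 t)))) in A4.
        auto_derive.
        + repeat split; eexists; eassumption.
        + change (fun x => u1 x) with u1; change (fun x => v1 x) with v1;
            change (fun x => u2 x) with u2; change (fun x => v2 x) with v2.
          rewrite (is_derive_unique _ _ _ A1), (is_derive_unique _ _ _ A2),
            (is_derive_unique _ _ _ A3), (is_derive_unique _ _ _ A4). ring.
      - intros t Ht. specialize (HM t Ht). unfold f, f', loud. simpl.
        fold (u1 t) (v1 t) (u2 t) (v2 t). unfold S in HM. fold B in HM.
        set (x := u1 t - u2 t). set (y := v1 t - v2 t).
        set (Dp := Rabs D) in *. set (Fp := Rabs F) in *.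
        assert (HD : - Dp <= D <= Dp) by (apply Rabs_le_between; unfold Dp; lra).
        assert (HF : - Fp <= F <= Fp) by (apply Rabs_le_between; unfold Fp; lra).
        pose proof (Rabs_pos (u1 t)). pose proof (Rabs_pos (v1 t)).
        pose proof (Rabs_pos (u2 t)). pose proof (Rabs_pos (v2 t)).
        assert (Hb1 : Rabs (v1 t) <= B) by lra.
        assert (Hb2 : Rabs (u2 t) <= B) by lra.
        assert (Hb3 : Rabs (u1 t + u2 t) <= B).
        { eapply Rle_trans; [apply Rabs_triang|]. lra. }
        assert (Hb4 : Rabs (v1 t + v2 t) <= B).
        { eapply Rle_trans; [apply Rabs_triang|]. lra. }
        assert (HB0 : 0 <= B) by lra.
        set (A := x ^ 2 + y ^ 2).
        assert (HA : 0 <= A) by (unfold A; nra).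
        assert (Hxy : Rabs (x * y) <= A).
        { apply Rabs_le. unfold A. split; nra. }
        assert (Hxx : Rabs (x * x) <= A) by (apply Rabs_le; unfold A; split; nra).
        assert (Hyy : Rabs (y * y) <= A) by (apply Rabs_le; unfold A; split; nra).
        assert (Hm : forall p q b c, Rabs p <= b -> Rabs q <= c -> Rabs (p * q) <= b * c).
        { intros p q b c Hp Hq. rewrite Rabs_mult.
          apply Rmult_le_compat; auto; apply Rabs_pos. }
        (* The linear rotation terms cancel, and every remaining term is quadratic in the difference
           [(x, y)]. *)
        match goal with |- Rabs ?e <= _ =>
          replace e with (2 * (x * x * v1 t + x * y * u2 t + y * y * (F * (v1 t + v2 t))
            + x * y * (D * (u1 t + u2 t)))) by (unfold x, y; ring) end.
        rewrite Rabs_mult, (Rabs_right 2) by lra.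
        assert (L1 : Rabs (x * x * v1 t) <= A * B) by auto.
        assert (L2 : Rabs (x * y * u2 t) <= A * B) by auto.
        assert (L3 : Rabs (y * y * (F * (v1 t + v2 t))) <= A * (Fp * B)).
        { apply Hm; auto. apply Hm; auto. unfold Fp; lra. }
        assert (L4 : Rabs (x * y * (D * (u1 t + u2 t))) <= A * (Dp * B)).
        { apply Hm; auto. apply Hm; auto. unfold Dp; lra. }
        assert (L5 : forall p q b c, Rabs p <= b -> Rabs q <= c -> Rabs (p + q) <= b + c).
        { intros p q b c Hp Hq. eapply Rle_trans; [apply Rabs_triang|]. lra. }
        assert (L6 := L5 _ _ _ _ (L5 _ _ _ _ (L5 _ _ _ _ L1 L2) L3) L4).
        match goal with |- _ <= ?e => replace e with
          (4 * A + 2 * (A * B + A * B + A * (Fp * B) + A * (Dp * B)))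
          by (unfold A, x, y, K, Dp, Fp; ring) end.
        lra.
      - intros t. unfold f.
        pose proof (pow2_ge_0 (u1 t - u2 t)). pose proof (pow2_ge_0 (v1 t - v2 t)). lra.
      - unfold f, u1, u2, v1, v2. rewrite H0. ring. }
    destruct Hz as [Z1 Z2]. unfold f, u1, u2, v1, v2 in Z1, Z2.
    assert (Hsq : forall x y, x ^ 2 + y ^ 2 = 0 -> x = 0 /\ y = 0).
    { intros x y Hxy. split; nra. }
    apply Hsq in Z1. apply Hsq in Z2.
    split; apply injective_projections; lra. }
  intros t. destruct (Rle_dec 0 t) as [Ht|Ht].
  - now apply Hmain.
  - replace t with (- - t) by ring. apply Hmain. lra.
Qed.

(** * The potential system *)

(** This is [u + D u^2] at [u = 1 - exp (- x)]. *)
Definition force (D x : R) : R := (1 - exp (- x)) * (1 + D - D * exp (- x)).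
Definition force' (D x : R) : R := exp (- x) * (1 + 2 * D - 2 * D * exp (- x)).
Definition wforce (D F x : R) : R := exp (2 * F * x) * force D x.
Definition potential (D F x : R) : R := RInt (wforce D F) 0 x.
(* Closed form of [2 F V + kappa - wforce] with [kappa = corr D F 0], see [corr_plus_wforce]. *)
Definition corr (D F x : R) : R :=
  (1 + 2 * D) * exp (- ((1 - 2 * F) * x)) / (1 - 2 * F)
  - D * exp (- (2 * (1 - F) * x)) / (1 - F).
Definition amp (D F x : R) : R :=
  if Rle_dec 0 x then sqrt (2 * potential D F x) else - sqrt (2 * potential D F x).
(* [dens = exp (F x) * dx / d amp]; the quotient is [0 / 0] at the center, where its limit is [1]. *)
Definition dens (D F x : R) : R :=
  if Req_EM_T x 0 then 1 else amp D F x * exp (- (F * x)) / force D x.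

Lemma exp_nonpos_le (x : R) : x <= 0 -> exp x <= 1.
Proof.
  intro Hx. rewrite <- exp_0. destruct Hx as [H|H].
  - left; now apply exp_increasing.
  - subst; lra.
Qed.

Lemma exp_nonneg_ge (x : R) : 0 <= x -> 1 <= exp x.
Proof. intro Hx. pose proof (exp_ineq1_le x). lra. Qed.

Lemma force_0 (D : R) : force D 0 = 0.
Proof. unfold force. rewrite Ropp_0, exp_0. ring. Qed.

Lemma force_factor_pos (D x : R) : -1 < D < 0 -> 0 < 1 + D - D * exp (- x).
Proof. intros HD. pose proof (exp_pos (- x)). nra. Qed.

Lemma force_pos (D x : R) : -1 < D < 0 -> 0 < x -> 0 < force D x.
Proof.
  intros HD Hx. apply Rmult_lt_0_compat.
  - assert (exp (- x) < exp 0) by (apply exp_increasing; lra). rewrite exp_0 in *. lra.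
  - now apply force_factor_pos.
Qed.

Lemma force_neg (D x : R) : -1 < D < 0 -> x < 0 -> force D x < 0.
Proof.
  intros HD Hx. pose proof (force_factor_pos D x HD) as Hf.
  assert (exp 0 < exp (- x)) by (apply exp_increasing; lra). rewrite exp_0 in *.
  unfold force. nra.
Qed.

Lemma force_neq_0 (D x : R) : -1 < D < 0 -> x <> 0 -> force D x <> 0.
Proof.
  intros HD Hx. destruct (Rtotal_order x 0) as [H|[H|H]].
  - pose proof (force_neg D x HD H). lra.
  - contradiction.
  - pose proof (force_pos D x HD H). lra.
Qed.

Lemma is_derive_force (D x : R) : is_derive (force D) x (force' D x).
Proof. unfold force, force'. auto_derive; [trivial|ring]. Qed.

Lemma is_derive_wforce (D F x : R) : is_derive (wforce D F) x
  (2 * F * wforce D F x + exp (2 * F * x) * force' D x).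
Proof. unfold wforce, force, force'. auto_derive; [trivial|ring]. Qed.

Lemma continuous_wforce (D F x : R) : continuous (wforce D F) x.
Proof. apply (ex_derive_continuous (wforce D F)). eexists. apply is_derive_wforce. Qed.

Lemma is_derive_potential (D F x : R) : is_derive (potential D F) x (wforce D F x).
Proof.
  unfold potential. apply (is_derive_RInt (wforce D F) (RInt (wforce D F) 0) 0 x).
  - apply filter_forall. intro y.
    apply (RInt_correct (wforce D F)), ex_RInt_continuous.
    intros; apply continuous_wforce.
  - apply continuous_wforce.
Qed.

Lemma potential_0 (D F : R) : potential D F 0 = 0.
Proof. exact (RInt_point 0 (wforce D F)). Qed.

Lemma wforce_pos (D F x : R) : -1 < D < 0 -> 0 < x -> 0 < wforce D F x.
Proof.
  intros HD Hx. apply Rmult_lt_0_compat; [apply exp_pos|now apply force_pos].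
Qed.

Lemma wforce_neg (D F x : R) : -1 < D < 0 -> x < 0 -> wforce D F x < 0.
Proof.
  intros HD Hx. pose proof (force_neg D x HD Hx). pose proof (exp_pos (2 * F * x)).
  unfold wforce. nra.
Qed.

Lemma potential_increment (D F a b : R) : a < b ->
  exists c, a < c < b /\ potential D F b - potential D F a = wforce D F c * (b - a).
Proof.
  intros Hab.
  destruct (MVT_cor2 (potential D F) (wforce D F) a b Hab) as [c [Hc1 Hc2]].
  - intros. apply is_derive_Reals, is_derive_potential.
  - exists c. auto.
Qed.

Lemma potential_lt_right (D F a b : R) : -1 < D < 0 -> 0 <= a < b ->
  potential D F a < potential D F b.
Proof.
  intros HD Hab. destruct (potential_increment D F a b) as [c [Hc He]]; [lra|].
  assert (0 < wforce D F c) by (apply wforce_pos; auto; lra). nra.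
Qed.

Lemma potential_lt_left (D F a b : R) : -1 < D < 0 -> a < b <= 0 ->
  potential D F b < potential D F a.
Proof.
  intros HD Hab. destruct (potential_increment D F a b) as [c [Hc He]]; [lra|].
  assert (wforce D F c < 0) by (apply wforce_neg; auto; lra). nra.
Qed.

Lemma potential_pos (D F x : R) : -1 < D < 0 -> x <> 0 -> 0 < potential D F x.
Proof.
  intros HD Hx. rewrite <- (potential_0 D F). destruct (Rtotal_order x 0) as [H|[H|H]].
  - apply potential_lt_left; auto; lra.
  - contradiction.
  - apply potential_lt_right; auto; lra.
Qed.

Lemma potential_nonneg (D F x : R) : -1 < D < 0 -> 0 <= potential D F x.
Proof.
  intros HD. destruct (Req_dec x 0) as [->|Hx].
  - rewrite potential_0; lra.
  - left. now apply potential_pos.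
Qed.

Lemma is_derive_corr (D F x : R) : Rabs F <= 1 / 32 ->
  is_derive (corr D F) x (- (exp (2 * F * x) * force' D x)).
Proof.
  intros HF. apply Rabs_le_between in HF. unfold corr, force'.
  auto_derive; [repeat split; lra|].
  replace (- ((1 - 2 * F) * x)) with (2 * F * x + - x) by ring.
  replace (- (2 * (1 - F) * x)) with (2 * F * x + (- x + - x)) by ring.
  rewrite !exp_plus. field. lra.
Qed.

(** The derivative of [corr] is exactly what is left of [2 F wforce] after removing the derivative
    of [wforce], so the difference of the two sides is constant; it is evaluated at 0. *)
Lemma corr_plus_wforce (D F x : R) : Rabs F <= 1 / 32 ->
  corr D F x + wforce D F x = 2 * F * potential D F x + corr D F 0.
Proof.
  intros HF.
  assert (H := zero_derivative_const
    (fun x => corr D F x + wforce D F x - 2 * F * potential D F x)).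
  assert (He : corr D F x + wforce D F x - 2 * F * potential D F x
    = corr D F 0 + wforce D F 0 - 2 * F * potential D F 0).
  { apply H. intro t.
    pose proof (is_derive_corr D F t HF) as H1.
    pose proof (is_derive_wforce D F t) as H2.
    pose proof (is_derive_potential D F t) as H3.
    auto_derive.
    - repeat split; eexists; eassumption.
    - change (fun x => corr D F x) with (corr D F).
      change (fun x => wforce D F x) with (wforce D F).
      change (fun x => potential D F x) with (potential D F).
      rewrite (is_derive_unique _ _ _ H1), (is_derive_unique _ _ _ H2),
        (is_derive_unique _ _ _ H3). ring. }
  unfold wforce at 2 in He. rewrite force_0, potential_0 in He. lra.
Qed.

(** * The signed amplitude and its density *)

Lemma amp_sqr (D F x : R) : -1 < D < 0 -> amp D F x * amp D F x = 2 * potential D F x.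
Proof.
  intros HD. pose proof (potential_nonneg D F x HD).
  assert (Hs : sqrt (2 * potential D F x) * sqrt (2 * potential D F x) = 2 * potential D F x)
    by (apply sqrt_sqrt; lra).
  unfold amp. destruct (Rle_dec 0 x); lra.
Qed.

Lemma amp_0 (D F : R) : amp D F 0 = 0.
Proof.
  unfold amp. rewrite potential_0, Rmult_0_r, sqrt_0. destruct (Rle_dec 0 0); lra.
Qed.

Lemma amp_pos (D F x : R) : -1 < D < 0 -> 0 < x -> 0 < amp D F x.
Proof.
  intros HD Hx. unfold amp. destruct (Rle_dec 0 x); [|lra].
  apply sqrt_lt_R0. assert (0 < potential D F x) by (apply potential_pos; lra). lra.
Qed.

Lemma amp_neg (D F x : R) : -1 < D < 0 -> x < 0 -> amp D F x < 0.
Proof.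
  intros HD Hx. unfold amp. destruct (Rle_dec 0 x); [lra|].
  assert (0 < sqrt (2 * potential D F x)); [|lra].
  apply sqrt_lt_R0. assert (0 < potential D F x) by (apply potential_pos; lra). lra.
Qed.

Lemma dens_pos (D F x : R) : -1 < D < 0 -> 0 < dens D F x.
Proof.
  intros HD. unfold dens. destruct (Req_EM_T x 0) as [H|H]; [lra|].
  pose proof (exp_pos (- (F * x))).
  destruct (Rlt_dec 0 x) as [Hx|Hx].
  - pose proof (amp_pos D F x HD Hx). pose proof (force_pos D x HD Hx).
    apply Rdiv_lt_0_compat; auto. now apply Rmult_lt_0_compat.
  - assert (Hx' : x < 0) by lra.
    pose proof (amp_neg D F x HD Hx'). pose proof (force_neg D x HD Hx').
    replace (amp D F x * exp (- (F * x)) / force D x)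
      with (- amp D F x * exp (- (F * x)) / (- force D x)) by (field; lra).
    apply Rdiv_lt_0_compat; [|lra]. apply Rmult_lt_0_compat; lra.
Qed.

Lemma dens_force (D F x : R) : -1 < D < 0 ->
  dens D F x * force D x = amp D F x * exp (- (F * x)).
Proof.
  intros HD. unfold dens. destruct (Req_EM_T x 0) as [->|H].
  - rewrite force_0, amp_0. ring.
  - field. now apply force_neq_0.
Qed.

(** Since [wforce] has slope 1 at 0, the potential is [x^2 / 2] to leading order. This is needed to
    differentiate [amp] at the center, where the square root is singular. *)
Lemma potential_quadratic_at_0 (D F eps : R) : 0 < eps ->
  exists d, 0 < d /\ forall x, Rabs x < d ->
    Rabs (2 * potential D F x - x * x) <= eps * (x * x).
Proof.
  intros Heps.
  assert (Hd : is_derive (wforce D F) 0 1).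
  { replace 1 with (2 * F * wforce D F 0 + exp (2 * F * 0) * force' D 0); [apply is_derive_wforce|].
    unfold wforce, force'. rewrite force_0, !Rmult_0_r, Ropp_0, exp_0. ring. }
  apply is_derive_Reals in Hd.
  destruct (Hd (eps / 2)) as [d Hdd]; [lra|].
  exists d. split; [apply cond_pos|]. intros x Hx.
  assert (Hw0 : wforce D F 0 = 0) by (unfold wforce; rewrite force_0; ring).
  assert (Hb : forall y, Rabs y <= Rabs x ->
    Rabs (2 * wforce D F y - 2 * y) <= eps * Rabs x).
  { intros y Hy. destruct (Req_dec y 0) as [->|Hy0].
    - rewrite Hw0. replace (2 * 0 - 2 * 0) with 0 by ring. rewrite Rabs_R0.
      pose proof (Rabs_pos x). nra.
    - specialize (Hdd y Hy0). rewrite Rplus_0_l, Hw0, Rminus_0_r in Hdd.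
      assert (Rabs (wforce D F y / y - 1) < eps / 2) by (apply Hdd; lra).
      replace (2 * wforce D F y - 2 * y) with (2 * y * (wforce D F y / y - 1)) by (field; auto).
      rewrite !Rabs_mult, (Rabs_right 2) by lra.
      pose proof (Rabs_pos y). pose proof (Rabs_pos (wforce D F y / y - 1)). nra. }
  assert (H := abs_increment_le (fun x => 2 * potential D F x - x * x)
    (fun x => 2 * wforce D F x - 2 * x) x (eps * Rabs x)).
  assert (H1 : Rabs (2 * potential D F x - x * x - (2 * potential D F 0 - 0 * 0))
    <= eps * Rabs x * Rabs x).
  { apply H; auto. intros y _. pose proof (is_derive_potential D F y) as Hp.
    auto_derive; [eexists; eassumption|].
    change (fun x => potential D F x) with (potential D F).
    rewrite (is_derive_unique _ _ _ Hp). ring. }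
  rewrite potential_0 in H1.
  replace (2 * potential D F x - x * x - (2 * 0 - 0 * 0))
    with (2 * potential D F x - x * x) in H1 by ring.
  replace (eps * (x * x)) with (eps * Rabs x * Rabs x); auto.
  rewrite Rmult_assoc, <- Rabs_mult, (Rabs_right (x * x)); [ring|nra].
Qed.

Lemma is_derive_amp_0 (D F : R) : -1 < D < 0 -> is_derive (amp D F) 0 1.
Proof.
  intros HD. apply is_derive_Reals. intros eps Heps.
  destruct (potential_quadratic_at_0 D F (eps / 2)) as [d [Hd Hq]]; [lra|].
  exists (mkposreal d Hd). intros h Hh Hhd. simpl in Hhd.
  rewrite Rplus_0_l, amp_0, Rminus_0_r.
  specialize (Hq h Hhd). rewrite <- (amp_sqr D F h HD) in Hq.
  set (a := amp D F h / h).
  assert (Ha0 : 0 < a).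
  { unfold a. destruct (Rlt_dec 0 h) as [Hp|Hp].
    - apply Rdiv_lt_0_compat; auto. now apply amp_pos.
    - assert (Hn : amp D F h < 0) by (apply amp_neg; lra).
      replace (amp D F h / h) with (- amp D F h / - h) by (field; auto).
      apply Rdiv_lt_0_compat; lra. }
  replace (amp D F h * amp D F h - h * h) with (h * h * ((a - 1) * (a + 1))) in Hq
    by (unfold a; field; auto).
  assert (Hhh : 0 < h * h) by nra.
  rewrite Rabs_mult, (Rabs_right (h * h)) in Hq by lra.
  assert (Hq' : Rabs ((a - 1) * (a + 1)) <= eps / 2) by nra.
  rewrite Rabs_mult, (Rabs_right (a + 1)) in Hq' by lra.
  pose proof (Rabs_pos (a - 1)). nra.
Qed.

Lemma is_derive_amp (D F x : R) : -1 < D < 0 ->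
  is_derive (amp D F) x (exp (F * x) / dens D F x).
Proof.
  intros HD. unfold dens. destruct (Req_EM_T x 0) as [->|Hx].
  - rewrite Rmult_0_r, exp_0. replace (1 / 1) with 1 by field. now apply is_derive_amp_0.
  - assert (Hfx := force_neq_0 D x HD Hx).
    pose proof (is_derive_potential D F x) as Hp.
    pose proof (potential_pos D F x HD Hx) as Hpp.
    assert (Hs : is_derive (fun y => sqrt (2 * potential D F y)) x
      (wforce D F x / sqrt (2 * potential D F x))).
    { auto_derive; [split; [eexists; eassumption|split; [lra|trivial]]|].
      change (fun x => potential D F x) with (potential D F).
      rewrite (is_derive_unique _ _ _ Hp). field. apply Rgt_not_eq, sqrt_lt_R0. lra. }
    assert (Hsp : 0 < sqrt (2 * potential D F x)) by (apply sqrt_lt_R0; lra).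
    assert (Hw : wforce D F x = exp (F * x) * exp (F * x) * force D x).
    { unfold wforce. rewrite <- exp_plus. f_equal. f_equal. ring. }
    pose proof (exp_pos (F * x)).
    rewrite exp_Ropp.
    destruct (Rlt_dec 0 x) as [Hx0|Hx0].
    + apply (is_derive_ext_loc (fun y => sqrt (2 * potential D F y))).
      { exists (mkposreal x Hx0). intros y Hy. unfold amp.
        apply ball_Rabs_lt in Hy; simpl in Hy.
        apply Rabs_def2 in Hy. destruct (Rle_dec 0 y); [reflexivity|lra]. }
      replace (exp (F * x) / (amp D F x * / exp (F * x) / force D x))
        with (wforce D F x / sqrt (2 * potential D F x)); auto.
      unfold amp. destruct (Rle_dec 0 x); [|lra]. rewrite Hw. field. repeat split; lra.
    + assert (Hx1 : 0 < - x) by lra.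
      apply (is_derive_ext_loc (fun y => - sqrt (2 * potential D F y))).
      { exists (mkposreal (- x) Hx1). intros y Hy. unfold amp.
        apply ball_Rabs_lt in Hy; simpl in Hy.
        apply Rabs_def2 in Hy. destruct (Rle_dec 0 y); [lra|reflexivity]. }
      replace (exp (F * x) / (amp D F x * / exp (F * x) / force D x))
        with (- (wforce D F x / sqrt (2 * potential D F x))).
      * apply (is_derive_opp (fun y => sqrt (2 * potential D F y))), Hs.
      * unfold amp. destruct (Rle_dec 0 x); [lra|]. rewrite Hw. field. repeat split; lra.
Qed.

Lemma amp_increasing (D F a b : R) : -1 < D < 0 -> a < b -> amp D F a < amp D F b.
Proof.
  intros HD Hab.
  destruct (MVT_cor2 (amp D F) (fun x => exp (F * x) / dens D F x) a b Hab) as [c [Hc1 Hc2]].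
  - intros. now apply is_derive_Reals, is_derive_amp.
  - assert (0 < exp (F * c) / dens D F c)
      by (apply Rdiv_lt_0_compat; [apply exp_pos|now apply dens_pos]). nra.
Qed.

Lemma is_lim_slope_0 (f : R -> R) (l : R) : f 0 = 0 -> is_derive f 0 l ->
  is_lim (fun x => f x / x) 0 l.
Proof.
  intros H0 Hd. apply is_derive_Reals in Hd. apply is_lim_spec. intros eps.
  destruct (Hd eps (cond_pos eps)) as [d Hdd]. exists d. intros y Hy Hy0.
  apply ball_Rabs_lt in Hy; simpl in Hy.
  specialize (Hdd y Hy0). rewrite Rplus_0_l, H0, Rminus_0_r in Hdd.
  apply Hdd. now rewrite Rminus_0_r in Hy.
Qed.

(** At the center the quotient is rewritten through [amp x / x] and [force x / x], both of which
    tend to 1. *)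
Lemma continuous_dens (D F x : R) : -1 < D < 0 -> continuous (dens D F) x.
Proof.
  intros HD. destruct (Req_dec x 0) as [->|Hx].
  - assert (Hl : is_lim (dens D F) 0 1).
    { apply (is_lim_ext_loc (fun x => amp D F x / x * exp (- (F * x)) / (force D x / x))).
      { exists (mkposreal 1 Rlt_0_1). intros y _ Hy. unfold dens.
        destruct (Req_EM_T y 0); [contradiction|]. field.
        split; auto. now apply force_neq_0. }
      replace (Finite 1) with (Rbar_div (Rbar_mult (Finite 1) (Finite 1)) (Finite 1))
        by (simpl; f_equal; field).
      apply is_lim_div.
      - apply is_lim_mult.
        + apply is_lim_slope_0; [apply amp_0|now apply is_derive_amp_0].
        + replace (Finite 1) with (Finite (exp (- (F * 0)))) by (rewrite Rmult_0_r, Ropp_0, exp_0; auto).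
          apply (is_lim_continuity (fun x => exp (- (F * x)))).
          apply continuity_pt_filterlim, (ex_derive_continuous (fun x => exp (- (F * x)))).
          auto_derive; trivial.
        + simpl; trivial.
      - apply is_lim_slope_0; [apply force_0|].
        replace 1 with (force' D 0); [apply is_derive_force|].
        unfold force'. rewrite Ropp_0, exp_0. ring.
      - intro H; injection H; lra.
      - simpl. lra. }
    apply continuity_pt_filterlim, continuity_pt_filterlim'.
    assert (Hd0 : dens D F 0 = 1) by (unfold dens; destruct (Req_EM_T 0 0); lra).
    rewrite Hd0. exact Hl.
  - apply (continuous_ext_loc _ (fun y => amp D F y * exp (- (F * y)) / force D y)).
    + assert (Hp : 0 < Rabs x) by now apply Rabs_pos_lt.
      exists (mkposreal _ Hp). intros y Hy.
      apply ball_Rabs_lt in Hy; simpl in Hy.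
      unfold dens. destruct (Req_EM_T y 0) as [Hy0|Hy0]; [|reflexivity].
      subst y. rewrite Rminus_0_l, Rabs_Ropp in Hy. lra.
    + apply (ex_derive_continuous (fun y => amp D F y * exp (- (F * y)) / force D y)).
      pose proof (is_derive_amp D F x HD). pose proof (is_derive_force D x).
      auto_derive. repeat split; try (eexists; eassumption). now apply force_neq_0.
Qed.

(** * Uniform estimates of the slope *)

(* The derivative of [dens * corr] with respect to [amp]. *)
Definition slope (D F x : R) : R :=
  exp (- (F * x)) / force D x * (corr D F x - 2 * potential D F x / wforce D F x *
    (F * corr D F x + force' D x / force D x * (2 * F * potential D F x + corr D F 0))).

Lemma is_derive_dens_corr (D F x : R) : -1 < D < 0 -> Rabs F <= 1 / 32 -> x <> 0 ->
  is_derive (fun y => dens D F y * corr D F y) x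
    (slope D F x * (exp (F * x) / dens D F x)).
Proof.
  intros HD HF Hx.
  apply (is_derive_ext_loc (fun y => amp D F y * exp (- (F * y)) / force D y * corr D F y)).
  { assert (Hp : 0 < Rabs x) by now apply Rabs_pos_lt.
    exists (mkposreal _ Hp). intros y Hy.
    apply ball_Rabs_lt in Hy; simpl in Hy.
    unfold dens. destruct (Req_EM_T y 0) as [Hy0|Hy0]; [|reflexivity].
    subst y. rewrite Rminus_0_l, Rabs_Ropp in Hy. lra. }
  pose proof (is_derive_amp D F x HD) as H1. pose proof (is_derive_force D x) as H2.
  pose proof (is_derive_corr D F x HF) as H3.
  pose proof (force_neq_0 D x HD Hx) as Hg.
  assert (Ha : amp D F x <> 0).
  { destruct (Rtotal_order x 0) as [H|[H|H]]; [|contradiction|].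
    - pose proof (amp_neg D F x HD H); lra.
    - pose proof (amp_pos D F x HD H); lra. }
  auto_derive; [repeat split; try (eexists; eassumption); auto|].
  change (fun x => amp D F x) with (amp D F). change (fun x => force D x) with (force D).
  change (fun x => corr D F x) with (corr D F).
  rewrite (is_derive_unique _ _ _ H1), (is_derive_unique _ _ _ H2), (is_derive_unique _ _ _ H3).
  unfold slope. rewrite <- (corr_plus_wforce D F x HF), <- (amp_sqr D F x HD).
  unfold dens. destruct (Req_EM_T x 0); [contradiction|].
  unfold wforce. replace (2 * F * x) with (F * x + F * x) by ring.
  rewrite exp_Ropp, exp_plus. pose proof (exp_pos (F * x)). field.
  repeat split; auto; lra.
Qed.

Lemma Rabs_mult_le (a b A B : R) : Rabs a <= A -> Rabs b <= B -> Rabs (a * b) <= A * B.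
Proof.
  intros. rewrite Rabs_mult. apply Rmult_le_compat; auto; apply Rabs_pos.
Qed.

Lemma Rabs_plus_le (a b A B : R) : Rabs a <= A -> Rabs b <= B -> Rabs (a + b) <= A + B.
Proof. intros. eapply Rle_trans; [apply Rabs_triang|]. lra. Qed.

Lemma Rabs_minus_le (a b A B : R) : Rabs a <= A -> Rabs b <= B -> Rabs (a - b) <= A + B.
Proof.
  intros. unfold Rminus. apply Rabs_plus_le; auto. now rewrite Rabs_Ropp.
Qed.

Lemma Rabs_div_le (a b A B : R) : Rabs a <= A -> 0 < B -> B <= Rabs b ->
  Rabs (a / b) <= A * / B.
Proof.
  intros Ha HB Hb. apply Rabs_mult_le; auto. rewrite Rabs_inv.
  now apply Rinv_le_contravar.
Qed.

Lemma exp_le_compat (x y : R) : x <= y -> exp x <= exp y.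
Proof. intros [H|H]; [left; now apply exp_increasing|subst; lra]. Qed.

Lemma Rabs_exp_le (x y : R) : x <= y -> Rabs (exp x) <= exp y.
Proof.
  intros H. rewrite Rabs_right; [now apply exp_le_compat|]. left. apply exp_pos.
Qed.

Lemma corr_abs_le (D F x : R) : -1 < D < 0 -> Rabs F <= 1 / 32 ->
  Rabs (corr D F x) <= 3 / 2 * exp (- ((1 - 2 * F) * x)) + 3 / 2 * exp (- (2 * (1 - F) * x)).
Proof.
  intros HD HF. apply Rabs_le_between in HF. unfold corr, Rdiv.
  set (A := exp _). set (B := exp (- (2 * (1 - F) * x))).
  assert (0 < A) by apply exp_pos. assert (0 < B) by apply exp_pos.
  apply Rabs_minus_le.
  - replace ((1 + 2 * D) * A * / (1 - 2 * F)) with ((1 + 2 * D) * / (1 - 2 * F) * A) by ring.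
    apply Rabs_mult_le; [|rewrite Rabs_right; lra].
    assert (0 < / (1 - 2 * F) <= 3 / 2).
    { split; [apply Rinv_0_lt_compat; lra|].
      replace (3 / 2) with (/ (2 / 3)) by field. apply Rinv_le_contravar; lra. }
    apply Rabs_le. nra.
  - replace (D * B * / (1 - F)) with (D * / (1 - F) * B) by ring.
    apply Rabs_mult_le; [|rewrite Rabs_right; lra].
    assert (0 < / (1 - F) <= 3 / 2).
    { split; [apply Rinv_0_lt_compat; lra|].
      replace (3 / 2) with (/ (2 / 3)) by field. apply Rinv_le_contravar; lra. }
    apply Rabs_le. nra.
Qed.

Lemma corr_0_abs_le (D F : R) : -1 < D < 0 -> Rabs F <= 1 / 32 -> Rabs (corr D F 0) <= 3.
Proof.
  intros HD HF. pose proof (corr_abs_le D F 0 HD HF) as H.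
  rewrite !Rmult_0_r, Ropp_0, exp_0 in H. lra.
Qed.

Lemma force'_abs_le (D x : R) : -1 < D < 0 ->
  Rabs (force' D x) <= exp (- x) * (1 + 2 * exp (- x)).
Proof.
  intros HD. unfold force'. pose proof (exp_pos (- x)) as He.
  apply Rabs_mult_le; [rewrite Rabs_right; lra|]. apply Rabs_le. nra.
Qed.

Lemma force_factor_ge (D d x : R) : -1 + d <= D <= - d ->
  d * (1 + exp (- x)) <= 1 + D - D * exp (- x).
Proof. intros HD. pose proof (exp_pos (- x)). nra. Qed.

Lemma force_factor_le (D x : R) : -1 < D < 0 ->
  1 + D - D * exp (- x) <= 1 + exp (- x).
Proof. intros HD. pose proof (exp_pos (- x)). nra. Qed.

Lemma force_le_1 (D x : R) : -1 < D < 0 -> 0 <= x -> 0 <= force D x <= 1.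
Proof.
  intros HD Hx. pose proof (exp_pos (- x)).
  assert (exp (- x) <= 1) by (apply exp_nonpos_le; lra). unfold force.
  assert (0 <= 1 + D - D * exp (- x) <= 1) by nra. nra.
Qed.

(** The weight [exp (2 F y)] is at most [exp (x / 16)], and the length [x] of the interval is at
    most [32 exp (x / 32)]. The bound [1 / 32] on [F] keeps this growth far below the decay of
    [force'] and [corr]. *)
Lemma potential_right_le (D F x : R) : -1 < D < 0 -> Rabs F <= 1 / 32 -> 0 <= x ->
  potential D F x <= 32 * exp (3 * x / 32).
Proof.
  intros HD HF Hx. apply Rabs_le_between in HF.
  assert (H := increment_le_everywhere (potential D F) (wforce D F) 0 x (exp (x / 16)) Hx).
  assert (H1 : potential D F x - potential D F 0 <= exp (x / 16) * (x - 0)).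
  { apply H; [intros; apply is_derive_potential|]. intros y Hy. unfold wforce.
    pose proof (force_le_1 D y HD) as Hf.
    assert (exp (2 * F * y) <= exp (x / 16)) by (apply exp_le_compat; nra).
    pose proof (exp_pos (2 * F * y)). nra. }
  rewrite potential_0 in H1.
  replace (3 * x / 32) with (x / 16 + x / 32) by field. rewrite exp_plus.
  pose proof (exp_ineq1_le (x / 32)). pose proof (exp_pos (x / 16)). nra.
Qed.

Lemma force_right_ge (D d x : R) : 0 < d -> -1 + d <= D <= - d -> 1 <= x ->
  d / 2 <= force D x.
Proof.
  intros Hd HD Hx. unfold force. pose proof (force_factor_ge D d x HD) as H1.
  assert (exp (- x) <= 1 / 2).
  { rewrite exp_Ropp. replace (1 / 2) with (/ 2) by field. apply Rinv_le_contravar; [lra|].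
    pose proof (exp_ineq1_le x). lra. }
  pose proof (exp_pos (- x)). nra.
Qed.

(** Every factor of [slope] is compared with an integer power of [T = exp (- x / 32)]. The decay of
    [corr] and [force'], about [T^30], outweighs the growth of the potential, of the weights and of
    the inverse of [wforce]. *)
Lemma slope_right_le (D F d x : R) : 0 < d <= 1 / 2 -> -1 + d <= D <= - d ->
  Rabs F <= 1 / 32 -> 1 <= x -> Rabs (slope D F x) <= 6500 * / d ^ 3 * exp (- x / 2).
Proof.
  intros Hd HD HF Hx.
  assert (HD' : -1 < D < 0) by lra.
  assert (HF' := proj1 (Rabs_le_between _ _) HF).
  set (T := exp (- x / 32)).
  assert (HT : 0 < T) by apply exp_pos.
  assert (HT1 : T <= 1) by (apply exp_nonpos_le; lra).
  assert (HTn : forall n, exp (- (INR n * x / 32)) = T ^ n).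
  { induction n as [|n IH].
    - simpl. replace (- (0 * x / 32)) with 0 by field. apply exp_0.
    - rewrite S_INR. replace (- ((INR n + 1) * x / 32)) with (- x / 32 + - (INR n * x / 32)) by field.
      rewrite exp_plus, IH. reflexivity. }
  assert (HTi : forall n, exp (INR n * x / 32) = / T ^ n).
  { intro n. rewrite <- HTn, exp_Ropp, Rinv_inv. reflexivity. }
  assert (Hg := force_right_ge D d x (proj1 Hd) HD Hx).
  assert (Hg0 : 0 < force D x) by lra.
  assert (B1 : Rabs (exp (- (F * x))) <= / T ^ 1).
  { rewrite <- HTi. apply Rabs_exp_le. simpl. nra. }
  assert (B2 : Rabs (corr D F x) <= 3 * T ^ 30).
  { eapply Rle_trans; [now apply corr_abs_le|]. rewrite <- HTn.
    assert (exp (- ((1 - 2 * F) * x)) <= exp (- (INR 30 * x / 32)))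
      by (apply exp_le_compat; simpl; nra).
    assert (exp (- (2 * (1 - F) * x)) <= exp (- (INR 30 * x / 32)))
      by (apply exp_le_compat; simpl; nra). lra. }
  assert (B3 : Rabs (force' D x) <= 3 * T ^ 32).
  { eapply Rle_trans; [now apply force'_abs_le|]. rewrite <- HTn.
    replace (INR 32 * x / 32) with x by (simpl; field).
    assert (exp (- x) <= 1) by (apply exp_nonpos_le; lra). pose proof (exp_pos (- x)). nra. }
  assert (B4 : Rabs (2 * potential D F x) <= 64 * / T ^ 3).
  { pose proof (potential_nonneg D F x HD'). rewrite Rabs_right by lra.
    assert (Hp := potential_right_le D F x HD' HF).
    rewrite <- HTi. replace (INR 3 * x / 32) with (3 * x / 32) by (simpl; field). lra. }
  assert (B5 : d / 2 * T ^ 2 <= Rabs (wforce D F x)).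
  { unfold wforce. rewrite Rabs_mult. rewrite (Rabs_right (force D x)) by lra.
    rewrite Rabs_right by (left; apply exp_pos). rewrite <- HTn.
    assert (exp (- (INR 2 * x / 32)) <= exp (2 * F * x)) by (apply exp_le_compat; simpl; nra).
    pose proof (exp_pos (- (INR 2 * x / 32))). nra. }
  assert (B6 : Rabs (corr D F x + wforce D F x) <= 4 * / T ^ 2).
  { replace (4 * / T ^ 2) with (3 * / T ^ 2 + / T ^ 2) by ring. apply Rabs_plus_le.
    - eapply Rle_trans; [exact B2|]. apply Rmult_le_compat_l; [lra|].
      apply Rle_trans with 1.
      + rewrite <- (pow1 30). apply pow_incr. lra.
      + rewrite <- Rinv_1. apply Rinv_le_contravar; [now apply pow_lt|].
        rewrite <- (pow1 2). apply pow_incr. lra.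
    - unfold wforce. rewrite <- HTi. rewrite <- Rmult_1_r. apply Rabs_mult_le.
      + apply Rabs_exp_le. simpl. nra.
      + pose proof (force_le_1 D x HD'). rewrite Rabs_right; lra. }
  assert (B7 : d / 2 <= Rabs (force D x)) by (rewrite Rabs_right; lra).
  unfold slope. rewrite <- (corr_plus_wforce D F x HF).
  assert (P2 : 0 < T ^ 2) by now apply pow_lt.
  assert (M1 := Rabs_div_le _ _ _ _ B1 (ltac:(lra) : 0 < d / 2) B7).
  assert (M2 := Rabs_div_le _ _ _ _ B4 (ltac:(nra) : 0 < d / 2 * T ^ 2) B5).
  assert (M3 := Rabs_mult_le _ _ _ _ (Rabs_div_le _ _ _ _ B3 (ltac:(lra) : 0 < d / 2) B7) B6).
  assert (M4 := Rabs_mult_le _ _ _ _ M2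
    (Rabs_plus_le _ _ _ _ (Rabs_mult_le _ _ _ _ HF B2) M3)).
  assert (M5 := Rabs_mult_le _ _ _ _ M1 (Rabs_minus_le _ _ _ _ B2 M4)).
  eapply Rle_trans; [exact M5|].
  replace (- x / 2) with (- (INR 16 * x / 32)) by (simpl; field). rewrite HTn.
  set (i := / d).
  (* The two contributions are of order [T^29] and [T^24]. Only [T^16 = exp (- x / 2)] is kept; the
     spare powers are bounded by 1. *)
  match goal with |- ?e <= _ => replace e with
    (2 * i * T ^ 16 * (3 * T ^ 13 + 128 * i * (3 / 32 * T ^ 8 + 24 * i * T ^ 8)))
    by (unfold i; field; lra) end.
  replace (6500 * / d ^ 3 * T ^ 16) with (T ^ 16 * (6500 * i ^ 3)) by (unfold i; field; lra).
  assert (Hi : 2 <= i).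
  { unfold i. replace 2 with (/ (1 / 2)) by field. apply Rinv_le_contravar; lra. }
  assert (T ^ 13 <= 1) by (rewrite <- (pow1 13); apply pow_incr; lra).
  assert (T ^ 8 <= 1) by (rewrite <- (pow1 8); apply pow_incr; lra).
  assert (0 < T ^ 16) by now apply pow_lt.
  assert (0 <= T ^ 8) by now apply pow_le; left.
  rewrite (Rmult_comm (2 * i)), Rmult_assoc.
  apply Rmult_le_compat_l; [lra|].
  assert (I1 : 3 / 32 * T ^ 8 + 24 * i * T ^ 8 <= 25 * i) by nra.
  assert (I2 : 3 * T ^ 13 + 128 * i * (3 / 32 * T ^ 8 + 24 * i * T ^ 8) <= 3 + 3200 * i ^ 2) by nra.
  assert (I3 : 3 + 3200 * i ^ 2 <= 3250 * i ^ 2) by nra.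
  assert (0 <= i ^ 2) by nra.
  nra.
Qed.

Lemma exp_INR_mult (L : R) (n : nat) : exp (INR n * L) = exp L ^ n.
Proof.
  induction n as [|n IH].
  - simpl. rewrite Rmult_0_l. apply exp_0.
  - rewrite S_INR. replace ((INR n + 1) * L) with (L + INR n * L) by ring.
    rewrite exp_plus, IH. reflexivity.
Qed.

Lemma force_abs_le (D L x : R) : -1 < D < 0 -> 0 <= L -> Rabs x <= L ->
  Rabs (force D x) <= 2 * exp L ^ 2 * Rabs x.
Proof.
  intros HD HL Hx.
  assert (HB : 1 <= exp L) by now apply exp_nonneg_ge.
  assert (H := abs_increment_le (fun y => - exp (- y)) (fun y => exp (- y)) x (exp L)).
  assert (H1 : Rabs (- exp (- x) - - exp (- 0)) <= exp L * Rabs x).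
  { apply H.
    - intros y _. auto_derive; [trivial|ring].
    - intros y Hy. apply Rabs_exp_le. pose proof (Rabs_le_between y (Rabs x)) as Hb.
      apply Hb in Hy. lra. }
  rewrite Ropp_0, exp_0 in H1. unfold force.
  replace (2 * exp L ^ 2 * Rabs x) with (exp L * Rabs x * (2 * exp L)) by ring.
  apply Rabs_mult_le.
  - replace (1 - exp (- x)) with (- exp (- x) - -1) by ring. exact H1.
  - pose proof (force_factor_pos D x HD). pose proof (force_factor_le D x HD).
    rewrite Rabs_right by lra.
    assert (exp (- x) <= exp L); [|lra].
    apply exp_le_compat. apply Rabs_le_between in Hx. lra.
Qed.

Lemma force_abs_ge (D d L x : R) : 0 < d -> -1 + d <= D <= - d -> 0 <= L -> Rabs x <= L ->
  d * / exp L * Rabs x <= Rabs (force D x).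
Proof.
  intros Hd HD HL Hx. unfold force. rewrite Rabs_mult.
  pose proof (force_factor_ge D d x HD) as Hf. pose proof (exp_pos (- x)) as He.
  rewrite (Rabs_right (1 + D - D * exp (- x))) by nra.
  assert (H1 : / exp L * Rabs x <= Rabs (1 - exp (- x))).
  { rewrite <- exp_Ropp. apply Rabs_le_between in Hx.
    assert (H := increment_ge_everywhere (fun y => - exp (- y)) (fun y => exp (- y))).
    destruct (Rle_dec 0 x) as [H0|H0].
    - assert (H1 : exp (- L) * (x - 0) <= - exp (- x) - - exp (- 0)).
      { apply H; [lra| |]; intros y Hy.
        - auto_derive; [trivial|ring].
        - apply exp_le_compat. lra. }
      rewrite Ropp_0, exp_0 in H1. rewrite (Rabs_right x) by lra.
      eapply Rle_trans; [|apply Rle_abs]. lra.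
    - assert (H1 : exp (- L) * (0 - x) <= - exp (- 0) - - exp (- x)).
      { apply H; [lra| |]; intros y Hy.
        - auto_derive; [trivial|ring].
        - apply exp_le_compat. lra. }
      rewrite Ropp_0, exp_0 in H1. rewrite (Rabs_left x) by lra.
      rewrite <- Rabs_Ropp. eapply Rle_trans; [|apply Rle_abs]. lra. }
  assert (H2 : d <= 1 + D - D * exp (- x)) by nra.
  assert (0 <= / exp L * Rabs x).
  { apply Rmult_le_pos; [left; apply Rinv_0_lt_compat, exp_pos|apply Rabs_pos]. }
  replace (d * / exp L * Rabs x) with (/ exp L * Rabs x * d) by ring.
  apply Rmult_le_compat; auto; lra.
Qed.

(* Near the center [slope] is a quotient of two cubic infinitesimals: the numerator is
   controlled by [wforce * force - 2 * potential * force'], whose derivative is O(x^2). *)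
Lemma slope_compact_le (D F d L x : R) : 0 < d -> -1 + d <= D <= - d ->
  Rabs F <= 1 / 32 -> 1 <= L -> Rabs x <= L -> x <> 0 ->
  Rabs (slope D F x) <= 124 * / d ^ 3 * exp L ^ 13 + 124 * / d ^ 2 * exp L ^ 13.
Proof.
  intros Hd HD HF HL Hx Hx0.
  assert (HD' : -1 < D < 0) by lra.
  assert (HF' := proj1 (Rabs_le_between _ _) HF).
  assert (HB : 1 <= exp L) by (apply exp_nonneg_ge; lra).
  assert (Hsmall : forall y c n, Rabs y <= L -> Rabs c <= INR n -> Rabs (exp (c * y)) <= exp L ^ n).
  { intros y c n Hy Hc. rewrite <- exp_INR_mult. apply Rabs_exp_le.
    apply Rle_trans with (Rabs (c * y)); [apply Rle_abs|].
    now apply Rabs_mult_le. }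
  set (B := exp L) in *.
  assert (Hforce' : forall y, Rabs y <= L -> Rabs (force' D y) <= 3 * B ^ 2).
  { intros y Hy. eapply Rle_trans; [now apply force'_abs_le|].
    assert (He : Rabs (exp (-1 * y)) <= B ^ 1)
      by (apply Hsmall; auto; simpl; rewrite Rabs_left; lra).
    replace (-1 * y) with (- y) in He by ring. pose proof (exp_pos (- y)).
    rewrite Rabs_right in He by lra. simpl in He. nra. }
  assert (Hexp2 : forall y, Rabs y <= L -> Rabs (exp (2 * F * y)) <= B).
  { intros y Hy. replace B with (B ^ 1) by ring. apply Hsmall; auto.
    simpl. apply Rabs_le. lra. }
  assert (Hw : forall y, Rabs y <= L -> Rabs (wforce D F y) <= 2 * B ^ 3 * Rabs y).
  { intros y Hy. replace (2 * B ^ 3 * Rabs y) with (B * (2 * B ^ 2 * Rabs y)) by ring.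
    unfold wforce. apply Rabs_mult_le; auto. apply force_abs_le; auto; lra. }
  assert (HV : forall y, Rabs y <= L -> Rabs (potential D F y) <= 2 * B ^ 3 * Rabs y * Rabs y).
  { intros y Hy. rewrite <- (Rminus_0_r (potential D F y)), <- (potential_0 D F).
    apply (abs_increment_le (potential D F) (wforce D F)).
    - intros; apply is_derive_potential.
    - intros z Hz. eapply Rle_trans; [apply Hw; lra|]. apply Rmult_le_compat_l; auto.
      apply Rmult_le_pos; [lra|]. apply pow_le; lra. }
  set (E1 := fun y => wforce D F y * force D y - 2 * potential D F y * force' D y).
  (* In the derivative the products of [wforce] and [force'] cancel, which leaves
     [2 F wforce force - 2 potential force''], quadratic in [y]. *)
  set (E1' := fun y => 2 * F * exp (2 * F * y) * force D y * force D y
    - 2 * potential D F y * (- exp (- y) * (1 + 2 * D) + 4 * D * exp (- y) * exp (- y))).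
  assert (HE : Rabs (E1 x) <= 24 * B ^ 5 * Rabs x * Rabs x * Rabs x).
  { assert (HE0 : E1 0 = 0) by (unfold E1, wforce; rewrite force_0, potential_0; ring).
    rewrite <- (Rminus_0_r (E1 x)), <- HE0.
    apply (abs_increment_le E1 E1').
    - intros y _. unfold E1, E1'.
      pose proof (is_derive_potential D F y) as H1. pose proof (is_derive_force D y) as H2.
      unfold wforce, force'. auto_derive.
      + repeat split; eexists; eassumption.
      + change (fun x => potential D F x) with (potential D F).
        change (fun x => force D x) with (force D).
        rewrite (is_derive_unique _ _ _ H1), (is_derive_unique _ _ _ H2).
        unfold wforce, force'. ring.
    - intros y Hy. assert (HyL : Rabs y <= L) by lra.
      apply Rle_trans with (24 * B ^ 5 * (Rabs y * Rabs y)).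
      2:{ rewrite !Rmult_assoc. apply Rmult_le_compat_l; [lra|].
          apply Rmult_le_compat_l; [apply pow_le; lra|].
          pose proof (Rabs_pos y). nra. }
      unfold E1'.
      replace (24 * B ^ 5 * (Rabs y * Rabs y)) with
        (1 * B * (2 * B ^ 2 * Rabs y) * (2 * B ^ 2 * Rabs y)
          + 2 * (2 * B ^ 3 * Rabs y * Rabs y) * (5 * B ^ 2)) by ring.
      assert (Hfy : Rabs (force D y) <= 2 * B ^ 2 * Rabs y) by (apply force_abs_le; auto; lra).
      apply Rabs_minus_le.
      + do 3 (apply Rabs_mult_le; auto). apply Rabs_le. lra.
      + apply Rabs_mult_le.
        * apply Rabs_mult_le; [rewrite Rabs_right; lra|auto].
        * assert (He : Rabs (exp (-1 * y)) <= B ^ 1)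
            by (apply Hsmall; auto; simpl; rewrite Rabs_left; lra).
          replace (-1 * y) with (- y) in He by ring. pose proof (exp_pos (- y)).
          rewrite Rabs_right in He by lra. simpl in He. rewrite Rmult_1_r in He.
          assert (exp (- y) * exp (- y) <= B * B) by (apply Rmult_le_compat; lra).
          apply Rabs_le. nra. }
  assert (Hq : Rabs (corr D F x) <= 4 * B ^ 3).
  { eapply Rle_trans; [now apply corr_abs_le|].
    assert (He1 : Rabs (exp (- (1 - 2 * F) * x)) <= B ^ 3)
      by (apply Hsmall; auto; simpl; apply Rabs_le; lra).
    assert (He2 : Rabs (exp (- (2 * (1 - F)) * x)) <= B ^ 3)
      by (apply Hsmall; auto; simpl; apply Rabs_le; lra).
    rewrite Rabs_right in He1 by (left; apply exp_pos).
    rewrite Rabs_right in He2 by (left; apply exp_pos).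
    replace (- (1 - 2 * F) * x) with (- ((1 - 2 * F) * x)) in He1 by ring.
    replace (- (2 * (1 - F)) * x) with (- (2 * (1 - F) * x)) in He2 by ring.
    assert (0 < B ^ 3) by (apply pow_lt; lra). lra. }
  assert (Hax : 0 < Rabs x) by now apply Rabs_pos_lt.
  set (a := Rabs x) in *.
  assert (Hg := force_abs_ge D d L x Hd HD (ltac:(lra)) Hx). fold B a in Hg.
  assert (Hgn := force_neq_0 D x HD' Hx0).
  assert (HG : d * / B ^ 2 * a <= Rabs (wforce D F x)).
  { unfold wforce. rewrite Rabs_mult.
    replace (d * / B ^ 2 * a) with (/ B * (d * / B * a)) by (field; lra).
    apply Rmult_le_compat; auto.
    - left; apply Rinv_0_lt_compat; lra.
    - apply Rmult_le_pos; [|lra]. apply Rmult_le_pos; [lra|].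
      left; apply Rinv_0_lt_compat; lra.
    - rewrite Rabs_right by (left; apply exp_pos).
      unfold B. rewrite <- exp_Ropp. apply exp_le_compat.
      assert (Rabs (2 * F * x) <= 1 * L).
      { apply Rabs_mult_le; auto. apply Rabs_le. lra. }
      apply Rabs_le_between in H. lra. }
  (* With [2 F potential + kappa] written as [corr + wforce], the bracket splits into a cubic over a
     quadratic term and a multiple of [potential / wforce]. Both are O(x), which compensates the
     division by [force]. *)
  assert (Hslope : slope D F x = exp (- F * x) / force D x * (corr D F x * E1 x /
     (wforce D F x * force D x) - 2 * potential D F x / wforce D F x *
     (F * corr D F x + exp (2 * F * x) * force' D x))).
  { unfold slope. rewrite <- (corr_plus_wforce D F x HF). unfold E1, wforce.
    replace (- (F * x)) with (- F * x) by ring. field.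
    split; auto. apply Rgt_not_eq, exp_pos. }
  rewrite Hslope.
  assert (P1 : 0 < d * / B * a).
  { apply Rmult_lt_0_compat; auto. apply Rmult_lt_0_compat; auto.
    apply Rinv_0_lt_compat; lra. }
  assert (P2 : 0 < d * / B ^ 2 * a).
  { apply Rmult_lt_0_compat; auto. apply Rmult_lt_0_compat; auto.
    apply Rinv_0_lt_compat, pow_lt; lra. }
  assert (B1 : Rabs (exp (- F * x)) <= B ^ 1).
  { apply Hsmall; auto. simpl. apply Rabs_le. lra. }
  assert (M1 := Rabs_div_le _ _ _ _ B1 P1 Hg).
  assert (HGg : d * / B ^ 2 * a * (d * / B * a) <= Rabs (wforce D F x * force D x)).
  { rewrite Rabs_mult. apply Rmult_le_compat; auto; lra. }
  assert (M2 := Rabs_div_le _ _ _ _ (Rabs_mult_le _ _ _ _ Hq HE)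
    (Rmult_lt_0_compat _ _ P2 P1) HGg).
  assert (H2V : Rabs (2 * potential D F x) <= 2 * (2 * B ^ 3 * a * a)).
  { apply Rabs_mult_le; [rewrite Rabs_right; lra|]. now apply HV. }
  assert (M3 := Rabs_div_le _ _ _ _ H2V P2 HG).
  assert (M4 : Rabs (F * corr D F x + exp (2 * F * x) * force' D x) <= 1 * (4 * B ^ 3) + B * (3 * B ^ 2)).
  { apply Rabs_plus_le; apply Rabs_mult_le; auto. apply Rabs_le; lra. }
  assert (M5 := Rabs_mult_le _ _ _ _ M1 (Rabs_minus_le _ _ _ _ M2 (Rabs_mult_le _ _ _ _ M3 M4))).
  eapply Rle_trans; [exact M5|].
  match goal with |- ?e <= _ => replace e with
    (96 * / d ^ 3 * B ^ 13 + 28 * / d ^ 2 * B ^ 10) by (field; repeat split; lra) end.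
  assert (0 < / d ^ 3) by (apply Rinv_0_lt_compat, pow_lt; lra).
  assert (0 < / d ^ 2) by (apply Rinv_0_lt_compat, pow_lt; lra).
  assert (B ^ 10 <= B ^ 13) by (apply Rle_pow; auto; lia).
  assert (0 < B ^ 10) by (apply pow_lt; lra).
  assert (28 * / d ^ 2 * B ^ 10 <= 124 * / d ^ 2 * B ^ 13) by nra.
  assert (96 * / d ^ 3 * B ^ 13 <= 124 * / d ^ 3 * B ^ 13) by nra.
  lra.
Qed.

Lemma wforce_left_bounds (D F d x : R) : 0 < d -> -1 + d <= D <= - d -> x <= -1 ->
  d / 2 * exp (- (2 * (1 - F) * x)) <= - wforce D F x <= exp (- (2 * (1 - F) * x)).
Proof.
  intros Hd HD Hx. set (X := exp (- x)).
  assert (HX : 2 <= X) by (unfold X; pose proof (exp_ineq1_le (- x)); lra).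
  pose proof (force_factor_ge D d x HD) as H1.
  pose proof (force_factor_le D x (ltac:(lra))) as H2. fold X in H1, H2.
  replace (exp (- (2 * (1 - F) * x))) with (exp (2 * F * x) * (X * X)).
  2:{ unfold X. rewrite <- !exp_plus. f_equal. ring. }
  assert (H3 : d / 2 * (X * X) <= - force D x <= X * X).
  { unfold force. fold X. set (f := 1 + D - D * X) in *.
    assert ((X - 1) * (d * (1 + X)) <= (X - 1) * f) by (apply Rmult_le_compat_l; lra).
    assert ((X - 1) * f <= (X - 1) * (1 + X)) by (apply Rmult_le_compat_l; lra).
    assert (d * 2 <= d * (X * X)) by (apply Rmult_le_compat_l; nra).
    split; lra. }
  pose proof (exp_pos (2 * F * x)). unfold wforce. nra.
Qed.

Lemma potential_left_le (D F x : R) : -1 < D < 0 -> Rabs F <= 1 / 32 -> x <= 0 ->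
  potential D F x <= exp (- (2 * (1 - F) * x)).
Proof.
  intros HD HF Hx. apply Rabs_le_between in HF.
  assert (H := increment_le_everywhere (fun y => exp (- (2 * (1 - F) * y)) - potential D F y)
    (fun y => - (2 * (1 - F)) * exp (- (2 * (1 - F) * y)) - wforce D F y) x 0 0 Hx).
  assert (H1 : exp (- (2 * (1 - F) * 0)) - potential D F 0
    - (exp (- (2 * (1 - F) * x)) - potential D F x) <= 0 * (0 - x)).
  { apply H.
    - intros y _. pose proof (is_derive_potential D F y) as Hp.
      auto_derive; [eexists; eassumption|].
      change (fun x => potential D F x) with (potential D F).
      rewrite (is_derive_unique _ _ _ Hp). ring.
    - intros y Hy. set (X := exp (- y)).
      assert (HX : 1 <= X) by (apply exp_nonneg_ge; lra).
      replace (exp (- (2 * (1 - F) * y))) with (exp (2 * F * y) * (X * X)).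
      2:{ unfold X. rewrite <- !exp_plus. f_equal. ring. }
      pose proof (force_factor_pos D y HD). pose proof (force_factor_le D y HD).
      unfold wforce, force. fold X in H0, H1 |- *. pose proof (exp_pos (2 * F * y)).
      set (f := 1 + D - D * X) in *. assert (Hff : - ((1 - X) * f) <= X * X) by nra.
      assert (0 <= exp (2 * F * y) * (2 * (1 - F) * (X * X) + (1 - X) * f)); [|lra].
      apply Rmult_le_pos; [lra|]. assert (0 < X * X) by nra. nra. }
  rewrite potential_0, Rmult_0_r, Ropp_0, exp_0 in H1. lra.
Qed.

(** The true growth is like [exp (- 2 (1 - F) x)], but the rate [exp (- x)] suffices. The threshold
    6 lets half of [d / 8 exp (- x)] absorb the boundary term at [-1], using [exp 1 <= 3]. *)
Lemma potential_left_ge (D F d x : R) : 0 < d -> -1 + d <= D <= - d -> Rabs F <= 1 / 32 ->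
  6 <= exp (- x) -> d / 16 * exp (- x) <= potential D F x.
Proof.
  intros Hd HD HF Hx. apply Rabs_le_between in HF.
  assert (He3 : exp 1 <= 3) by apply exp_le_3.
  assert (Hx1 : x <= -1).
  { destruct (Rle_dec x (-1)); auto.
    assert (exp (- x) <= exp 1) by (apply exp_le_compat; lra). lra. }
  assert (H := increment_le_everywhere (fun y => potential D F y - d / 8 * exp (- y))
    (fun y => wforce D F y + d / 8 * exp (- y)) x (-1) 0 Hx1).
  assert (H1 : potential D F (-1) - d / 8 * exp (- -1)
    - (potential D F x - d / 8 * exp (- x)) <= 0 * (-1 - x)).
  { apply H.
    - intros y _. pose proof (is_derive_potential D F y) as Hp.
      auto_derive; [eexists; eassumption|].
      change (fun x => potential D F x) with (potential D F).
      rewrite (is_derive_unique _ _ _ Hp). ring.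
    - intros y Hy. assert (Hb := wforce_left_bounds D F d y Hd HD (ltac:(lra))).
      assert (exp (- y) <= exp (- (2 * (1 - F) * y))) by (apply exp_le_compat; nra).
      pose proof (exp_pos (- y)). nra. }
  replace (- -1) with 1 in H1 by ring.
  pose proof (potential_nonneg D F (-1) (ltac:(lra))). nra.
Qed.

(** Far to the left [corr] is at least [d / 2] times [A = exp (2 F x) X^2], where [X = exp (- x)],
    while [|force| <= X^2]. The subtracted term of [slope] is at most half of [corr], so the sign
    and the size are those of [exp (- F x) corr / (2 force)]. *)
Lemma slope_left_le (D F d x : R) : 0 < d <= 1 / 2 -> -1 + d <= D <= - d ->
  Rabs F <= d ^ 3 / 400 -> 1000 / d ^ 3 <= exp (- x) ->
  slope D F x <= - (d / 4 * exp (F * x)).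
Proof.
  intros Hd HD HFs HX.
  assert (HD' : -1 < D < 0) by lra.
  assert (Hd3 : 0 < d ^ 3 <= 1 / 8) by (split; [apply pow_lt; lra|nra]).
  assert (HF : Rabs F <= 1 / 32) by lra.
  assert (HF' := proj1 (Rabs_le_between _ _) HF).
  assert (HXd : 1000 <= exp (- x) * d ^ 3).
  { apply (Rmult_le_reg_r (/ d ^ 3)); [apply Rinv_0_lt_compat; lra|].
    rewrite Rmult_assoc, Rinv_r, Rmult_1_r by lra. exact HX. }
  set (X := exp (- x)) in *.
  assert (HX0 : 0 < X) by apply exp_pos.
  assert (HX1 : 8000 <= X) by nra.
  assert (Hx1 : x <= -1).
  { destruct (Rle_dec x (-1)); auto.
    assert (exp (- x) <= exp 1) by (apply exp_le_compat; lra).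
    pose proof exp_le_3. unfold X in *. lra. }
  assert (Hwb := wforce_left_bounds D F d x (proj1 Hd) HD Hx1).
  set (A := exp (- (2 * (1 - F) * x))) in *.
  assert (HA0 : 0 < A) by apply exp_pos.
  assert (HAX : X <= A) by (apply exp_le_compat; nra).
  assert (HA : A = exp (2 * F * x) * (X * X)).
  { unfold A, X. rewrite <- !exp_plus. f_equal. ring. }
  assert (Hq : A * (d / 2) <= corr D F x).
  { unfold corr. fold A.
    replace (exp (- ((1 - 2 * F) * x))) with (A * / X).
    2:{ unfold A, X. rewrite <- exp_Ropp, <- exp_plus. f_equal. ring. }
    assert (HiX : 0 < / X) by now apply Rinv_0_lt_compat.
    assert (HiX2 : / X <= d / 100).
    { replace (d / 100) with (/ (100 / d)) by (field; lra).
      apply Rinv_le_contravar.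
      - apply Rdiv_lt_0_compat; lra.
      - apply (Rmult_le_reg_r d); [lra|]. unfold Rdiv.
        rewrite Rmult_assoc, Rinv_l, Rmult_1_r by lra. nra. }
    assert (Hi1 : 0 < / (1 - 2 * F) <= 2).
    { split; [apply Rinv_0_lt_compat; lra|].
      replace 2 with (/ (1 / 2)) at 2 by field. apply Rinv_le_contravar; lra. }
    assert (Hi2 : 3 / 4 <= / (1 - F)).
    { replace (3 / 4) with (/ (4 / 3)) by field. apply Rinv_le_contravar; lra. }
    replace ((1 + 2 * D) * (A * / X) / (1 - 2 * F) - D * A / (1 - F))
      with (A * ((1 + 2 * D) * (/ X * / (1 - 2 * F)) + - D * / (1 - F))) by (field; lra).
    apply Rmult_le_compat_l; [lra|].
    assert (0 <= / X * / (1 - 2 * F) <= d / 50) by nra. nra. }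
  assert (HV0 := potential_nonneg D F x HD').
  assert (HV := potential_left_le D F x HD' HF (ltac:(lra))). fold A in HV.
  assert (Hgneg := force_neg D x HD' (ltac:(lra))).
  assert (Hk0 := corr_0_abs_le D F HD' HF).
  assert (Hgb : d / 2 * (X * X) <= - force D x <= X * X).
  { pose proof (exp_pos (2 * F * x)) as He. unfold wforce in Hwb. rewrite HA in Hwb.
    split; nra. }
  set (i := / d).
  assert (Hid : i * d = 1) by (unfold i; field; lra).
  assert (Hi : 2 <= i) by nra.
  set (q := corr D F x) in *. set (V := potential D F x) in *.
  assert (Hq0 : 0 < q) by nra.
  assert (R1 : Rabs (2 * V / wforce D F x) <= 4 * i).
  { assert (HVa : Rabs (2 * V) <= 2 * A) by (rewrite Rabs_right; lra).
    eapply Rle_trans.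
    - apply (Rabs_div_le _ _ _ (d / 2 * A) HVa); [nra|]. rewrite Rabs_left; nra.
    - right. unfold i. field. lra. }
  assert (R2 : Rabs (force' D x / force D x) <= 6 * i).
  { assert (Hf : Rabs (force' D x) <= 3 * (X * X)).
    { eapply Rle_trans; [now apply force'_abs_le|]. fold X. nra. }
    eapply Rle_trans.
    - apply (Rabs_div_le _ _ _ (d / 2 * (X * X)) Hf); [nra|]. rewrite Rabs_left; lra.
    - right. unfold i. field. lra. }
  assert (Hf0 := Rabs_pos F). set (f := Rabs F) in *.
  assert (R3 : Rabs (2 * F * V + corr D F 0) <= f * (4 * i * q) + 3).
  { apply Rabs_plus_le; auto.
    replace (2 * F * V) with (F * (2 * V)) by ring. apply Rabs_mult_le; [unfold f; lra|].
    rewrite Rabs_right by lra. assert (A <= 2 * i * q); [|lra].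
    apply (Rmult_le_reg_r (d / 2)); [lra|].
    replace (2 * i * q * (d / 2)) with (i * d * q) by field. rewrite Hid. lra. }
  assert (R4 : Rabs (F * q) <= f * q).
  { apply Rabs_mult_le; [unfold f; lra|rewrite Rabs_right; lra]. }
  assert (R5 := Rabs_mult_le _ _ _ _ R1 (Rabs_plus_le _ _ _ _ R4 (Rabs_mult_le _ _ _ _ R2 R3))).
  assert (Hfi : f * i ^ 3 <= 1 / 400).
  { assert (i ^ 3 * d ^ 3 = 1) by (rewrite <- Rpow_mult_distr, Hid; ring).
    assert (0 < i ^ 3) by (apply pow_lt; lra). nra. }
  assert (Hqbig : 288 * i ^ 2 <= q).
  { assert (HX3 : 1000 * i ^ 3 <= X).
    { apply (Rmult_le_reg_r (d ^ 3)); [lra|].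
      replace (1000 * i ^ 3 * d ^ 3) with (1000 * (i * d) ^ 3) by ring.
      rewrite Hid. lra. }
    assert (500 * i ^ 2 <= X * (d / 2)).
    { replace (500 * i ^ 2) with (1000 * i ^ 2 * (i * d) / 2) by (rewrite Hid; field). nra. }
    assert (0 <= i ^ 2) by nra. nra. }
  set (br := 2 * V / wforce D F x * (F * q + force' D x / force D x * (2 * F * V + corr D F 0))) in *.
  (* The subtracted term is at most [f q (4 i + 96 i^3) + 72 i^2]. Smallness of [F] makes the first
     part at most [q / 4], and [q >= 288 i^2] does the same for the second; this dictates the
     constants 400 and 1000 of the statement. *)
  assert (Hbr : q / 2 <= q - br).
  { apply Rabs_le_between in R5.
    assert (4 * i * (f * q + 6 * i * (f * (4 * i * q) + 3)) <= q / 2); [|lra].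
    replace (4 * i * (f * q + 6 * i * (f * (4 * i * q) + 3)))
      with (q * (f * (4 * i + 96 * i ^ 3)) + 72 * i ^ 2) by ring.
    assert (4 * i + 96 * i ^ 3 <= 100 * i ^ 3) by nra.
    assert (f * (4 * i + 96 * i ^ 3) <= 1 / 4) by nra. nra. }
  assert (Hs : slope D F x = - (exp (- (F * x)) * (/ (- force D x) * (q - br)))).
  { unfold slope. fold q V br. field. lra. }
  rewrite Hs. apply Ropp_le_contravar.
  assert (Hig : / (X * X) <= / - force D x) by (apply Rinv_le_contravar; nra).
  replace (exp (F * x)) with (exp (- (F * x)) * exp (2 * F * x)).
  2:{ rewrite <- exp_plus. f_equal. ring. }
  replace (d / 4 * (exp (- (F * x)) * exp (2 * F * x)))
    with (exp (- (F * x)) * (/ (X * X) * (A * (d / 2) / 2))) by (rewrite HA; field; lra).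
  apply Rmult_le_compat_l; [left; apply exp_pos|].
  assert (0 < / (X * X)) by (apply Rinv_0_lt_compat; nra).
  apply Rmult_le_compat; nra.
Qed.

(** The slopes at [x2] and [x1] are those of [wcorr] at [w] and [-w], so their difference is the
    derivative of the symmetrized integrand. The one-sided bounds by [C0] serve for small [w], the
    lower bound [c / w] for large [w]. *)
Lemma slope_difference_bounds (d : R) : 0 < d <= 1 / 2 ->
  exists C0 c w0 dl, 0 < C0 /\ 0 < c /\ 0 < w0 /\ 0 < dl <= 1 / 32 /\
  forall D F, -1 + d <= D <= - d -> Rabs F <= dl ->
    (forall x, 0 < x -> - C0 <= slope D F x) /\
    (forall x, x < 0 -> slope D F x <= C0) /\
    (forall x1 x2, x1 < 0 -> 0 < x2 -> amp D F x1 = - amp D F x2 -> w0 <= amp D F x2 ->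
       c / amp D F x2 <= slope D F x2 - slope D F x1).
Proof.
  intros Hd.
  assert (Hd3 : 0 < d ^ 3 <= 1 / 8) by (split; [apply pow_lt; lra|nra]).
  assert (Hd5 : 0 < d ^ 5) by (apply pow_lt; lra).
  set (X1 := 1000 / d ^ 3).
  assert (HX1 : 8000 <= X1).
  { unfold X1, Rdiv. assert (8 <= / d ^ 3); [|lra].
    replace 8 with (/ (1 / 8)) by field. apply Rinv_le_contravar; lra. }
  set (L := ln X1).
  assert (HeL : exp L = X1) by (apply exp_ln; lra).
  assert (HL : 1 <= L).
  { destruct (Rle_dec 1 L); auto. assert (exp L <= exp 1) by (apply exp_le_compat; lra).
    pose proof exp_le_3. lra. }
  set (C1 := 124 * / d ^ 3 * exp L ^ 13 + 124 * / d ^ 2 * exp L ^ 13).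
  assert (Hi3 : 0 < / d ^ 3) by (apply Rinv_0_lt_compat; lra).
  assert (Hi2 : 0 < / d ^ 2) by (apply Rinv_0_lt_compat, pow_lt; lra).
  assert (HC1 : 0 < C1).
  { unfold C1. assert (0 < exp L ^ 13) by apply pow_lt, exp_pos.
    apply Rplus_lt_0_compat; apply Rmult_lt_0_compat; auto; lra. }
  set (xs := 10000000 / d ^ 5).
  assert (Hxs : 1 <= xs).
  { unfold xs, Rdiv. assert (1 <= / d ^ 5); [|lra].
    rewrite <- Rinv_1. apply Rinv_le_contravar; auto.
    rewrite <- (pow1 5). apply pow_incr. lra. }
  (* An amplitude of at least [8 exp xs + 2 X1^3] forces both [x2 >= xs] and [exp (- x1) >= X1].
     There the left slope contributes at least [(d^2 / 32) / w], and [xs] is large enough for the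
     right slope to spoil at most half of it, whence [d^2 / 64]. *)
  exists (C1 + 6500 * / d ^ 3), (d ^ 2 / 64), (8 * exp xs + 2 * X1 ^ 3), (d ^ 3 / 400).
  assert (HX13 : 0 < X1 ^ 3) by (apply pow_lt; lra).
  assert (Hexs : 1 <= exp xs) by (apply exp_nonneg_ge; lra).
  split; [lra|]. split; [nra|]. split; [lra|]. split; [lra|].
  intros D F HD HFs.
  assert (HD' : -1 < D < 0) by lra.
  assert (HF : Rabs F <= 1 / 32) by lra.
  assert (HF' := proj1 (Rabs_le_between _ _) HF).
  split; [|split].
  - intros x Hx. destruct (Rle_dec x 1) as [H1|H1].
    + assert (H : Rabs (slope D F x) <= C1).
      { apply slope_compact_le; auto; try lra. rewrite Rabs_right; lra. }
      apply Rabs_le_between in H. lra.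
    + assert (H := slope_right_le D F d x Hd HD HF (ltac:(lra))).
      assert (exp (- x / 2) <= 1) by (apply exp_nonpos_le; lra).
      pose proof (exp_pos (- x / 2)). apply Rabs_le_between in H.
      assert (6500 * / d ^ 3 * exp (- x / 2) <= 6500 * / d ^ 3 * 1)
        by (apply Rmult_le_compat_l; lra). lra.
  - intros x Hx. destruct (Rle_dec X1 (exp (- x))) as [H1|H1].
    + assert (H := slope_left_le D F d x Hd HD HFs H1). pose proof (exp_pos (F * x)). nra.
    + assert (HxL : - x <= L).
      { destruct (Rle_dec (- x) L); auto.
        assert (exp L <= exp (- x)) by (apply exp_le_compat; lra). lra. }
      assert (H : Rabs (slope D F x) <= C1).
      { apply slope_compact_le; auto; try lra. rewrite Rabs_left; lra. }
      apply Rabs_le_between in H. lra.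
  - intros x1 x2 Hx1 Hx2 Ham Hw.
    assert (Hw1 := amp_sqr D F x1 HD'). assert (Hw2 := amp_sqr D F x2 HD').
    rewrite Ham in Hw1. set (w := amp D F x2) in *.
    assert (HxsX : xs <= x2).
    { destruct (Rle_dec xs x2); auto. exfalso.
      pose proof (potential_right_le D F x2 HD' HF (ltac:(lra))) as HV.
      assert (exp (3 * x2 / 32) <= exp xs) by (apply exp_le_compat; lra).
      assert (8 * exp xs * (8 * exp xs) <= w * w) by (apply Rmult_le_compat; lra).
      nra. }
    assert (HxX1 : X1 <= exp (- x1)).
    { destruct (Rle_dec X1 (exp (- x1))) as [|H1]; auto. exfalso.
      pose proof (potential_left_le D F x1 HD' HF (ltac:(lra))) as HV.
      assert (exp (- (2 * (1 - F) * x1)) <= exp (INR 3 * - x1))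
        by (apply exp_le_compat; simpl; nra).
      rewrite exp_INR_mult in H.
      assert (exp (- x1) ^ 3 <= X1 ^ 3) by (apply pow_incr; pose proof (exp_pos (- x1)); lra).
      nra. }
    assert (Hwpos : 8 <= w) by lra.
    assert (H1 := slope_left_le D F d x1 Hd HD HFs HxX1).
    assert (H2 := slope_right_le D F d x2 Hd HD HF (ltac:(lra))).
    assert (G1 : d ^ 2 / 32 <= d / 4 * exp (F * x1) * w).
    (* The weight [exp (F x1)] has no uniform positive lower bound when [F > 0]; multiplied by [w]
       it does, because [exp (- 2 F x1) <= exp (- x1)] while [w^2] grows at least like
       [exp (- x1)]. *)
    { assert (Hq : d / 8 * exp (- (F * x1)) <= w).
      { assert (HV := potential_left_ge D F d x1 (proj1 Hd) HD HF (ltac:(lra))).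
        assert (He : exp (- (F * x1)) * exp (- (F * x1)) <= exp (- x1)).
        { rewrite <- exp_plus. apply exp_le_compat. nra. }
        set (e := exp (- (F * x1))) in *. assert (0 < e) by apply exp_pos.
        apply Rsqr_incr_0_var; [|lra]. unfold Rsqr.
        assert (d / 8 * (e * e) <= w * w) by nra.
        assert (0 < e * e) by nra.
        assert (d / 8 * d / 8 * (e * e) <= d / 8 * (e * e))
          by (apply Rmult_le_compat_r; nra).
        lra. }
      assert (He : exp (F * x1) * exp (- (F * x1)) = 1).
      { rewrite <- exp_plus, Rplus_opp_r. apply exp_0. }
      pose proof (exp_pos (F * x1)).
      assert (exp (F * x1) * (d / 8 * exp (- (F * x1))) <= exp (F * x1) * w)
        by (apply Rmult_le_compat_l; lra).
      assert (d / 8 <= exp (F * x1) * w).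
      { replace (d / 8) with (d / 8 * (exp (F * x1) * exp (- (F * x1)))) by (rewrite He; ring).
        lra. }
      nra. }
    assert (G2 : Rabs (slope D F x2) * w <= d ^ 2 / 64).
    { assert (Hwle : w <= 8 * exp (x2 / 16)).
      { pose proof (potential_right_le D F x2 HD' HF (ltac:(lra))) as HV.
        assert (exp (3 * x2 / 32) <= exp (x2 / 16) * exp (x2 / 16)).
        { rewrite <- exp_plus. apply exp_le_compat. lra. }
        pose proof (exp_pos (x2 / 16)).
        apply Rsqr_incr_0_var; [|lra]. unfold Rsqr. lra. }
      apply Rle_trans with (6500 * / d ^ 3 * exp (- x2 / 2) * (8 * exp (x2 / 16))).
      { apply Rmult_le_compat; auto; [apply Rabs_pos|lra]. }
      replace (6500 * / d ^ 3 * exp (- x2 / 2) * (8 * exp (x2 / 16)))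
        with (52000 * / d ^ 3 * (exp (- x2 / 2) * exp (x2 / 16))) by ring.
      rewrite <- exp_plus. replace (- x2 / 2 + x2 / 16) with (- (7 * x2 / 16)) by field.
      rewrite exp_Ropp.
      assert (Hin : / exp (7 * x2 / 16) <= d ^ 5 / 4000000).
      { replace (d ^ 5 / 4000000) with (/ (4000000 / d ^ 5)) by (field; lra).
        apply Rinv_le_contravar.
        - apply Rdiv_lt_0_compat; lra.
        - pose proof (exp_ineq1_le (7 * x2 / 16)). unfold xs in HxsX.
          assert (0 < / d ^ 5) by now apply Rinv_0_lt_compat. unfold Rdiv in *. lra. }
      apply Rle_trans with (52000 * / d ^ 3 * (d ^ 5 / 4000000)).
      - apply Rmult_le_compat_l; lra.
      - replace (52000 * / d ^ 3 * (d ^ 5 / 4000000)) with (d ^ 2 * (52000 / 4000000))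
          by (field; lra).
        nra. }
    apply (Rmult_le_reg_r w); [lra|].
    replace (d ^ 2 / 64 / w * w) with (d ^ 2 / 64) by (field; lra).
    assert (G3 : - (d ^ 2 / 64) <= slope D F x2 * w).
    { pose proof (Rle_abs (- slope D F x2)) as Hn. rewrite Rabs_Ropp in Hn. nra. }
    assert (G4 : d ^ 2 / 32 <= - slope D F x1 * w) by nra.
    lra.
Qed.

(** * Inverting the amplitude *)

(* Inverse of [amp]; junk outside the range of [amp], which is bounded above when [F < 0]. *)
Definition xpos (D F w : R) : R := epsilon (inhabits 0) (fun x => amp D F x = w).
Definition wdens (D F w : R) : R := dens D F (xpos D F w).
Definition wcorr (D F w : R) : R := wdens D F w * corr D F (xpos D F w).

Lemma amp_inj (D F x y : R) : -1 < D < 0 -> amp D F x = amp D F y -> x = y.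
Proof.
  intros HD H. destruct (Rtotal_order x y) as [H1|[H1|H1]]; auto;
    apply (amp_increasing D F) in H1; auto; lra.
Qed.

Lemma amp_reflects_lt (D F x y : R) : -1 < D < 0 -> amp D F x < amp D F y -> x < y.
Proof.
  intros HD H. destruct (Rtotal_order x y) as [H1|[H1|H1]]; auto; [subst; lra|].
  apply (amp_increasing D F) in H1; auto; lra.
Qed.

Lemma xpos_amp (D F x : R) : -1 < D < 0 -> xpos D F (amp D F x) = x.
Proof.
  intros HD. apply (amp_inj D F); auto. unfold xpos. apply epsilon_spec. now exists x.
Qed.

Lemma continuous_amp (D F x : R) : -1 < D < 0 -> continuous (amp D F) x.
Proof.
  intros HD. apply (ex_derive_continuous (amp D F)). eexists. now apply is_derive_amp.
Qed.

Lemma amp_unbounded_left (D F M : R) : -1 < D < 0 -> Rabs F <= 1 / 32 ->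
  exists a, amp D F a < - M.
Proof.
  intros HD HF. set (d := Rmin (1 + D) (- D)).
  assert (Hd : 0 < d) by (apply Rmin_pos; lra).
  assert (HDd : -1 + d <= D <= - d).
  { pose proof (Rmin_l (1 + D) (- D)). pose proof (Rmin_r (1 + D) (- D)). fold d in H, H0. lra. }
  set (X := 6 + 8 * (M * M + 1) / d).
  assert (HX : 6 <= X).
  { unfold X. assert (0 < 8 * (M * M + 1) / d) by (apply Rdiv_lt_0_compat; nra). lra. }
  exists (- ln X).
  assert (He : exp (- - ln X) = X) by (rewrite Ropp_involutive; apply exp_ln; lra).
  assert (Hn : - ln X < 0).
  { assert (0 < ln X); [|lra]. rewrite <- ln_1. apply ln_increasing; lra. }
  assert (HV := potential_left_ge D F d (- ln X) Hd HDd HF (ltac:(lra))).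
  rewrite He in HV. assert (Hs := amp_sqr D F (- ln X) HD).
  assert (Ha := amp_neg D F (- ln X) HD Hn).
  assert (HdX : 8 * (M * M + 1) <= d * X).
  { unfold X. replace (d * (6 + 8 * (M * M + 1) / d)) with (6 * d + 8 * (M * M + 1)) by (field; lra).
    lra. }
  set (a := amp D F (- ln X)) in *. nra.
Qed.

(** The point [b] certifies that [w] lies below the supremum of [amp], which is finite when [F < 0];
    on the left the range is unbounded. The same parameter [b] plays this role in the following
    lemmas. *)
Lemma amp_xpos (D F b w : R) : -1 < D < 0 -> Rabs F <= 1 / 32 -> w < amp D F b ->
  amp D F (xpos D F w) = w.
Proof.
  intros HD HF Hw. unfold xpos. apply (epsilon_spec (inhabits 0) (fun x => amp D F x = w)).
  destruct (amp_unbounded_left D F (- w) HD HF) as [a Ha].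
  destruct (IVT_gen (amp D F) a b w) as [x [_ Hx]].
  - intros x. apply continuity_pt_filterlim. now apply continuous_amp.
  - rewrite Rmin_left, Rmax_right; lra.
  - now exists x.
Qed.

Lemma is_derive_xpos (D F b w : R) : -1 < D < 0 -> Rabs F <= 1 / 32 -> w < amp D F b ->
  is_derive (xpos D F) w (exp (- (F * xpos D F w)) * wdens D F w).
Proof.
  intros HD HF Hw. pose proof (amp_xpos D F b w HD HF Hw) as Hinv.
  unfold wdens. set (x := xpos D F w) in *. rewrite <- Hinv.
  pose proof (dens_pos D F x HD) as Hd. pose proof (exp_pos (F * x)) as He.
  replace (exp (- (F * x)) * dens D F x) with (/ (exp (F * x) / dens D F x)).
  2:{ rewrite exp_Ropp. field. lra. }
  apply is_derive_inverse.
  - intros; now apply amp_increasing.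
  - now apply is_derive_amp.
  - apply Rgt_not_eq, Rdiv_lt_0_compat; auto.
  - rewrite Hinv. assert (Hp : 0 < amp D F b - w) by lra.
    exists (mkposreal _ Hp). intros y Hy. apply (amp_xpos D F b); auto.
    apply ball_Rabs_lt in Hy; simpl in Hy.
    apply Rabs_def2 in Hy. lra.
Qed.

Lemma continuous_xpos (D F b w : R) : -1 < D < 0 -> Rabs F <= 1 / 32 -> w < amp D F b ->
  continuous (xpos D F) w.
Proof.
  intros. apply (ex_derive_continuous (xpos D F)). eexists. now apply (is_derive_xpos D F b).
Qed.

Lemma continuous_wdens (D F b w : R) : -1 < D < 0 -> Rabs F <= 1 / 32 -> w < amp D F b ->
  continuous (wdens D F) w.
Proof.
  intros. unfold wdens. apply (continuous_comp (xpos D F) (dens D F)).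
  - now apply (continuous_xpos D F b).
  - now apply continuous_dens.
Qed.

Lemma wdens_pos (D F w : R) : -1 < D < 0 -> 0 < wdens D F w.
Proof. intros. now apply dens_pos. Qed.

Lemma continuous_wcorr (D F b w : R) : -1 < D < 0 -> Rabs F <= 1 / 32 -> w < amp D F b ->
  continuous (wcorr D F) w.
Proof.
  intros HD HF Hw. apply (continuous_mult (wdens D F) (fun w => corr D F (xpos D F w))).
  - now apply (continuous_wdens D F b).
  - apply (continuous_comp (xpos D F) (corr D F)).
    + now apply (continuous_xpos D F b).
    + apply (ex_derive_continuous (corr D F)). eexists. now apply is_derive_corr.
Qed.

Lemma is_derive_wcorr (D F b w : R) : -1 < D < 0 -> Rabs F <= 1 / 32 -> w < amp D F b ->
  w <> 0 -> is_derive (wcorr D F) w (slope D F (xpos D F w)).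
Proof.
  intros HD HF Hw Hw0. pose proof (amp_xpos D F b w HD HF Hw) as Hinv.
  set (x := xpos D F w) in *.
  assert (Hx : x <> 0) by (intro Hx; rewrite Hx, amp_0 in Hinv; auto).
  replace (slope D F x) with
    (exp (- (F * x)) * wdens D F w * (slope D F x * (exp (F * x) / dens D F x))).
  - apply (is_derive_comp (fun y => dens D F y * corr D F y) (xpos D F)).
    + fold x. now apply is_derive_dens_corr.
    + now apply (is_derive_xpos D F b).
  - unfold wdens. fold x. rewrite exp_Ropp. pose proof (exp_pos (F * x)).
    pose proof (dens_pos D F x HD). field. lra.
Qed.

Lemma xpos_sign (D F b w : R) : -1 < D < 0 -> Rabs F <= 1 / 32 -> 0 < w < amp D F b ->
  0 < xpos D F w /\ xpos D F (- w) < 0.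
Proof.
  intros HD HF Hw.
  pose proof (amp_xpos D F b w HD HF (proj2 Hw)) as H1.
  pose proof (amp_xpos D F b (- w) HD HF (ltac:(lra))) as H2.
  split; apply (amp_reflects_lt D F); auto; rewrite amp_0; lra.
Qed.

(** Only [wcorr w + wcorr (- w)] matters for an integral over a full turn, and here the negative
    slope on the left counts as growth. At [w1 = 0] continuity is enough. *)
Lemma wcorr_sum_increment (D F b w1 w2 l : R) : -1 < D < 0 -> Rabs F <= 1 / 32 ->
  0 <= w1 <= w2 -> w2 < amp D F b ->
  (forall w, w1 < w < w2 -> l <= slope D F (xpos D F w) - slope D F (xpos D F (- w))) ->
  l * (w2 - w1) <= wcorr D F w2 + wcorr D F (- w2) - (wcorr D F w1 + wcorr D F (- w1)).
Proof.
  intros HD HF H1 H2 Hl.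
  apply (increment_ge (fun w => wcorr D F w + wcorr D F (- w))
    (fun w => slope D F (xpos D F w) - slope D F (xpos D F (- w)))); auto; [lra| |].
  - intros w Hw.
    assert (A1 := is_derive_wcorr D F b w HD HF (ltac:(lra)) (ltac:(lra))).
    assert (A2 := is_derive_wcorr D F b (- w) HD HF (ltac:(lra)) (ltac:(lra))).
    auto_derive.
    + repeat split; eexists; eassumption.
    + change (fun x => wcorr D F x) with (wcorr D F).
      rewrite (is_derive_unique _ _ _ A1), (is_derive_unique _ _ _ A2). ring.
  - intros w Hw. apply (continuous_plus (wcorr D F) (fun w => wcorr D F (- w))).
    + apply (continuous_wcorr D F b); auto; lra.
    + apply (continuous_comp (fun w => - w) (wcorr D F)).
      * apply (ex_derive_continuous (fun w => - w)). auto_derive; trivial.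
      * apply (continuous_wcorr D F b); auto; lra.
Qed.

(** * Integrals over one loop *)

Definition loop_period (D F r : R) : R :=
  RInt (fun th => wdens D F (r * sin th)) 0 (2 * PI).
Definition loop_corr (D F r : R) : R :=
  RInt (fun th => wcorr D F (r * sin th)) 0 (2 * PI).
Definition loop_action (D F r : R) : R :=
  RInt (fun th => exp (F * xpos D F (r * sin th)) * (r * sin th)) 0 (2 * PI).

Lemma r_sin_le (r th : R) : 0 <= r -> - r <= r * sin th <= r.
Proof. intros Hr. pose proof (SIN_bound th). nra. Qed.

Lemma continuous_r_sin (r th : R) : continuous (fun th => r * sin th) th.
Proof. apply (ex_derive_continuous (fun th => r * sin th)). auto_derive; trivial. Qed.

Lemma continuous_comp_r_sin (f : R -> R) (r M th : R) : 0 <= r < M ->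
  (forall w, w < M -> continuous f w) -> continuous (fun th => f (r * sin th)) th.
Proof.
  intros Hr Hf. apply (continuous_comp (fun th => r * sin th) f).
  - apply continuous_r_sin.
  - apply Hf. pose proof (r_sin_le r th (proj1 Hr)). lra.
Qed.

(** In the oscillator coordinate [z = exp (F x)] the density enters the derivative linearly and
    without exponential weight. *)
Lemma is_derive_exp_xpos (D F b w : R) : -1 < D < 0 -> Rabs F <= 1 / 32 -> w < amp D F b ->
  is_derive (fun w => exp (F * xpos D F w)) w (F * wdens D F w).
Proof.
  intros HD HF Hw. pose proof (is_derive_xpos D F b w HD HF Hw) as Hp.
  auto_derive; [eexists; eassumption|].
  change (fun x => xpos D F x) with (xpos D F).
  rewrite (is_derive_unique _ _ _ Hp), exp_Ropp.
  pose proof (exp_pos (F * xpos D F w)). field. lra.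
Qed.

Lemma continuous_exp_xpos (D F b w : R) : -1 < D < 0 -> Rabs F <= 1 / 32 -> w < amp D F b ->
  continuous (fun w => exp (F * xpos D F w)) w.
Proof.
  intros. apply (ex_derive_continuous (fun w => exp (F * xpos D F w))). eexists.
  now apply (is_derive_exp_xpos D F b).
Qed.

(** This is the integration by parts: the integrand is the derivative of [exp (F x) r cos th], which
    returns to its value after a full turn. *)
Lemma is_RInt_exp_xpos_cos_derivative (D F b r : R) : -1 < D < 0 -> Rabs F <= 1 / 32 ->
  0 <= r < amp D F b ->
  is_RInt (fun th => F * wdens D F (r * sin th) * (r * cos th) * (r * cos th)
    - exp (F * xpos D F (r * sin th)) * (r * sin th)) 0 (2 * PI) 0.
Proof.
  intros HD HF Hr.
  set (f := fun th => exp (F * xpos D F (r * sin th)) * (r * cos th)).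
  replace 0 with (minus (f (2 * PI)) (f 0)) at 2.
  2:{ unfold f, minus, plus, opp; simpl. rewrite sin_2PI, cos_2PI, sin_0, cos_0. ring. }
  apply (is_RInt_derive f).
  - intros th _. unfold f.
    assert (Hw : r * sin th < amp D F b) by (pose proof (r_sin_le r th (proj1 Hr)); lra).
    pose proof (is_derive_exp_xpos D F b _ HD HF Hw) as Hz.
    assert (Hc : is_derive (fun th => exp (F * xpos D F (r * sin th))) th
      (r * cos th * (F * wdens D F (r * sin th)))).
    { apply (is_derive_comp (fun w => exp (F * xpos D F w)) (fun th => r * sin th)); auto.
      auto_derive; [trivial|ring]. }
    set (Z := fun th => exp (F * xpos D F (r * sin th))).
    change (is_derive Z th (r * cos th * (F * wdens D F (r * sin th)))) in Hc.
    apply (is_derive_ext (fun th => Z th * (r * cos th))); [reflexivity|].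
    auto_derive; [eexists; eassumption|].
    change (fun x => Z x) with Z. rewrite (is_derive_unique _ _ _ Hc). unfold Z. ring.
  - intros th _.
    apply (continuous_minus (fun th => F * wdens D F (r * sin th) * (r * cos th) * (r * cos th))
      (fun th => exp (F * xpos D F (r * sin th)) * (r * sin th))).
    + apply (continuous_ext (fun th => wdens D F (r * sin th) * (F * (r * cos th) * (r * cos th)))).
      { intro; simpl; ring. }
      apply (continuous_mult (fun th => wdens D F (r * sin th))
        (fun th => F * (r * cos th) * (r * cos th))).
      * apply (continuous_comp_r_sin _ r (amp D F b)); auto.
        intros; now apply (continuous_wdens D F b).
      * apply (ex_derive_continuous (fun th => F * (r * cos th) * (r * cos th))).
        auto_derive; trivial.
    + apply (continuous_mult (fun th => exp (F * xpos D F (r * sin th))) (fun th => r * sin th)).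
      * apply (continuous_comp_r_sin (fun w => exp (F * xpos D F w)) r (amp D F b)); auto.
        intros; now apply (continuous_exp_xpos D F b).
      * apply continuous_r_sin.
Qed.

Lemma is_RInt_loop_period (D F b r : R) : -1 < D < 0 -> Rabs F <= 1 / 32 ->
  0 <= r < amp D F b ->
  is_RInt (fun th => wdens D F (r * sin th)) 0 (2 * PI) (loop_period D F r).
Proof.
  intros. apply (RInt_correct (fun th => wdens D F (r * sin th))), ex_RInt_continuous.
  intros th _. apply (continuous_comp_r_sin _ r (amp D F b)); auto.
  intros; now apply (continuous_wdens D F b).
Qed.

Lemma is_RInt_loop_corr (D F b r : R) : -1 < D < 0 -> Rabs F <= 1 / 32 ->
  0 <= r < amp D F b ->
  is_RInt (fun th => wcorr D F (r * sin th)) 0 (2 * PI) (loop_corr D F r).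
Proof.
  intros. apply (RInt_correct (fun th => wcorr D F (r * sin th))), ex_RInt_continuous.
  intros th _. apply (continuous_comp_r_sin _ r (amp D F b)); auto.
  intros; now apply (continuous_wcorr D F b).
Qed.

Lemma ex_RInt_loop_action (D F b r : R) : -1 < D < 0 -> Rabs F <= 1 / 32 ->
  0 <= r < amp D F b ->
  ex_RInt (fun th => exp (F * xpos D F (r * sin th)) * (r * sin th)) 0 (2 * PI).
Proof.
  intros. apply (ex_RInt_continuous (fun th => exp (F * xpos D F (r * sin th)) * (r * sin th))).
  intros th _. apply (continuous_mult (fun th => exp (F * xpos D F (r * sin th))) (fun th => r * sin th)).
  - apply (continuous_comp_r_sin (fun w => exp (F * xpos D F w)) r (amp D F b)); auto.
    intros; now apply (continuous_exp_xpos D F b).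
  - apply continuous_r_sin.
Qed.

(** [corr_plus_wforce] multiplied by the density, with [2 potential = w^2] and
    [dens * force = w exp (- F x)]. *)
Lemma wdens_quadratic (D F b w : R) : -1 < D < 0 -> Rabs F <= 1 / 32 -> w < amp D F b ->
  (F * w * w + corr D F 0) * wdens D F w = wcorr D F w + exp (F * xpos D F w) * w.
Proof.
  intros HD HF Hw. pose proof (amp_xpos D F b w HD HF Hw) as Hinv.
  unfold wcorr, wdens. set (x := xpos D F w) in *.
  pose proof (corr_plus_wforce D F x HF) as Hc. pose proof (amp_sqr D F x HD) as Hs.
  pose proof (dens_force D F x HD) as Hd. rewrite Hinv in Hs, Hd.
  unfold wforce in Hc. replace (2 * F * x) with (F * x + F * x) in Hc by ring.
  rewrite exp_plus in Hc. rewrite exp_Ropp in Hd. pose proof (exp_pos (F * x)) as He.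
  set (e := exp (F * x)) in *.
  replace (F * w * w + corr D F 0) with (corr D F x + e * e * force D x).
  2:{ rewrite Hc. replace (F * w * w) with (F * (w * w)) by ring. rewrite Hs. ring. }
  replace ((corr D F x + e * e * force D x) * dens D F x)
    with (dens D F x * corr D F x + e * e * (dens D F x * force D x)) by ring.
  rewrite Hd. field. lra.
Qed.

(** Split [F r^2] into [F (r sin th)^2], treated by [wdens_quadratic], and [F (r cos th)^2], which
    the integration by parts turns into a second copy of the action. *)
Lemma loop_identity (D F b r : R) : -1 < D < 0 -> Rabs F <= 1 / 32 -> 0 <= r < amp D F b ->
  (F * r * r + corr D F 0) * loop_period D F r = 2 * loop_action D F r + loop_corr D F r.
Proof.
  intros HD HF Hr.
  pose proof (is_RInt_exp_xpos_cos_derivative D F b r HD HF Hr) as I0.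
  pose proof (is_RInt_loop_period D F b r HD HF Hr) as I1.
  pose proof (is_RInt_loop_corr D F b r HD HF Hr) as I2.
  pose proof (RInt_correct _ _ _ (ex_RInt_loop_action D F b r HD HF Hr)) as I3.
  fold (loop_action D F r) in I3.
  apply (is_RInt_scal _ _ _ (F * r * r + corr D F 0)) in I1.
  apply (is_RInt_scal _ _ _ 2) in I3.
  pose proof (is_RInt_plus _ _ _ _ _ _ (is_RInt_plus _ _ _ _ _ _ I3 I2) I0) as I4.
  assert (I5 : is_RInt (fun th => scal (F * r * r + corr D F 0) (wdens D F (r * sin th))) 0 (2 * PI)
    (2 * loop_action D F r + loop_corr D F r + 0)).
  { refine (is_RInt_ext _ _ _ _ _ _ I4). intros th _.
    assert (Hw : r * sin th < amp D F b) by (pose proof (r_sin_le r th (proj1 Hr)); lra).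
    pose proof (wdens_quadratic D F b _ HD HF Hw) as Hq.
    unfold plus, scal; simpl; unfold mult; simpl.
    pose proof (sin2_cos2 th) as Hsc. unfold Rsqr in Hsc.
    replace (F * r * r + corr D F 0) with
      (F * (r * sin th) * (r * sin th) + corr D F 0 + F * r * r * (cos th * cos th)).
    2:{ replace (cos th * cos th) with (1 - sin th * sin th) by lra. ring. }
    rewrite Rmult_plus_distr_r, Hq. ring. }
  apply (is_RInt_unique (V := R_CompleteNormedModule)) in I5.
  apply (is_RInt_unique (V := R_CompleteNormedModule)) in I1.
  pose proof (eq_trans (eq_sym I1) I5) as I6.
  unfold scal in I6; simpl in I6; unfold mult in I6; simpl in I6. lra.
Qed.

(** Differentiation under the integral touches only [exp (F x)], so the density need only be
    continuous. Subtracting [1 / r] times the integration by parts from [F r N] gives exactly the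
    differentiated integrand. *)
Lemma is_derive_loop_action (D F b r : R) : -1 < D < 0 -> Rabs F <= 1 / 32 ->
  0 < r < amp D F b -> is_derive (loop_action D F) r (F * r * loop_period D F r).
Proof.
  intros HD HF Hr.
  set (f := fun r th => exp (F * xpos D F (r * sin th)) * (r * sin th)).
  set (f' := fun r th => F * wdens D F (r * sin th) * (r * sin th) * sin th
    + exp (F * xpos D F (r * sin th)) * sin th).
  assert (Hnear : 0 < Rmin r (amp D F b - r)) by (apply Rmin_pos; lra).
  assert (Hin : forall y, ball r (mkposreal _ Hnear) y -> 0 < y < amp D F b).
  { intros y Hy.
    apply ball_Rabs_lt in Hy; simpl in Hy.
    pose proof (Rmin_l r (amp D F b - r)). pose proof (Rmin_r r (amp D F b - r)).
    apply Rabs_def2 in Hy. lra. }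
  assert (Hd : forall y th, 0 < y < amp D F b -> is_derive (fun y => f y th) y (f' y th)).
  { intros y th Hy.
    assert (Hw : y * sin th < amp D F b) by (pose proof (r_sin_le y th); lra).
    pose proof (is_derive_exp_xpos D F b _ HD HF Hw) as Hz.
    assert (Hc : is_derive (fun y => exp (F * xpos D F (y * sin th))) y
      (sin th * (F * wdens D F (y * sin th)))).
    { apply (is_derive_comp (fun w => exp (F * xpos D F w)) (fun y => y * sin th)); auto.
      auto_derive; [trivial|ring]. }
    unfold f, f'. set (Z := fun y => exp (F * xpos D F (y * sin th))).
    change (is_derive Z y (sin th * (F * wdens D F (y * sin th)))) in Hc.
    apply (is_derive_ext (fun y => Z y * (y * sin th))); [reflexivity|].
    auto_derive; [eexists; eassumption|].
    change (fun x => Z x) with Z. rewrite (is_derive_unique _ _ _ Hc). unfold Z. ring. }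
  assert (Hmain : is_derive (fun y => RInt (fun th => f y th) 0 (2 * PI)) r
    (RInt (fun th => Derive (fun u => f u th) r) 0 (2 * PI))).
  { apply is_derive_RInt_param.
    - exists (mkposreal _ Hnear). intros y Hy th _. eexists. apply Hd. now apply Hin.
    - intros th _. apply (continuity_2d_pt_ext_loc f').
      { exists (mkposreal _ Hnear). intros y t Hy _. symmetry.
        apply is_derive_unique, Hd, Hin. exact Hy. }
      assert (Hw : r * sin th < amp D F b) by (pose proof (r_sin_le r th); lra).
      assert (Cs : continuity_2d_pt (fun y t => sin t) r th).
      { apply (continuity_1d_2d_pt_comp sin (fun y t => t)); [apply continuity_sin|].
        apply continuity_2d_pt_id2. }
      assert (Crs : continuity_2d_pt (fun y t => y * sin t) r th).
      { apply continuity_2d_pt_mult; [apply continuity_2d_pt_id1|exact Cs]. }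
      unfold f'. apply continuity_2d_pt_plus.
      + apply continuity_2d_pt_mult; [|exact Cs].
        apply continuity_2d_pt_mult; [|exact Crs].
        apply continuity_2d_pt_mult; [apply continuity_2d_pt_const|].
        apply (continuity_1d_2d_pt_comp (wdens D F) (fun y t => y * sin t)); auto.
        apply continuity_pt_filterlim. now apply (continuous_wdens D F b).
      + apply continuity_2d_pt_mult; [|exact Cs].
        apply (continuity_1d_2d_pt_comp (fun w => exp (F * xpos D F w)) (fun y t => y * sin t)); auto.
        apply continuity_pt_filterlim. now apply (continuous_exp_xpos D F b).
    - exists (mkposreal _ Hnear). intros y Hy. apply Hin in Hy.
      apply (ex_RInt_loop_action D F b); auto. lra. }
  replace (F * r * loop_period D F r) with (RInt (fun th => Derive (fun u => f u th) r) 0 (2 * PI));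
    [exact Hmain|].
  pose proof (is_RInt_exp_xpos_cos_derivative D F b r HD HF (ltac:(lra))) as I0.
  pose proof (is_RInt_loop_period D F b r HD HF (ltac:(lra))) as I1.
  apply (is_RInt_scal _ _ _ (F * r)) in I1. apply (is_RInt_scal _ _ _ (/ r)) in I0.
  pose proof (is_RInt_minus _ _ _ _ _ _ I1 I0) as I2.
  apply is_RInt_unique.
  replace (F * r * loop_period D F r) with
    (minus (scal (F * r) (loop_period D F r)) (scal (/ r) 0)).
  2:{ unfold minus, plus, opp, scal; simpl; unfold mult; simpl. ring. }
  refine (is_RInt_ext _ _ _ _ _ _ I2). intros th _.
  transitivity (f' r th); [|symmetry; apply is_derive_unique, Hd; auto].
  unfold minus, plus, opp, scal; simpl; unfold mult; simpl. unfold f'.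
  pose proof (sin2_cos2 th) as Hsc. unfold Rsqr in Hsc.
  set (N := wdens D F (r * sin th)). set (Z := exp (F * xpos D F (r * sin th))).
  replace (F * N * (r * sin th) * sin th) with (F * N * r * (1 - cos th * cos th))
    by (replace (1 - cos th * cos th) with (sin th * sin th) by lra; ring).
  field. lra.
Qed.

(** * Growth of the corrected integral *)

Lemma RInt_ge_const (f : R -> R) (a b c : R) : a <= b ->
  (forall x, continuous f x) -> (forall x, a < x < b -> c <= f x) ->
  c * (b - a) <= RInt f a b.
Proof.
  intros Hab Hf Hc.
  replace (c * (b - a)) with (RInt (fun _ => c) a b).
  2:{ rewrite RInt_const. unfold scal; simpl; unfold mult; simpl. ring. }
  apply RInt_le; auto.
  - apply ex_RInt_const.
  - apply (ex_RInt_continuous f). intros; apply Hf.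
Qed.

(** The substitution [th + PI] on the second half turn changes the sign of [sin] and pairs [w] with
    [- w]. *)
Lemma loop_corr_half (D F b r : R) : -1 < D < 0 -> Rabs F <= 1 / 32 -> 0 <= r < amp D F b ->
  loop_corr D F r = RInt (fun th => wcorr D F (r * sin th) + wcorr D F (- (r * sin th))) 0 PI.
Proof.
  intros HD HF Hr.
  assert (Hc : forall th, continuous (fun th => wcorr D F (r * sin th)) th).
  { intro th. apply (continuous_comp_r_sin _ r (amp D F b)); auto.
    intros; now apply (continuous_wcorr D F b). }
  assert (Hex : forall x y, ex_RInt (fun th => wcorr D F (r * sin th)) x y).
  { intros x y. apply (ex_RInt_continuous (fun th => wcorr D F (r * sin th))). auto. }
  unfold loop_corr. rewrite <- (RInt_Chasles _ 0 PI (2 * PI) (Hex _ _) (Hex _ _)).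
  assert (Hs : is_RInt (fun th => wcorr D F (- (r * sin th))) 0 PI
    (RInt (fun th => wcorr D F (r * sin th)) PI (2 * PI))).
  { pose proof (RInt_correct _ _ _ (Hex PI (2 * PI))) as HI.
    replace PI with (1 * 0 + PI) in HI at 1 by ring.
    replace (2 * PI) with (1 * PI + PI) in HI at 1 by ring.
    apply (is_RInt_comp_lin _ 1 PI) in HI.
    refine (is_RInt_ext _ _ _ _ _ _ HI). intros th _.
    unfold scal; simpl; unfold mult; simpl. rewrite Rmult_1_l.
    replace (1 * th + PI) with (th + PI) by ring. rewrite neg_sin. f_equal. ring. }
  symmetry. apply (is_RInt_unique (V := R_CompleteNormedModule)).
  apply (is_RInt_plus (V := R_NormedModule)).
  - apply (RInt_correct _ _ _ (Hex 0 PI)).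
  - exact Hs.
Qed.

Lemma sin_ge_middle (t th : R) : 0 <= t <= PI / 2 -> t <= th <= PI - t -> sin t <= sin th.
Proof.
  intros Ht Hth. pose proof PI_RGT_0. destruct (Rle_dec th (PI / 2)).
  - apply sin_incr_1; lra.
  - rewrite <- (sin_PI_x th). apply sin_incr_1; lra.
Qed.

(** On [[t, PI - t]] the amplitude exceeds [w0] and the integrand gains at the rate [c / r2]. In the
    side strips it can lose only where [r1 sin th < w0], and there the increment of amplitude is at
    most [(w0 / r1) (r2 - r1)]. Gain and loss are thus both of order [(r2 - r1) / r1], and narrow
    strips decide for the gain. *)
Lemma loop_corr_growth (d : R) : 0 < d <= 1 / 2 ->
  exists r0 c dl, 0 < r0 /\ 0 < c /\ 0 < dl <= 1 / 32 /\
  forall D F, -1 + d <= D <= - d -> Rabs F <= dl ->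
  forall b r1 r2, r0 <= r1 <= r2 -> r2 <= 2 * r1 -> r2 < amp D F b ->
    c / r1 * (r2 - r1) <= loop_corr D F r2 - loop_corr D F r1.
Proof.
  intros Hd.
  destruct (slope_difference_bounds d Hd) as (C0 & c & w0 & dl & HC0 & Hc & Hw0 & Hdl & HB).
  assert (HPI : 3 < PI) by (pose proof PI2_3_2; lra).
  set (t := Rmin (1 / 2) (c / (32 * C0 * w0))).
  assert (Hq : 0 < 32 * C0 * w0) by (repeat apply Rmult_lt_0_compat; lra).
  assert (Ht0 : 0 < t).
  { apply Rmin_pos; [lra|]. now apply Rdiv_lt_0_compat. }
  assert (Ht1 : t <= 1 / 2) by apply Rmin_l.
  assert (Ht2 : 32 * C0 * w0 * t <= c).
  { assert (t <= c / (32 * C0 * w0)) by apply Rmin_r.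
    apply Rle_trans with (32 * C0 * w0 * (c / (32 * C0 * w0))).
    - apply Rmult_le_compat_l; lra.
    - right. field. lra. }
  assert (Hs : 0 < sin t) by (apply sin_gt_0; lra).
  exists (w0 / sin t), (c / 2), dl.
  split; [now apply Rdiv_lt_0_compat|]. split; [lra|]. split; [exact Hdl|].
  intros D F HD HFs b r1 r2 Hr Hr2 Hrb.
  assert (HF : Rabs F <= 1 / 32) by lra.
  assert (HD' : -1 < D < 0) by lra.
  destruct (HB D F HD HFs) as (HR & HL & HRL).
  assert (Hr0 : 0 < w0 / sin t) by now apply Rdiv_lt_0_compat.
  assert (Hws : w0 <= r1 * sin t).
  { apply Rle_trans with (w0 / sin t * sin t).
    - right. field. lra.
    - apply Rmult_le_compat_r; lra. }
  set (m := fun w => wcorr D F w + wcorr D F (- w)).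
  assert (Hm1 : forall w1 w2, 0 <= w1 <= w2 -> w2 <= r2 ->
    - (2 * C0) * (w2 - w1) <= m w2 - m w1).
  { intros w1 w2 Hw1 Hw2. apply (wcorr_sum_increment D F b); auto; [lra|].
    intros w Hw. destruct (xpos_sign D F b w HD' HF) as [S1 S2]; [lra|].
    specialize (HR _ S1). specialize (HL _ S2). lra. }
  assert (Hm2 : forall w1 w2, w0 <= w1 <= w2 -> w2 <= r2 ->
    c / w2 * (w2 - w1) <= m w2 - m w1).
  { intros w1 w2 Hw1 Hw2. apply (wcorr_sum_increment D F b); auto; [lra|lra|].
    intros w Hw. destruct (xpos_sign D F b w HD' HF) as [S1 S2]; [lra|].
    assert (E1 := amp_xpos D F b w HD' HF (ltac:(lra))).
    assert (E2 := amp_xpos D F b (- w) HD' HF (ltac:(lra))).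
    assert (HK := HRL _ _ S2 S1). rewrite E1, E2 in HK. specialize (HK eq_refl (ltac:(lra))).
    eapply Rle_trans; [|exact HK]. unfold Rdiv. apply Rmult_le_compat_l; [lra|].
    apply Rinv_le_contravar; lra. }
  set (S := fun th => m (r2 * sin th) - m (r1 * sin th)).
  assert (Cm : forall r th, 0 <= r < amp D F b -> continuous (fun th => m (r * sin th)) th).
  { intros r th Hrr.
    apply (continuous_plus (fun th => wcorr D F (r * sin th)) (fun th => wcorr D F (- (r * sin th)))).
    - apply (continuous_comp_r_sin _ r (amp D F b)); auto.
      intros; now apply (continuous_wcorr D F b).
    - apply (continuous_comp (fun th => - (r * sin th)) (wcorr D F)).
      + apply (ex_derive_continuous (fun th => - (r * sin th))). auto_derive; trivial.
      + apply (continuous_wcorr D F b); auto. pose proof (r_sin_le r th (proj1 Hrr)). lra. }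
  assert (CS : forall th, continuous S th).
  { intro th. apply (continuous_minus (fun th => m (r2 * sin th)) (fun th => m (r1 * sin th)));
      apply Cm; lra. }
  assert (HE : loop_corr D F r2 - loop_corr D F r1 = RInt S 0 PI).
  { rewrite (loop_corr_half D F b r2), (loop_corr_half D F b r1) by (auto; lra).
    symmetry. apply (RInt_minus (V := R_CompleteNormedModule)
      (fun th => m (r2 * sin th)) (fun th => m (r1 * sin th)));
      apply (ex_RInt_continuous (V := R_CompleteNormedModule)); intros; apply Cm; lra. }
  rewrite HE.
  assert (Hex : forall x y, ex_RInt S x y).
  { intros. apply (ex_RInt_continuous S). auto. }
  assert (Hsplit : RInt S 0 PI = RInt S 0 t + RInt S t (PI - t) + RInt S (PI - t) PI).
  { rewrite <- (RInt_Chasles S 0 (PI - t) PI), <- (RInt_Chasles S 0 t (PI - t)) by auto.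
    reflexivity. }
  rewrite Hsplit.
  assert (Hrr : 0 <= r2 - r1) by lra.
  assert (Hmid : c / r2 * (r2 - r1) * (PI - t - t) <= RInt S t (PI - t)).
  { apply RInt_ge_const; auto; [lra|]. intros th Hth.
    assert (Hst : sin t <= sin th) by (apply sin_ge_middle; lra).
    pose proof (SIN_bound th).
    replace (c / r2 * (r2 - r1)) with (c / (r2 * sin th) * (r2 * sin th - r1 * sin th))
      by (field; lra).
    apply Hm2; nra. }
  assert (Hside : forall th, 0 <= th <= PI -> - (2 * C0 * (w0 / r1) * (r2 - r1)) <= S th).
  { intros th Hth. assert (Hst : 0 <= sin th) by (apply sin_ge_0; lra).
    pose proof (SIN_bound th) as Hb.
    assert (Hw0r : 0 < w0 / r1) by (apply Rdiv_lt_0_compat; lra).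
    destruct (Rle_dec w0 (r1 * sin th)) as [Hw|Hw].
    - assert (H0 : 0 <= S th).
      { eapply Rle_trans; [|apply Hm2; nra].
        apply Rmult_le_pos; [|nra]. left. apply Rdiv_lt_0_compat; nra. }
      assert (0 <= 2 * C0 * (w0 / r1) * (r2 - r1)).
      { apply Rmult_le_pos; auto. nra. }
      lra.
    - eapply Rle_trans; [|apply Hm1; nra].
      assert (sin th <= w0 / r1).
      { apply (Rmult_le_reg_r r1); [lra|]. replace (w0 / r1 * r1) with w0 by (field; lra). lra. }
      replace (r2 * sin th - r1 * sin th) with (sin th * (r2 - r1)) by ring.
      assert (sin th * (r2 - r1) <= w0 / r1 * (r2 - r1)) by (apply Rmult_le_compat_r; lra).
      nra. }
  assert (Hl : - (2 * C0 * (w0 / r1) * (r2 - r1)) * (t - 0) <= RInt S 0 t).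
  { apply RInt_ge_const; auto; [lra|]. intros; apply Hside; lra. }
  assert (Hrt : - (2 * C0 * (w0 / r1) * (r2 - r1)) * (PI - (PI - t)) <= RInt S (PI - t) PI).
  { apply RInt_ge_const; auto; [lra|]. intros; apply Hside; lra. }
  set (x := (r2 - r1) / r1).
  assert (Hx : 0 <= x).
  { unfold x. apply Rmult_le_pos; auto. left. apply Rinv_0_lt_compat. lra. }
  assert (Hmid2 : c * x <= c / r2 * (r2 - r1) * (PI - t - t)).
  { apply Rle_trans with (c / (2 * r1) * (r2 - r1) * 2).
    - right. unfold x. field. lra.
    - apply Rmult_le_compat; [|lra| |lra].
      + apply Rmult_le_pos; auto. left. apply Rdiv_lt_0_compat; lra.
      + apply Rmult_le_compat_r; auto. unfold Rdiv. apply Rmult_le_compat_l; [lra|].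
        apply Rinv_le_contravar; lra. }
  replace (2 * C0 * (w0 / r1) * (r2 - r1)) with (2 * C0 * w0 * x) in Hl, Hrt by (unfold x; field; lra).
  replace (c / 2 / r1 * (r2 - r1)) with (c / 2 * x) by (unfold x; field; lra).
  assert (32 * C0 * w0 * t * x <= c * x) by (apply Rmult_le_compat_r; auto).
  assert (0 <= c * x) by nra.
  lra.
Qed.

(** * The period as a loop integral *)

Definition xof (p : R * R) : R := - ln (1 - fst p).
Definition energy (D F : R) (p : R * R) : R :=
  (exp (F * xof p) * snd p) ^ 2 + 2 * potential D F (xof p).
Definition rad (D F : R) (p : R * R) : R := sqrt (energy D F p).
Definition orbit_pt (D F r th : R) : R * R :=
  (1 - exp (- xpos D F (r * sin th)),
   - (exp (- (F * xpos D F (r * sin th))) * (r * cos th))).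
Definition orbit_time (D F r th : R) : R := RInt (fun s => wdens D F (r * sin s)) 0 th.
Definition orbit_angle (D F r t : R) : R :=
  epsilon (inhabits 0) (fun th => orbit_time D F r th = t).

Lemma polar_angle (a b r : R) : 0 < r -> a ^ 2 + b ^ 2 = r ^ 2 ->
  exists th, r * sin th = a /\ r * cos th = b.
Proof.
  intros Hr Hab. set (c := b / r).
  assert (Hb : b = r * c) by (unfold c; field; lra).
  clearbody c. subst b.
  assert (Hc : -1 <= c <= 1).
  { assert (Hcc : c * c <= 1).
    { apply (Rmult_le_reg_l (r * r)); [nra|]. nra. }
    split; nra. }
  assert (Hs : sin (acos c) = sqrt (1 - c ^ 2)) by (rewrite sin_acos by auto; unfold Rsqr; f_equal; ring).
  assert (Ha : a ^ 2 = (r * sqrt (1 - c ^ 2)) ^ 2).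
  { rewrite Rpow_mult_distr, pow2_sqrt by nra. nra. }
  assert (Hp : 0 <= r * sqrt (1 - c ^ 2)) by (apply Rmult_le_pos; [lra|apply sqrt_pos]).
  destruct (Rle_dec 0 a) as [H0|H0].
  - exists (acos c). rewrite cos_acos, Hs by auto. split; [|lra].
    apply Rsqr_inj; auto. unfold Rsqr. nra.
  - exists (- acos c). rewrite cos_neg, sin_neg, cos_acos, Hs by auto. split; [|lra].
    assert (r * sqrt (1 - c ^ 2) = - a); [|lra].
    apply Rsqr_inj; auto; [lra|]. unfold Rsqr. nra.
Qed.

Lemma exp_xof (p : R * R) : fst p < 1 -> exp (- xof p) = 1 - fst p.
Proof. intros Hp. unfold xof. rewrite Ropp_involutive. apply exp_ln. lra. Qed.

Lemma xof_orbit_pt (D F r th : R) : xof (orbit_pt D F r th) = xpos D F (r * sin th).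
Proof.
  unfold xof, orbit_pt; simpl.
  replace (1 - (1 - exp (- xpos D F (r * sin th)))) with (exp (- xpos D F (r * sin th))) by ring.
  rewrite ln_exp. ring.
Qed.

Lemma energy_pos (D F : R) (p : R * R) : -1 < D < 0 -> fst p < 1 -> p <> (0, 0) ->
  0 < energy D F p.
Proof.
  intros HD Hp Hne. unfold energy.
  pose proof (pow2_ge_0 (exp (F * xof p) * snd p)) as H1.
  pose proof (potential_nonneg D F (xof p) HD) as H2.
  destruct (Req_dec (xof p) 0) as [Hx|Hx].
  - assert (Hv : snd p <> 0).
    { intro Hv. apply Hne. pose proof (exp_xof p Hp) as He. rewrite Hx, Ropp_0, exp_0 in He.
      apply injective_projections; simpl; lra. }
    assert (exp (F * xof p) * snd p <> 0).
    { apply Rmult_integral_contrapositive. split; auto. apply Rgt_not_eq, exp_pos. }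
    assert (0 < (exp (F * xof p) * snd p) ^ 2) by (apply pow2_gt_0; auto). lra.
  - pose proof (potential_pos D F (xof p) HD Hx). lra.
Qed.

Lemma rad_pos (D F : R) (p : R * R) : -1 < D < 0 -> fst p < 1 -> p <> (0, 0) ->
  0 < rad D F p.
Proof. intros. apply sqrt_lt_R0. now apply energy_pos. Qed.

(** The energy is [amp^2 + (exp (F x) v)^2], so the point has an angle on the circle of radius
    [rad]. *)
Lemma orbit_pt_surj (D F : R) (p : R * R) : -1 < D < 0 -> Rabs F <= 1 / 32 ->
  fst p < 1 -> p <> (0, 0) -> exists th, orbit_pt D F (rad D F p) th = p.
Proof.
  intros HD HF Hp Hne. pose proof (rad_pos D F p HD Hp Hne) as Hr.
  destruct (polar_angle (amp D F (xof p)) (- (exp (F * xof p) * snd p)) (rad D F p) Hr)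
    as [th [H1 H2]].
  { unfold rad. rewrite pow2_sqrt by (left; now apply energy_pos). unfold energy.
    rewrite <- (amp_sqr D F (xof p) HD). ring. }
  exists th. unfold orbit_pt. rewrite H1, H2, xpos_amp by auto.
  apply injective_projections; simpl.
  - rewrite exp_xof by auto. ring.
  - rewrite exp_Ropp. field. apply Rgt_not_eq, exp_pos.
Qed.

Lemma continuous_wdens_r_sin (D F b r th : R) : -1 < D < 0 -> Rabs F <= 1 / 32 ->
  0 <= r < amp D F b -> continuous (fun s => wdens D F (r * sin s)) th.
Proof.
  intros. apply (continuous_comp_r_sin _ r (amp D F b)); auto.
  intros; now apply (continuous_wdens D F b).
Qed.

Lemma is_derive_orbit_time (D F b r th : R) : -1 < D < 0 -> Rabs F <= 1 / 32 ->
  0 <= r < amp D F b -> is_derive (orbit_time D F r) th (wdens D F (r * sin th)).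
Proof.
  intros HD HF Hr. unfold orbit_time.
  apply (is_derive_RInt (fun s => wdens D F (r * sin s))
    (RInt (fun s => wdens D F (r * sin s)) 0) 0 th).
  - apply filter_forall. intro y.
    apply (RInt_correct (fun s => wdens D F (r * sin s))), ex_RInt_continuous.
    intros; now apply (continuous_wdens_r_sin D F b).
  - now apply (continuous_wdens_r_sin D F b).
Qed.

Lemma orbit_time_increasing (D F b r x y : R) : -1 < D < 0 -> Rabs F <= 1 / 32 ->
  0 <= r < amp D F b -> x < y -> orbit_time D F r x < orbit_time D F r y.
Proof.
  intros HD HF Hr Hxy.
  destruct (MVT_cor2 (orbit_time D F r) (fun th => wdens D F (r * sin th)) x y Hxy)
    as [z [Hz1 Hz2]].
  - intros. apply is_derive_Reals. now apply (is_derive_orbit_time D F b).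
  - pose proof (wdens_pos D F (r * sin z) HD). nra.
Qed.

Lemma orbit_time_shift (D F b r th : R) : -1 < D < 0 -> Rabs F <= 1 / 32 ->
  0 <= r < amp D F b ->
  orbit_time D F r (th + 2 * PI) = orbit_time D F r th + loop_period D F r.
Proof.
  intros HD HF Hr.
  assert (H := zero_derivative_const
    (fun th => orbit_time D F r (th + 2 * PI) - orbit_time D F r th)).
  assert (He : orbit_time D F r (th + 2 * PI) - orbit_time D F r th
    = orbit_time D F r (0 + 2 * PI) - orbit_time D F r 0).
  { apply H. intro t.
    pose proof (is_derive_orbit_time D F b r t HD HF Hr) as H1.
    pose proof (is_derive_orbit_time D F b r (t + 2 * PI) HD HF Hr) as H2.
    auto_derive; [repeat split; eexists; eassumption|].
    change (fun x => orbit_time D F r x) with (orbit_time D F r).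
    rewrite (is_derive_unique _ _ _ H1), (is_derive_unique _ _ _ H2).
    rewrite sin_plus, sin_2PI, cos_2PI.
    replace (sin t * 1 + cos t * 0) with (sin t) by ring. ring. }
  rewrite Rplus_0_l in He.
  assert (H0 : orbit_time D F r 0 = 0) by exact (RInt_point 0 (fun s => wdens D F (r * sin s))).
  rewrite H0 in He. change (orbit_time D F r (2 * PI)) with (loop_period D F r) in He. lra.
Qed.

Lemma loop_period_pos (D F b r : R) : -1 < D < 0 -> Rabs F <= 1 / 32 ->
  0 <= r < amp D F b -> 0 < loop_period D F r.
Proof.
  intros HD HF Hr. pose proof PI_RGT_0.
  pose proof (orbit_time_shift D F b r 0 HD HF Hr) as H1.
  pose proof (orbit_time_increasing D F b r 0 (0 + 2 * PI) HD HF Hr (ltac:(lra))). lra.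
Qed.

Lemma orbit_time_angle (D F b r t : R) : -1 < D < 0 -> Rabs F <= 1 / 32 ->
  0 <= r < amp D F b -> orbit_time D F r (orbit_angle D F r t) = t.
Proof.
  intros HD HF Hr. unfold orbit_angle.
  apply (epsilon_spec (inhabits 0) (fun th => orbit_time D F r th = t)).
  pose proof (loop_period_pos D F b r HD HF Hr) as HT. set (T := loop_period D F r) in *.
  assert (Hn : forall n, orbit_time D F r (INR n * (2 * PI)) = INR n * T
    /\ orbit_time D F r (- (INR n * (2 * PI))) = - (INR n * T)).
  { induction n as [|n [IH1 IH2]].
    - simpl. rewrite !Rmult_0_l, Ropp_0.
      assert (H0 : orbit_time D F r 0 = 0) by exact (RInt_point 0 (fun s => wdens D F (r * sin s))).
      rewrite H0. lra.
    - rewrite S_INR. split.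
      + replace ((INR n + 1) * (2 * PI)) with (INR n * (2 * PI) + 2 * PI) by ring.
        rewrite (orbit_time_shift D F b), IH1 by auto. fold T. ring.
      + pose proof (orbit_time_shift D F b r (- ((INR n + 1) * (2 * PI))) HD HF Hr) as Hs.
        replace (- ((INR n + 1) * (2 * PI)) + 2 * PI) with (- (INR n * (2 * PI))) in Hs by ring.
        rewrite IH2 in Hs. fold T in Hs. lra. }
  destruct (nfloor_ex (Rabs t / T)) as [n Hfl].
  { apply Rmult_le_pos; [apply Rabs_pos|]. left. now apply Rinv_0_lt_compat. }
  assert (Hbig : Rabs t < INR (S n) * T).
  { rewrite S_INR. apply (Rmult_lt_reg_r (/ T)); [now apply Rinv_0_lt_compat|].
    rewrite Rmult_assoc, Rinv_r, Rmult_1_r by lra. apply Hfl. }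
  apply Rabs_def2 in Hbig. destruct (Hn (S n)) as [H1 H2].
  (* The time is known at all whole turns, which are unbounded in both directions; [S n] turns
     either way enclose [t]. *)
  destruct (IVT_gen (orbit_time D F r) (- (INR (S n) * (2 * PI))) (INR (S n) * (2 * PI)) t)
    as [x [_ Hx]].
  - intro x. apply continuity_pt_filterlim, (ex_derive_continuous (orbit_time D F r)).
    eexists. now apply (is_derive_orbit_time D F b).
  - rewrite H1, H2, Rmin_left, Rmax_right; lra.
  - now exists x.
Qed.

Lemma orbit_angle_time (D F b r th : R) : -1 < D < 0 -> Rabs F <= 1 / 32 ->
  0 <= r < amp D F b -> orbit_angle D F r (orbit_time D F r th) = th.
Proof.
  intros HD HF Hr. pose proof (orbit_time_angle D F b r (orbit_time D F r th) HD HF Hr) as H.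
  destruct (Rtotal_order (orbit_angle D F r (orbit_time D F r th)) th) as [H1|[H1|H1]]; auto;
    apply (orbit_time_increasing D F b r) in H1; auto; lra.
Qed.

Lemma orbit_angle_increasing (D F b r s t : R) : -1 < D < 0 -> Rabs F <= 1 / 32 ->
  0 <= r < amp D F b -> s < t -> orbit_angle D F r s < orbit_angle D F r t.
Proof.
  intros HD HF Hr Hst.
  pose proof (orbit_time_angle D F b r s HD HF Hr) as H1.
  pose proof (orbit_time_angle D F b r t HD HF Hr) as H2.
  destruct (Rtotal_order (orbit_angle D F r s) (orbit_angle D F r t)) as [H|[H|H]]; auto.
  - rewrite H in H1. lra.
  - apply (orbit_time_increasing D F b r) in H; auto. lra.
Qed.

Lemma orbit_angle_shift (D F b r t : R) : -1 < D < 0 -> Rabs F <= 1 / 32 ->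
  0 <= r < amp D F b ->
  orbit_angle D F r (t + loop_period D F r) = orbit_angle D F r t + 2 * PI.
Proof.
  intros HD HF Hr.
  pose proof (orbit_time_shift D F b r (orbit_angle D F r t) HD HF Hr) as Hs.
  rewrite (orbit_time_angle D F b) in Hs by auto.
  rewrite <- Hs. now apply (orbit_angle_time D F b).
Qed.

Lemma is_derive_orbit_angle (D F b r t : R) : -1 < D < 0 -> Rabs F <= 1 / 32 ->
  0 <= r < amp D F b ->
  is_derive (orbit_angle D F r) t (/ wdens D F (r * sin (orbit_angle D F r t))).
Proof.
  intros HD HF Hr. pose proof (orbit_time_angle D F b r t HD HF Hr) as Ht.
  set (th := orbit_angle D F r t) in *. rewrite <- Ht.
  apply is_derive_inverse.
  - intros. now apply (orbit_time_increasing D F b).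
  - now apply (is_derive_orbit_time D F b).
  - apply Rgt_not_eq. now apply wdens_pos.
  - apply filter_forall. intro y. now apply (orbit_time_angle D F b).
Qed.

Lemma orbit_pt_shift (D F r th : R) : orbit_pt D F r (th + 2 * PI) = orbit_pt D F r th.
Proof.
  unfold orbit_pt. rewrite sin_plus, cos_plus, sin_2PI, cos_2PI.
  replace (sin th * 1 + cos th * 0) with (sin th) by ring.
  replace (cos th * 1 - sin th * 0) with (cos th) by ring. reflexivity.
Qed.

(** The angle moves at speed [1 / N], which gives [x' = exp (- F x) r cos th = - v]; the equation
    for [v] then comes from [dens_force]. *)
Lemma orbit_solution (D F b r t0 : R) : -1 < D < 0 -> Rabs F <= 1 / 32 ->
  0 < r < amp D F b ->
  is_solution D F (fun t => orbit_pt D F r (orbit_angle D F r (t + t0))).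
Proof.
  intros HD HF Hr t.
  set (A := fun t => orbit_angle D F r (t + t0)).
  set (th := A t). set (w := r * sin th). set (x := xpos D F w).
  set (N := wdens D F w).
  assert (HN : 0 < N) by now apply wdens_pos.
  assert (Hw : w < amp D F b) by (pose proof (r_sin_le r th); unfold w; lra).
  assert (HA : is_derive A t (/ N)).
  { unfold A. pose proof (is_derive_orbit_angle D F b r (t + t0) HD HF (ltac:(lra))) as H.
    apply (is_derive_ext (fun t => orbit_angle D F r (t + t0))); [reflexivity|].
    replace (/ N) with (scal 1 (/ N)) by (unfold scal; simpl; unfold mult; simpl; ring).
    apply (is_derive_comp (orbit_angle D F r) (fun t => t + t0)); auto.
    auto_derive; [trivial|ring]. }
  set (Xt := fun t => xpos D F (r * sin (A t))).
  assert (HX : is_derive Xt t (exp (- (F * x)) * (r * cos th))).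
  { replace (exp (- (F * x)) * (r * cos th)) with
      (scal (r * cos th * / N) (exp (- (F * x)) * N)).
    2:{ unfold scal; simpl; unfold mult; simpl. field. lra. }
    apply (is_derive_comp (xpos D F) (fun t => r * sin (A t))).
    - apply (is_derive_xpos D F b); auto.
    - auto_derive; [eexists; eassumption|].
      change (fun x => A x) with A. rewrite (is_derive_unique _ _ _ HA). fold th. ring. }
  assert (Hinv := amp_xpos D F b w HD HF Hw). fold x in Hinv.
  assert (Hdf := dens_force D F x HD). change (dens D F x) with N in Hdf. rewrite Hinv in Hdf.
  assert (Hforce : (1 - exp (- x)) + D * (1 - exp (- x)) ^ 2 = force D x) by (unfold force; ring).
  split.
  - apply (is_derive_ext (fun t => 1 - exp (- Xt t))); [reflexivity|].
    auto_derive; [eexists; eassumption|].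
    change (fun x => Xt x) with Xt. rewrite (is_derive_unique _ _ _ HX).
    unfold loud, orbit_pt; simpl. fold (A t). fold th. fold w. change (Xt t) with x. fold x.
    ring.
  - apply (is_derive_ext (fun t => - (exp (- (F * Xt t)) * (r * cos (A t))))); [reflexivity|].
    auto_derive; [repeat split; eexists; eassumption|].
    change (fun x => Xt x) with Xt. change (fun x => A x) with A.
    rewrite (is_derive_unique _ _ _ HX), (is_derive_unique _ _ _ HA).
    unfold loud, orbit_pt; simpl. fold (A t). fold th. fold w. change (Xt t) with x. fold x.
    set (e := exp (- (F * x))) in *. set (X := exp (- x)) in *.
    replace (1 - X + D * ((1 - X) * ((1 - X) * 1))) with (force D x) by (rewrite <- Hforce; ring).
    replace (force D x) with (w * e * / N) by (rewrite <- Hdf; field; lra).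
    unfold w. field. lra.
Qed.

(** Equal points have equal sine and cosine, so [cos (th - a) = 1], which is impossible because the
    half angle lies strictly between 0 and [PI]. It yields minimality of the period. *)
Lemma orbit_pt_not_returning (D F b r a th : R) : -1 < D < 0 -> Rabs F <= 1 / 32 ->
  0 < r < amp D F b -> a < th < a + 2 * PI -> orbit_pt D F r th <> orbit_pt D F r a.
Proof.
  intros HD HF Hr Hth He.
  assert (Hin : forall t, amp D F (xpos D F (r * sin t)) = r * sin t).
  { intro t. apply (amp_xpos D F b); auto. pose proof (r_sin_le r t). lra. }
  pose proof (f_equal xof He) as Hx. rewrite !xof_orbit_pt in Hx.
  pose proof (f_equal (amp D F) Hx) as Hs. rewrite !Hin in Hs.
  assert (Hs' : sin th = sin a) by (apply (Rmult_eq_reg_l r); lra).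
  pose proof (f_equal snd He) as Hc. unfold orbit_pt in Hc; simpl in Hc. rewrite Hx in Hc.
  pose proof (exp_pos (- (F * xpos D F (r * sin a)))) as Hexp.
  assert (Hc' : cos th = cos a).
  { apply (Rmult_eq_reg_l (exp (- (F * xpos D F (r * sin a))) * r)); [lra|].
    apply Rgt_not_eq. apply Rmult_lt_0_compat; lra. }
  assert (Hd : cos (th - a) = 1).
  { rewrite cos_minus, Hs', Hc'. pose proof (sin2_cos2 a). unfold Rsqr in *. lra. }
  replace (th - a) with (2 * ((th - a) / 2)) in Hd by field.
  rewrite cos_2a_sin in Hd.
  assert (0 < sin ((th - a) / 2)) by (apply sin_gt_0; lra). nra.
Qed.

Lemma loud_neq_0 (D F : R) (p : R * R) : -1 < D < 0 -> fst p < 1 -> p <> (0, 0) ->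
  loud D F p <> (0, 0).
Proof.
  intros HD Hp Hne He. apply Hne.
  pose proof (f_equal fst He) as H1. pose proof (f_equal snd He) as H2.
  unfold loud in H1, H2; simpl in H1, H2.
  assert (Hv : snd p = 0).
  { apply (Rmult_eq_reg_r (fst p - 1)); [lra|]. lra. }
  rewrite Hv in H2.
  assert (Hu : fst p = 0).
  { apply (Rmult_eq_reg_r (1 + D * fst p)); [lra|]. nra. }
  now apply injective_projections.
Qed.

(** Uniqueness is included because [period] is a choice: of two distinct minimal periods of the same
    solution, the shorter would be an early return for the longer. *)
Lemma is_period_loop_period (D F b : R) (p : R * R) : -1 < D < 0 -> Rabs F <= 1 / 32 ->
  fst p < 1 -> p <> (0, 0) -> rad D F p < amp D F b ->
  is_period D F p (loop_period D F (rad D F p)) /\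
  forall T, is_period D F p T -> T = loop_period D F (rad D F p).
Proof.
  intros HD HF Hp Hne Hb. pose proof (rad_pos D F p HD Hp Hne) as Hr.
  destruct (orbit_pt_surj D F p HD HF Hp Hne) as [a Ha].
  set (r := rad D F p) in *.
  assert (Hr' : 0 <= r < amp D F b) by lra.
  set (T0 := loop_period D F r).
  assert (HT0 : 0 < T0) by now apply (loop_period_pos D F b).
  set (t0 := orbit_time D F r a).
  set (g := fun t => orbit_pt D F r (orbit_angle D F r (t + t0))).
  assert (Hsol : is_solution D F g) by now apply (orbit_solution D F b).
  assert (Hang : orbit_angle D F r t0 = a) by now apply (orbit_angle_time D F b).
  assert (Hg0 : g 0 = p) by (unfold g; rewrite Rplus_0_l, Hang; auto).
  assert (Hper : forall t, g (t + T0) = g t).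
  { intro t. unfold g. replace (t + T0 + t0) with (t + t0 + T0) by ring.
    unfold T0. rewrite (orbit_angle_shift D F b) by auto. apply orbit_pt_shift. }
  assert (Hmin : forall s, 0 < s < T0 -> g s <> p).
  { intros s Hs. rewrite <- Ha. unfold g. apply (orbit_pt_not_returning D F b); auto.
    rewrite <- Hang at 1. split.
    - apply (orbit_angle_increasing D F b); auto. lra.
    - rewrite <- Hang, <- (orbit_angle_shift D F b) by auto.
      apply (orbit_angle_increasing D F b); auto. fold T0. lra. }
  split.
  - split; [now apply loud_neq_0|]. split; auto. exists g. auto.
  - intros T (_ & HT & g' & Hs' & Hg0' & Hper' & Hmin').
    assert (Heq : forall t, g' t = g t).
    { apply (loud_solution_unique D F); auto. now rewrite Hg0', Hg0. }
    destruct (Rtotal_order T T0) as [H|[H|H]]; auto; exfalso.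
    + apply (Hmin T); [lra|]. rewrite <- Heq, <- (Rplus_0_l T), Hper'. exact Hg0'.
    + apply (Hmin' T0); [lra|]. rewrite Heq, <- (Rplus_0_l T0), Hper. exact Hg0.
Qed.

Lemma period_eq_loop_period (D F b : R) (p : R * R) : -1 < D < 0 -> Rabs F <= 1 / 32 ->
  fst p < 1 -> p <> (0, 0) -> rad D F p < amp D F b ->
  period D F p = loop_period D F (rad D F p).
Proof.
  intros HD HF Hp Hne Hb.
  destruct (is_period_loop_period D F b p HD HF Hp Hne Hb) as [H1 H2].
  apply H2. unfold period. apply (epsilon_spec (inhabits 0) (fun T => is_period D F p T)).
  eexists; eassumption.
Qed.

(** * The period annulus *)

Lemma is_solution_shift (D F t0 : R) (g : R -> R * R) :
  is_solution D F g -> is_solution D F (fun t => g (t + t0)).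
Proof.
  intros Hs t. destruct (Hs (t + t0)) as [H1 H2].
  split.
  - replace (fst (loud D F (g (t + t0)))) with (scal 1 (fst (loud D F (g (t + t0)))))
      by (unfold scal; simpl; unfold mult; simpl; ring).
    apply (is_derive_comp (fun s => fst (g s)) (fun t => t + t0)); auto.
    auto_derive; [trivial|ring].
  - replace (snd (loud D F (g (t + t0)))) with (scal 1 (snd (loud D F (g (t + t0)))))
      by (unfold scal; simpl; unfold mult; simpl; ring).
    apply (is_derive_comp (fun s => snd (g s)) (fun t => t + t0)); auto.
    auto_derive; [trivial|ring].
Qed.

(** Here [u' = v (u - 1)], so [(u - 1)^2] satisfies a linear differential inequality on each compact
    time interval. *)
Lemma invariant_line (D F : R) (g : R -> R * R) : is_solution D F g -> fst (g 0) = 1 ->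
  forall t, fst (g t) = 1.
Proof.
  intros Hs H0.
  assert (Hmain : forall a, 0 <= a -> fst (g a) = 1 /\ fst (g (- a)) = 1).
  { intros a Ha.
    destruct (continuity_ab_maj (fun t => Rabs (snd (g t))) (- a) a) as [M [HM _]]; [lra| |].
    { intros c _. apply continuity_pt_filterlim.
      apply (continuous_comp (fun t => snd (g t)) Rabs); [|apply continuous_Rabs].
      now apply (solution_continuous D F). }
    destruct (gronwall_zero (fun t => (fst (g t) - 1) ^ 2)
      (fun t => 2 * snd (g t) * (fst (g t) - 1) ^ 2) a (2 * Rabs (snd (g M)))) as [Z1 Z2]; auto.
    - intros t _. destruct (Hs t) as [H1 _]. set (u := fun s => fst (g s)).
      change (is_derive u t (fst (loud D F (g t)))) in H1.
      apply (is_derive_ext (fun t => (u t - 1) ^ 2)); [reflexivity|].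
      auto_derive; [eexists; eassumption|].
      change (fun x => u x) with u. rewrite (is_derive_unique _ _ _ H1).
      unfold u, loud; simpl. ring.
    - intros t Ht. specialize (HM t Ht). rewrite Rabs_mult.
      rewrite (Rabs_right ((fst (g t) - 1) ^ 2)) by (apply Rle_ge, pow2_ge_0).
      apply Rmult_le_compat_r; [apply pow2_ge_0|].
      rewrite Rabs_mult, (Rabs_right 2) by lra. lra.
    - intros; apply pow2_ge_0.
    - rewrite H0. ring.
    - split; nra. }
  intros t. destruct (Rle_dec 0 t).
  - now apply Hmain.
  - replace t with (- - t) by ring. apply Hmain. lra.
Qed.

Lemma invariant_half_plane (D F : R) (g : R -> R * R) : is_solution D F g -> fst (g 0) < 1 ->
  forall t, fst (g t) < 1.
Proof.
  intros Hs H0 t. destruct (Rlt_dec (fst (g t)) 1) as [|Hn]; auto. exfalso.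
  destruct (IVT_gen (fun s => fst (g s)) 0 t 1) as [s [_ Hs1]].
  - intro s. apply continuity_pt_filterlim. now apply (solution_continuous D F).
  - rewrite Rmin_left, Rmax_right; lra.
  - pose proof (invariant_line D F _ (is_solution_shift D F s g Hs)) as HL.
    simpl in HL. rewrite Rplus_0_l in HL. specialize (HL Hs1 (- s)).
    rewrite Rplus_opp_l in HL. lra.
Qed.

(* On the invariant line the field is one-dimensional, so a closed orbit would contain
   an equilibrium. *)
Lemma periodic_fst_neq_1 (D F : R) (p : R * R) : periodic D F p -> fst p <> 1.
Proof.
  intros (T & Hl & HT & g & Hs & Hg0 & Hper & _) Hp.
  assert (Hu : forall t, fst (g t) = 1) by (apply (invariant_line D F); auto; now rewrite Hg0).
  destruct (MVT_cor2 (fun t => snd (g t)) (fun t => snd (loud D F (g t))) 0 T HT) as [c [Hc1 Hc2]].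
  { intros t _. apply is_derive_Reals, Hs. }
  assert (HgT : g T = g 0) by (rewrite <- (Rplus_0_l T) at 1; apply Hper).
  rewrite HgT, Rminus_diag, Rminus_0_r in Hc1.
  assert (Hc : snd (loud D F (g c)) = 0) by nra.
  assert (Hc' : loud D F (g c) = (0, 0)).
  { apply injective_projections; auto. unfold loud; simpl. rewrite Hu. ring. }
  assert (Heq : forall t, g (t + c) = g c).
  { apply (loud_solution_unique D F (fun t => g (t + c)) (fun _ => g c)).
    - now apply is_solution_shift.
    - intro t. rewrite Hc'. simpl. split; apply (is_derive_const (V := R_NormedModule)).
    - now rewrite Rplus_0_l. }
  apply Hl. specialize (Heq (- c)). rewrite Rplus_opp_l, Hg0 in Heq. now rewrite Heq.
Qed.

(** Stated for an arbitrary curve: along solutions it gives conservation of the energy, along a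
    transversal line it shows that the radius has nonzero derivative. *)
Lemma is_derive_energy (D F : R) (u v : R -> R) (t u' v' : R) :
  is_derive u t u' -> is_derive v t v' -> u t < 1 ->
  is_derive (fun s => energy D F (u s, v s)) t
    (2 * exp (2 * F * xof (u t, v t)) *
      ((u t + D * u t ^ 2 + F * v t ^ 2) / (1 - u t) * u' + v t * v')).
Proof.
  intros Hu Hv Hlt. set (x := fun s => - ln (1 - u s)).
  assert (Hx : is_derive x t (u' / (1 - u t))).
  { unfold x. auto_derive; [split; [eexists; eassumption|split; [lra|trivial]]|].
    change (fun x => u x) with u. rewrite (is_derive_unique _ _ _ Hu). field. lra. }
  assert (HV : is_derive (fun s => potential D F (x s)) t (u' / (1 - u t) * wforce D F (x t))).
  { apply (is_derive_comp (potential D F) x); auto. apply is_derive_potential. }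
  set (P := fun s => potential D F (x s)).
  change (is_derive P t (u' / (1 - u t) * wforce D F (x t))) in HV.
  apply (is_derive_ext (fun s => (exp (F * x s) * v s) ^ 2 + 2 * P s)); [reflexivity|].
  auto_derive; [repeat split; eexists; eassumption|].
  change (fun x => v x) with v. change (fun s => x s) with x. change (fun x => P x) with P.
  rewrite (is_derive_unique _ _ _ Hx), (is_derive_unique _ _ _ Hv).
  rewrite (is_derive_unique _ _ _ HV).
  change (xof (u t, v t)) with (x t).
  assert (He : exp (- x t) = 1 - u t) by (unfold x; rewrite Ropp_involutive; apply exp_ln; lra).
  unfold wforce, force. rewrite He.
  replace (2 * F * x t) with (F * x t + F * x t) by ring. rewrite exp_plus.
  field. lra.
Qed.

Lemma energy_constant (D F : R) (g : R -> R * R) : is_solution D F g ->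
  (forall t, fst (g t) < 1) -> forall t, energy D F (g t) = energy D F (g 0).
Proof.
  intros Hs Hlt. apply (zero_derivative_const (fun t => energy D F (g t))). intro t.
  destruct (Hs t) as [H1 H2].
  apply (is_derive_ext (fun s => energy D F (fst (g s), snd (g s)))).
  { intro s. now rewrite <- surjective_pairing. }
  pose proof (is_derive_energy D F _ _ t _ _ H1 H2 (Hlt t)) as H.
  specialize (Hlt t). unfold loud in H; simpl in H.
  match type of H with is_derive _ _ ?e => replace e with 0 in H; [exact H|] end.
  field. lra.
Qed.

(** The point of largest [u] on the orbit lies on the positive [u]-axis. Its coordinate [x] measures
    the orbit: [amp x] is the radius, and the position of this point relative to the excluded
    segment decides whether the orbit is large. *)
Lemma periodic_max_point (D F : R) (p : R * R) : -1 < D < 0 -> fst p < 1 ->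
  periodic D F p ->
  exists x, 0 < x /\ on_orbit D F p (1 - exp (- x), 0) /\ rad D F p = amp D F x.
Proof.
  intros HD Hp (T & Hl & HT & g & Hs & Hg0 & Hper & _).
  assert (Hlt : forall t, fst (g t) < 1).
  { apply (invariant_half_plane D F); auto. now rewrite Hg0. }
  assert (Hne : p <> (0, 0)).
  { intro He. apply Hl. rewrite He. unfold loud; simpl. f_equal; ring. }
  assert (HE : forall t, energy D F (g t) = energy D F p).
  { intro t. rewrite <- Hg0. now apply energy_constant. }
  pose proof (energy_pos D F p HD Hp Hne) as HEp.
  destruct (continuity_ab_maj (fun t => fst (g t)) 0 T) as [m [Hm Hm1]]; [lra| |].
  { intros c _. apply continuity_pt_filterlim. now apply (solution_continuous D F). }
  (* The maximum over [[0, T]] may sit at an endpoint; extending by periodicity makes it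
     interior. *)
  assert (Hmax : forall t, - T < t < 2 * T -> fst (g t) <= fst (g m)).
  { intros t Ht. destruct (Rlt_dec t 0) as [H1|H1].
    - rewrite <- Hper. apply Hm. lra.
    - destruct (Rle_dec t T) as [H2|H2]; [apply Hm; lra|].
      replace t with (t - T + T) by ring. rewrite Hper. apply Hm. lra. }
  assert (Hu0 : fst (loud D F (g m)) = 0).
  { assert (Hd := proj1 (Hs m)). apply is_derive_Reals in Hd.
    set (pr := exist _ (fst (loud D F (g m))) Hd : derivable_pt (fun t => fst (g t)) m).
    rewrite <- (derive_pt_eq_0 _ _ _ pr Hd).
    apply (deriv_maximum (fun t => fst (g t)) (- T) (2 * T) m pr); try lra.
    intros t Ht1 Ht2. apply Hmax. lra. }
  assert (Hv : snd (g m) = 0).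
  { unfold loud in Hu0; simpl in Hu0. specialize (Hlt m).
    apply (Rmult_eq_reg_r (fst (g m) - 1)); lra. }
  set (x := xof (g m)).
  assert (Hx : exp (- x) = 1 - fst (g m)) by (apply exp_xof; auto).
  assert (HEx : energy D F p = 2 * potential D F x).
  { rewrite <- (HE m). unfold energy. fold x. rewrite Hv. ring. }
  assert (Hx0 : 0 < x).
  (* If [x < 0], then [v' < 0] at the maximum, so [v] becomes negative and [u' = - v (1 - u) > 0]
     just afterwards, a contradiction. If [x = 0], the energy would vanish. *)
  { destruct (Rtotal_order x 0) as [H|[H|H]]; auto; exfalso.
    - assert (Hd := proj2 (Hs m)). apply is_derive_Reals in Hd.
      assert (Hneg : snd (loud D F (g m)) < 0).
      { pose proof (force_neg D x HD H) as Hf. unfold force in Hf. rewrite Hx in Hf.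
        unfold loud; simpl. rewrite Hv. nra. }
      set (l := snd (loud D F (g m))) in *.
      destruct (Hd (- l / 2)) as [d Hdd]; [lra|].
      set (h := Rmin (d / 2) (T / 2)).
      assert (Hh : 0 < h) by (apply Rmin_pos; [apply is_pos_div_2|lra]).
      assert (Hh1 : h <= d / 2) by apply Rmin_l.
      assert (Hh2 : h <= T / 2) by apply Rmin_r.
      destruct (MVT_cor2 (fun t => fst (g t)) (fun t => fst (loud D F (g t))) m (m + h))
        as [c [Hc1 Hc2]]; [lra| |].
      { intros t _. apply is_derive_Reals, Hs. }
      assert (Hvc : snd (g c) < 0).
      { assert (Hq : Rabs ((snd (g (m + (c - m))) - snd (g m)) / (c - m) - l) < - l / 2).
        { apply Hdd; [lra|]. rewrite Rabs_right by lra. destruct d; simpl in *; lra. }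
        replace (m + (c - m)) with c in Hq by ring. rewrite Hv, Rminus_0_r in Hq.
        apply Rabs_def2 in Hq.
        assert (snd (g c) / (c - m) < 0) by lra.
        replace (snd (g c)) with (snd (g c) / (c - m) * (c - m)) by (field; lra). nra. }
      assert (Hu1 : 0 < fst (loud D F (g c))).
      { unfold loud; simpl. specialize (Hlt c). nra. }
      assert (fst (g (m + h)) <= fst (g m)) by (apply Hmax; lra).
      nra.
    - rewrite H, potential_0 in HEx. lra. }
  exists x. split; auto. split.
  - exists g. split; auto. split; auto. exists m.
    apply injective_projections; simpl; lra.
  - unfold rad. rewrite HEx. unfold amp. destruct (Rle_dec 0 x); [reflexivity|lra].
Qed.

(** As long as [|F| x <= 1 / 2] the weight stays above [exp (- 1) >= 1 / 3], so the growth is linear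
    whatever the sign of [F]. For [F = 0] this holds on the whole half-line. *)
Lemma potential_right_ge (D F d x : R) : 0 < d -> -1 + d <= D <= - d -> 1 <= x ->
  Rabs F * x <= 1 / 2 -> d / 6 * (x - 1) <= potential D F x.
Proof.
  intros Hd HD Hx HF.
  assert (H := increment_ge_everywhere (potential D F) (wforce D F) 1 x (d / 6) Hx).
  assert (H1 : d / 6 * (x - 1) <= potential D F x - potential D F 1).
  { apply H; [intros; apply is_derive_potential|]. intros y Hy.
    assert (Hf := force_right_ge D d y Hd HD (proj1 Hy)).
    assert (He : / 3 <= exp (2 * F * y)).
    { apply Rle_trans with (exp (- (1))).
      - rewrite exp_Ropp. apply Rinv_le_contravar; [apply exp_pos|apply exp_le_3].
      - apply exp_le_compat. pose proof (Rabs_pos F). pose proof (Rle_abs (- F)) as Hn.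
        rewrite Rabs_Ropp in Hn. nra. }
    unfold wforce. nra. }
  pose proof (potential_nonneg D F 1 (ltac:(lra))). lra.
Qed.

Lemma halfplane_periodic (D : R) (q : R * R) : -1 < D < 0 -> fst q < 1 -> q <> (0, 0) ->
  periodic D 0 q.
Proof.
  intros HD Hq Hne. set (d := Rmin (1 + D) (- D)).
  assert (Hd : 0 < d) by (apply Rmin_pos; lra).
  assert (HDd : -1 + d <= D <= - d).
  { pose proof (Rmin_l (1 + D) (- D)). pose proof (Rmin_r (1 + D) (- D)). fold d in H, H0. lra. }
  set (r := rad D 0 q). pose proof (rad_pos D 0 q HD Hq Hne) as Hr. fold r in Hr.
  (* This makes the potential at [b] at least [r^2], hence [amp b > r]. *)
  set (b := 1 + 6 * (r * r) / d).
  assert (Hb : 0 < 6 * (r * r) / d) by (apply Rdiv_lt_0_compat; nra).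
  exists (loop_period D 0 r).
  apply (is_period_loop_period D 0 b); auto.
  - rewrite Rabs_R0. lra.
  - fold r.
    assert (HV := potential_right_ge D 0 d b Hd HDd (ltac:(unfold b; lra))
      (ltac:(rewrite Rabs_R0; lra))).
    replace (d / 6 * (b - 1)) with (r * r) in HV by (unfold b; field; lra).
    assert (Hs := amp_sqr D 0 b HD). assert (Ha := amp_pos D 0 b HD (ltac:(unfold b; lra))). nra.
Qed.

(** * Connectedness in the plane and location of the annulus *)

Lemma dist2_coord_lt (x y : R * R) (e : R) : 0 < e -> dist2 x y < e ^ 2 ->
  Rabs (fst x - fst y) < e /\ Rabs (snd x - snd y) < e.
Proof.
  unfold dist2. intros He H.
  pose proof (pow2_ge_0 (fst x - fst y)). pose proof (pow2_ge_0 (snd x - snd y)).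
  split; apply Rabs_def1; nra.
Qed.

Lemma openR2_left : openR2 (fun q => fst q < 1).
Proof.
  intros x Hx. exists (1 - fst x). split; [lra|]. intros y Hy.
  apply dist2_coord_lt in Hy; [|lra]. destruct Hy as [Hy _]. apply Rabs_def2 in Hy. lra.
Qed.

Lemma openR2_right : openR2 (fun q => 1 < fst q).
Proof.
  intros x Hx. exists (fst x - 1). split; [lra|]. intros y Hy.
  apply dist2_coord_lt in Hy; [|lra]. destruct Hy as [Hy _]. apply Rabs_def2 in Hy. lra.
Qed.

Lemma clamp_lipschitz (s t : R) :
  Rabs (Rmax 0 (Rmin 1 s) - Rmax 0 (Rmin 1 t)) <= Rabs (s - t).
Proof.
  unfold Rmax, Rmin, Rabs.
  repeat destruct Rle_dec; repeat destruct Rcase_abs; lra.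
Qed.

(** If [A] and [B] were disjoint on [U], the function that is [-1] on [A] and [1] on [B] would be
    locally constant along a segment of [U] and yet change sign. *)
Lemma convex_connectedR2 (U : R * R -> Prop) :
  (forall a b t, U a -> U b -> 0 <= t <= 1 ->
     U (fst a + t * (fst b - fst a), snd a + t * (snd b - snd a))) -> connectedR2 U.
Proof.
  intros Hconv A B HA HB Hcov [a [Ua Aa]] [b [Ub Bb]].
  apply NNPP. intro Hno.
  (* Clamping the parameter extends the segment to all of the line, as the intermediate value
     theorem used below asks for continuity everywhere. *)
  set (cl := fun t => Rmax 0 (Rmin 1 t)).
  assert (Hcl : forall t, 0 <= cl t <= 1).
  { intro t. unfold cl, Rmax, Rmin. repeat destruct Rle_dec; lra. }
  set (gam := fun t => (fst a + cl t * (fst b - fst a), snd a + cl t * (snd b - snd a))).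
  assert (HU : forall t, U (gam t)) by (intro t; apply Hconv; auto).
  set (K := dist2 a b).
  assert (HK : 0 <= K).
  { unfold K, dist2. pose proof (pow2_ge_0 (fst a - fst b)).
    pose proof (pow2_ge_0 (snd a - snd b)). lra. }
  assert (Hdist : forall s t, dist2 (gam s) (gam t) <= (s - t) ^ 2 * K).
  { intros s t. unfold gam, dist2; simpl.
    pose proof (clamp_lipschitz s t) as Hc. fold (cl s) (cl t) in Hc.
    assert (Hsq : (cl s - cl t) ^ 2 <= (s - t) ^ 2).
    { rewrite <- (pow2_abs (cl s - cl t)), <- (pow2_abs (s - t)).
      apply pow_incr. split; [apply Rabs_pos|auto]. }
    apply Rle_trans with ((cl s - cl t) ^ 2 * K).
    - right. unfold K, dist2. ring.
    - apply Rmult_le_compat_r; auto. }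
  assert (Hloc : forall C t, openR2 C -> C (gam t) -> locally t (fun s => C (gam s))).
  { intros C t HC Ct. destruct (HC _ Ct) as [e [He HCe]].
    assert (Hp : 0 < e / (1 + K)) by (apply Rdiv_lt_0_compat; lra).
    exists (mkposreal _ Hp). intros s Hs. apply HCe.
    apply ball_Rabs_lt in Hs; simpl in Hs.
    eapply Rle_lt_trans; [apply Hdist|].
    assert (Hsq : (t - s) ^ 2 <= (e / (1 + K)) ^ 2).
    { rewrite <- (pow2_abs (t - s)). apply pow_incr. split; [apply Rabs_pos|].
      rewrite Rabs_minus_sym. lra. }
    apply Rle_lt_trans with ((e / (1 + K)) ^ 2 * K).
    - apply Rmult_le_compat_r; auto.
    - apply Rlt_le_trans with ((e / (1 + K)) ^ 2 * ((1 + K) * (1 + K))).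
      + apply Rmult_lt_compat_l; [apply pow_lt; auto|nra].
      + right. field. lra. }
  set (f := fun t => if excluded_middle_informative (A (gam t)) then -1 else 1).
  assert (Hf : forall t, continuous f t).
  { intro t. destruct (Hcov _ (HU t)) as [H|H].
    - apply (continuous_ext_loc _ (fun _ => -1)); [|apply continuous_const].
      generalize (Hloc A t HA H). apply filter_imp. intros s Hs. unfold f.
      destruct (excluded_middle_informative (A (gam s))); [reflexivity|contradiction].
    - apply (continuous_ext_loc _ (fun _ => 1)); [|apply continuous_const].
      generalize (Hloc B t HB H). apply filter_imp. intros s Hs. unfold f.
      destruct (excluded_middle_informative (A (gam s))) as [HAs|]; [|reflexivity].
      exfalso. apply Hno. exists (gam s). auto. }
  assert (Hcl0 : cl 0 = 0) by (unfold cl; rewrite Rmin_right, Rmax_left; lra).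
  assert (Hcl1 : cl 1 = 1) by (unfold cl; rewrite Rmin_left, Rmax_right; lra).
  assert (Hg0 : gam 0 = a).
  { unfold gam. rewrite Hcl0. apply injective_projections; simpl; ring. }
  assert (Hg1 : gam 1 = b).
  { unfold gam. rewrite Hcl1. apply injective_projections; simpl; ring. }
  assert (Hf0 : f 0 = -1).
  { unfold f. rewrite Hg0. destruct (excluded_middle_informative (A a)); [auto|contradiction]. }
  assert (Hf1 : f 1 = 1).
  { unfold f. rewrite Hg1. destruct (excluded_middle_informative (A b)); auto.
    exfalso. apply Hno. exists b. auto. }
  destruct (IVT_gen f 0 1 0) as [t [_ Ht]].
  - intro t. apply continuity_pt_filterlim, Hf.
  - rewrite Hf0, Hf1, Rmin_left, Rmax_right; lra.
  - unfold f in Ht. destruct (excluded_middle_informative (A (gam t))); lra.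
Qed.

Lemma halfplane_in_annulus (D : R) (p : R * R) : -1 < D < 0 -> fst p < 1 -> p <> (0, 0) ->
  in_period_annulus D 0 p.
Proof.
  intros HD Hp Hne. split; auto. exists (fun q => fst q < 1).
  split; [apply openR2_left|]. split.
  - apply convex_connectedR2. intros a b t Ha Hb Ht. simpl in *.
    destruct (Rle_dec (fst a) (fst b)); nra.
  - split; [simpl; lra|]. split; auto. intros q Hq Hq0. now apply halfplane_periodic.
Qed.

(** No periodic point lies on [u = 1], so the connected neighbourhood of the origin avoids this line
    and stays on the side of the origin. *)
Lemma annulus_periodic_left (D F : R) (p : R * R) : in_period_annulus D F p ->
  periodic D F p /\ fst p < 1.
Proof.
  intros (Hne & U & _ & HUc & HU0 & HUp & Hper).
  assert (Hp := Hper p HUp Hne). split; auto.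
  destruct (Rlt_dec (fst p) 1) as [|Hn]; auto. exfalso.
  pose proof (periodic_fst_neq_1 D F p Hp) as H1.
  destruct (HUc (fun q => fst q < 1) (fun q => 1 < fst q) openR2_left openR2_right)
    as [x [_ [Hx1 Hx2]]].
  - intros x Ux. destruct (excluded_middle_informative (x = (0, 0))) as [->|Hx].
    + left. simpl. lra.
    + pose proof (periodic_fst_neq_1 D F x (Hper x Ux Hx)).
      destruct (Rlt_dec (fst x) 1); [left; auto|right; lra].
  - exists (0, 0). split; auto. simpl. lra.
  - exists p. split; auto. lra.
  - lra.
Qed.

(** * Regularity of the period at the outer boundary *)

(** Lets a lower bound on increments contradict a zero derivative: for small [s > 0], [f] moves by
    at most [c |l| s / 4], while [h] moves by at least [|l| s / 2]. *)
Lemma zero_derivative_not_expanding (f h : R -> R) (l c : R) :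
  is_derive f 0 0 -> is_derive h 0 l -> l <> 0 -> 0 < c ->
  ~ locally 0 (fun s => c * Rabs (h s - h 0) <= Rabs (f s - f 0)).
Proof.
  intros Hf Hh Hl Hc [d0 Hd0].
  apply is_derive_Reals in Hf. apply is_derive_Reals in Hh.
  assert (Hal : 0 < Rabs l) by now apply Rabs_pos_lt.
  destruct (Hf (c * Rabs l / 4)) as [d1 Hd1]; [nra|].
  destruct (Hh (Rabs l / 2)) as [d2 Hd2]; [lra|].
  set (s := Rmin d0 (Rmin d1 d2) / 2).
  assert (Hm : 0 < Rmin d0 (Rmin d1 d2)) by (repeat apply Rmin_pos; apply cond_pos).
  assert (Hm0 : Rmin d0 (Rmin d1 d2) <= d0) by apply Rmin_l.
  assert (Hm1 : Rmin d0 (Rmin d1 d2) <= d1) by (eapply Rle_trans; [apply Rmin_r|apply Rmin_l]).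
  assert (Hm2 : Rmin d0 (Rmin d1 d2) <= d2) by (eapply Rle_trans; [apply Rmin_r|apply Rmin_r]).
  assert (Hs : 0 < s) by (unfold s; lra).
  assert (Has : Rabs s = s) by (apply Rabs_right; lra).
  specialize (Hd1 s (ltac:(lra)) (ltac:(rewrite Has; unfold s; lra))).
  specialize (Hd2 s (ltac:(lra)) (ltac:(rewrite Has; unfold s; lra))).
  rewrite Rplus_0_l in Hd1, Hd2.
  assert (H := Hd0 s).
  assert (Hb : ball 0 d0 s).
  { unfold ball; simpl; unfold AbsRing_ball, abs, minus, plus, opp; simpl.
    rewrite Ropp_0, Rplus_0_r, Has. unfold s. lra. }
  specialize (H Hb).
  assert (E1 : Rabs (f s - f 0) <= c * Rabs l / 4 * s).
  { replace (f s - f 0) with (((f s - f 0) / s - 0) * s) by (field; lra).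
    rewrite Rabs_mult, Has. apply Rmult_le_compat_r; lra. }
  assert (E2 : Rabs l / 2 * s <= Rabs (h s - h 0)).
  { replace (h s - h 0) with ((h s - h 0) / s * s) by (field; lra).
    rewrite Rabs_mult, Has. apply Rmult_le_compat_r; [lra|].
    pose proof (Rabs_triang_inv l (l - (h s - h 0) / s)) as Ht.
    replace (l - (l - (h s - h 0) / s)) with ((h s - h 0) / s) in Ht by ring.
    rewrite Rabs_minus_sym in Hd2. lra. }
  assert (0 < c * Rabs l * s) by (apply Rmult_lt_0_compat; auto; nra).
  nra.
Qed.

Lemma continuous_eventually_lt (f : R -> R) (c : R) :
  continuous f 0 -> f 0 < c -> locally 0 (fun s => f s < c).
Proof. intros Hf Hc. apply (Hf (fun y => y < c)). now apply open_lt. Qed.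

Lemma continuous_eventually_gt (f : R -> R) (c : R) :
  continuous f 0 -> c < f 0 -> locally 0 (fun s => c < f s).
Proof. intros Hf Hc. apply (Hf (fun y => c < y)). now apply open_gt. Qed.

(* A zero of the derivative of the period along a transversal would, through
   [loop_identity] and [is_derive_loop_action], be a zero of the derivative of [loop_corr],
   against the growth hypothesis. *)
Lemma not_critical_of_growth (D F r0 c b : R) (p : R * R) : -1 < D < 0 -> Rabs F <= 1 / 32 ->
  0 < c -> 0 < r0 ->
  (forall r1 r2, r0 <= r1 <= r2 -> r2 <= 2 * r1 -> r2 < amp D F b ->
    c / r1 * (r2 - r1) <= loop_corr D F r2 - loop_corr D F r1) ->
  fst p < 1 -> p <> (0, 0) -> r0 < rad D F p < amp D F b -> ~ critical_period D F p.
Proof.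
  intros HD HF Hc Hr0 Hgrow Hp Hne Hrad [_ [w [Htr Hcrit]]].
  set (u := fun s => fst p + s * fst w). set (v := fun s => snd p + s * snd w).
  set (gam := fun s => (u s, v s)).
  assert (Hu : is_derive u 0 (fst w)) by (unfold u; auto_derive; [trivial|ring]).
  assert (Hv : is_derive v 0 (snd w)) by (unfold v; auto_derive; [trivial|ring]).
  assert (Hu0 : u 0 = fst p) by (unfold u; ring).
  assert (Hv0 : v 0 = snd p) by (unfold v; ring).
  assert (Hg0 : gam 0 = p) by (unfold gam; rewrite Hu0, Hv0; now destruct p).
  pose proof (is_derive_energy D F u v 0 _ _ Hu Hv (ltac:(lra))) as He.
  rewrite Hu0, Hv0 in He. rewrite <- (surjective_pairing p) in He.
  set (e' := 2 * exp (2 * F * xof p) * ((fst p + D * fst p ^ 2 + F * snd p ^ 2) / (1 - fst p) * fst w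
    + snd p * snd w)) in He.
  (* Up to the positive factor [2 exp (2 F x) / (1 - u)], [e'] is the determinant of [w] and the
     field, nonzero by transversality. *)
  assert (He' : e' <> 0).
  { unfold e'. intro H0. apply Htr. pose proof (exp_pos (2 * F * xof p)) as Hex.
    assert (Hz : (fst p + D * fst p ^ 2 + F * snd p ^ 2) / (1 - fst p) * fst w + snd p * snd w = 0) by nra.
    transitivity ((1 - fst p) * ((fst p + D * fst p ^ 2 + F * snd p ^ 2) / (1 - fst p) * fst w
      + snd p * snd w)); [unfold loud; simpl; field; lra|].
    rewrite Hz. ring. }
  set (en := fun s => energy D F (u s, v s)).
  change (is_derive en 0 e') in He.
  set (rho := fun s => rad D F (gam s)).
  assert (Hrho0 : rho 0 = rad D F p) by (unfold rho; now rewrite Hg0).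
  set (R0 := rad D F p) in *.
  pose proof (energy_pos D F p HD Hp Hne) as Hep.
  assert (Hen0 : en 0 = energy D F p) by (unfold en; fold (gam 0); now rewrite Hg0).
  assert (HR0 : 0 < R0) by (apply rad_pos; auto).
  set (l := e' / (2 * R0)).
  assert (Hl : l <> 0).
  { unfold l. intro H0. apply He'. replace e' with (e' / (2 * R0) * (2 * R0)) by (field; lra).
    rewrite H0. ring. }
  assert (Hrho : is_derive rho 0 l).
  { apply (is_derive_ext (fun s => sqrt (en s))); [reflexivity|].
    auto_derive; [split; [eexists; eassumption|split; [rewrite Hen0; lra|trivial]]|].
    change (fun x => en x) with en. rewrite (is_derive_unique _ _ _ He), Hen0.
    fold (rad D F p). fold R0. unfold l. field. lra. }
  assert (Cu : continuous u 0) by (apply (ex_derive_continuous u); eexists; eassumption).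
  assert (Crho : continuous rho 0) by (apply (ex_derive_continuous rho); eexists; eassumption).
  assert (Cen : continuous en 0) by (apply (ex_derive_continuous en); eexists; eassumption).
  (* The last two conditions keep the radii within a factor 2 of [R0], as the growth hypothesis
     requires, and bound its coefficient below by [c / (2 R0)]. *)
  assert (Hloc : locally 0 (fun s => (u s < 1 /\ 0 < en s) /\ (r0 < rho s /\ rho s < amp D F b)
    /\ (R0 / 2 < rho s /\ rho s < 2 * R0))).
  { repeat apply filter_and.
    - apply continuous_eventually_lt; auto. lra.
    - apply continuous_eventually_gt; auto. lra.
    - apply continuous_eventually_gt; auto. lra.
    - apply continuous_eventually_lt; auto. lra.
    - apply continuous_eventually_gt; auto. lra.
    - apply continuous_eventually_lt; auto. lra. }
  assert (Hper : locally 0 (fun s => period D F (gam s) = loop_period D F (rho s))).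
  { generalize Hloc. apply filter_imp. intros s ((H1 & H2) & (H3 & H4) & _).
    apply (period_eq_loop_period D F b); auto.
    intro H0. unfold en in H2. fold (gam s) in H2. rewrite H0 in H2.
    unfold energy, xof in H2; simpl in H2. rewrite Rminus_0_r, ln_1, Ropp_0, potential_0 in H2. lra. }
  assert (HT : is_derive (fun s => loop_period D F (rho s)) 0 0).
  { apply (is_derive_ext_loc (fun s => period D F (gam s))); auto. }
  assert (HJ : is_derive (fun s => loop_action D F (rho s)) 0 (l * (F * R0 * loop_period D F R0))).
  { apply (is_derive_comp (loop_action D F) rho); auto. rewrite Hrho0.
    apply (is_derive_loop_action D F b); auto. lra. }
  (* Differentiability comes from [loop_identity]. The derivative of [F rho^2] contributes
     [2 F R0 l T], which twice the derivative of the action cancels exactly. *)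
  assert (HE : is_derive (fun s => loop_corr D F (rho s)) 0 0).
  { set (Tf := fun s => loop_period D F (rho s)). set (Jf := fun s => loop_action D F (rho s)).
    change (is_derive Tf 0 0) in HT. change (is_derive Jf 0 (l * (F * R0 * loop_period D F R0))) in HJ.
    apply (is_derive_ext_loc (fun s => (F * rho s * rho s + corr D F 0) * Tf s - 2 * Jf s)).
    - generalize Hloc. apply filter_imp. intros s (_ & (H3 & H4) & _).
      pose proof (loop_identity D F b (rho s) HD HF (ltac:(lra))) as Hi. unfold Tf, Jf. lra.
    - auto_derive; [repeat split; eexists; eassumption|].
      change (fun x => rho x) with rho. change (fun x => Tf x) with Tf. change (fun x => Jf x) with Jf.
      rewrite (is_derive_unique _ _ _ Hrho), (is_derive_unique _ _ _ HT), (is_derive_unique _ _ _ HJ).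
      unfold Tf. rewrite Hrho0. ring. }
  apply (zero_derivative_not_expanding (fun s => loop_corr D F (rho s)) rho l (c / (2 * R0)));
    auto; [apply Rdiv_lt_0_compat; lra|].
  generalize Hloc. apply filter_imp. intros s (_ & (H3 & H4) & (H5 & H6)). rewrite Hrho0.
  assert (Hcoef : forall r, 0 < r <= 2 * R0 -> c / (2 * R0) <= c / r).
  { intros r Hr. unfold Rdiv. apply Rmult_le_compat_l; [lra|]. apply Rinv_le_contravar; lra. }
  destruct (Rle_dec R0 (rho s)) as [Hle|Hle].
  - rewrite (Rabs_right (rho s - R0)) by lra.
    eapply Rle_trans; [|apply Rle_abs].
    eapply Rle_trans; [|apply (Hgrow R0 (rho s)); lra].
    apply Rmult_le_compat_r; [lra|]. apply Hcoef. lra.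
  - rewrite (Rabs_left (rho s - R0)) by lra.
    rewrite Rabs_minus_sym. eapply Rle_trans; [|apply Rle_abs].
    replace (- (rho s - R0)) with (R0 - rho s) by ring.
    eapply Rle_trans; [|apply (Hgrow (rho s) R0); lra].
    apply Rmult_le_compat_r; [lra|]. apply Hcoef. lra.
Qed.

(** * The [u]-axis in the Poincare disc and the conclusion *)

Lemma div_sqrt_le (s t : R) : 0 <= s <= t -> s / sqrt (1 + s ^ 2 + 0 ^ 2) <= t / sqrt (1 + t ^ 2 + 0 ^ 2).
Proof.
  intros Hst.
  assert (P1 : 0 < sqrt (1 + s ^ 2 + 0 ^ 2)) by (apply sqrt_lt_R0; nra).
  assert (P2 : 0 < sqrt (1 + t ^ 2 + 0 ^ 2)) by (apply sqrt_lt_R0; nra).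
  assert (S1 : sqrt (1 + s ^ 2 + 0 ^ 2) ^ 2 = 1 + s ^ 2) by (rewrite pow2_sqrt; nra).
  assert (S2 : sqrt (1 + t ^ 2 + 0 ^ 2) ^ 2 = 1 + t ^ 2) by (rewrite pow2_sqrt; nra).
  set (a := sqrt (1 + s ^ 2 + 0 ^ 2)) in *. set (b := sqrt (1 + t ^ 2 + 0 ^ 2)) in *.
  apply (Rmult_le_reg_r (a * b)); [nra|].
  replace (s / a * (a * b)) with (s * b) by (field; lra).
  replace (t / b * (a * b)) with (t * a) by (field; lra).
  apply Rsqr_incr_0_var; [|nra]. unfold Rsqr.
  replace (s * b * (s * b)) with (s ^ 2 * b ^ 2) by ring.
  replace (t * a * (t * a)) with (t ^ 2 * a ^ 2) by ring.
  rewrite S1, S2. nra.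
Qed.

Lemma poincare_axis_preimage (u0 a : R) : 0 < u0 ->
  0 < a <= u0 / sqrt (1 + u0 ^ 2 + 0 ^ 2) ->
  exists u, 0 < u <= u0 /\ poincare (u, 0) = (a, 0).
Proof.
  intros Hu0 Ha.
  assert (Pb : 0 < sqrt (1 + u0 ^ 2 + 0 ^ 2)) by (apply sqrt_lt_R0; nra).
  assert (Sb : sqrt (1 + u0 ^ 2 + 0 ^ 2) ^ 2 = 1 + u0 ^ 2) by (rewrite pow2_sqrt; nra).
  set (b := sqrt (1 + u0 ^ 2 + 0 ^ 2)) in *.
  assert (Hab : a * b <= u0).
  { apply Rle_trans with (u0 / b * b); [apply Rmult_le_compat_r; lra|]. right. field. lra. }
  assert (Ha2 : a ^ 2 * (1 + u0 ^ 2) <= u0 ^ 2).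
  { rewrite <- Sb. replace (a ^ 2 * b ^ 2) with ((a * b) ^ 2) by ring.
    apply pow_incr. nra. }
  assert (H1a : 0 < 1 - a ^ 2) by nra.
  set (k := sqrt (1 - a ^ 2)).
  assert (Pk : 0 < k) by (apply sqrt_lt_R0; lra).
  assert (Sk : k ^ 2 = 1 - a ^ 2) by (apply pow2_sqrt; lra).
  (* The inverse of [u / sqrt (1 + u^2)] is [a / sqrt (1 - a^2)]. *)
  exists (a / k). split; [split|].
  - apply Rdiv_lt_0_compat; lra.
  - apply (Rmult_le_reg_r k); auto. replace (a / k * k) with a by (field; lra).
    apply Rsqr_incr_0_var; [|nra]. unfold Rsqr. nra.
  - unfold poincare. cbv [fst snd].
    replace (sqrt (1 + (a / k) ^ 2 + 0 ^ 2)) with (/ k).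
    + f_equal; field; lra.
    + symmetry. apply sqrt_lem_1.
      * pose proof (pow2_ge_0 (a / k)). lra.
      * left. now apply Rinv_0_lt_compat.
      * replace (1 + (a / k) ^ 2 + 0 ^ 2) with ((k ^ 2 + a ^ 2) / k ^ 2) by (field; lra).
        rewrite Sk at 1. replace (1 - a ^ 2 + a ^ 2) with 1 by ring. field. lra.
Qed.

Theorem theoremB :
  forall D0 : R, -1 < D0 < 0 ->
  exists delta : R, 0 < delta /\
  exists W : R * R -> Prop,
    openR2 W /\ (forall q, outer_boundary D0 0 q -> W q) /\
    forall D F : R, Rabs (D - D0) < delta -> Rabs F < delta ->
      forall p : R * R, in_period_annulus D F p ->
        (forall q, on_orbit D F p q -> W (poincare q)) ->
        ~ critical_period D F p.
Proof.
  intros D0 HD0.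
  (* Half the distance of [D0] to the ends of [(-1, 0)]: a perturbation by less than [d] stays in
     [[-1 + d, - d]]. *)
  set (d := Rmin (1 + D0) (- D0) / 2).
  assert (Hm1 : Rmin (1 + D0) (- D0) <= 1 + D0) by apply Rmin_l.
  assert (Hm2 : Rmin (1 + D0) (- D0) <= - D0) by apply Rmin_r.
  assert (Hm : 0 < Rmin (1 + D0) (- D0)) by (apply Rmin_pos; lra).
  assert (Hd : 0 < d <= 1 / 2) by (unfold d; lra).
  destruct (loop_corr_growth d Hd) as (r0 & c & dl & Hr0 & Hc & Hdl & Hgrow).
  (* Chosen so that [potential_right_ge] gives [2 potential xs >= r0^2], that is [amp xs >= r0],
     uniformly in the parameters; the bound [1 / (2 xs)] in [delta] secures its hypothesis. *)
  set (xs := 1 + 3 * (r0 * r0) / d).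
  assert (Hxs : 1 < xs).
  { unfold xs. assert (0 < 3 * (r0 * r0) / d) by (apply Rdiv_lt_0_compat; nra). lra. }
  set (u0 := 1 - exp (- xs)).
  assert (Hu0 : 0 < u0 < 1).
  { unfold u0. pose proof (exp_pos (- xs)).
    assert (exp (- xs) < exp 0) by (apply exp_increasing; lra). rewrite exp_0 in *. lra. }
  set (a0 := u0 / sqrt (1 + u0 ^ 2 + 0 ^ 2)).
  set (delta := Rmin d (Rmin dl (1 / (2 * xs)))).
  assert (Hdelta : 0 < delta).
  { unfold delta. repeat apply Rmin_pos; try lra. apply Rdiv_lt_0_compat; lra. }
  assert (Hde1 : delta <= d) by apply Rmin_l.
  assert (Hde2 : delta <= dl) by (eapply Rle_trans; [apply Rmin_r|apply Rmin_l]).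
  assert (Hde3 : delta <= 1 / (2 * xs)) by (eapply Rle_trans; [apply Rmin_r|apply Rmin_r]).
  exists delta. split; auto.
  (* The complement of the image of the segment from the center to [(u0, 0)]. An orbit inside [W]
     must cross the positive axis beyond [u0]. *)
  exists (fun q => ~ (snd q = 0 /\ 0 <= fst q <= a0)). split; [|split].
  - intros q Hq.
    assert (Hcase : snd q <> 0 \/ fst q < 0 \/ a0 < fst q).
    { destruct (Req_dec (snd q) 0) as [H|H]; [right|left; auto].
      destruct (Rlt_dec (fst q) 0); [left; auto|right].
      destruct (Rlt_dec a0 (fst q)); auto. exfalso. apply Hq. lra. }
    destruct Hcase as [H|[H|H]].
    + exists (Rabs (snd q)). split; [now apply Rabs_pos_lt|]. intros y Hy [Hy1 _].
      apply dist2_coord_lt in Hy; [|now apply Rabs_pos_lt]. destruct Hy as [_ Hy].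
      rewrite Hy1, Rminus_0_r in Hy. lra.
    + exists (- fst q). split; [lra|]. intros y Hy [_ Hy2].
      apply dist2_coord_lt in Hy; [|lra]. destruct Hy as [Hy _]. apply Rabs_def2 in Hy. lra.
    + exists (fst q - a0). split; [lra|]. intros y Hy [_ Hy2].
      apply dist2_coord_lt in Hy; [|lra]. destruct Hy as [Hy _]. apply Rabs_def2 in Hy. lra.
  (* A point of the segment other than the center comes from an axis point with [u <= u0 < 1], which
     lies in the annulus because for [F = 0] the whole punctured half-plane does. *)
  - intros q (_ & Hni & Hq0) [Hq1 Hq2]. apply Hni.
    assert (Hqp : 0 < fst q).
    { destruct (Req_dec (fst q) 0); [|lra]. exfalso. apply Hq0. now apply injective_projections. }
    destruct (poincare_axis_preimage u0 (fst q)) as [u [Hu1 Hu2]]; [lra|split; [auto|apply Hq2]|].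
    exists (u, 0). split.
    + apply halfplane_in_annulus; auto; [simpl; lra|]. intro H. injection H. lra.
    + rewrite Hu2. symmetry. now apply injective_projections.
  - intros D F HDd HFd p Hann HW.
    apply Rabs_def2 in HDd.
    assert (HDb : -1 + d <= D <= - d) by (unfold d in *; lra).
    assert (HD : -1 < D < 0) by lra.
    assert (HF : Rabs F <= 1 / 32) by lra.
    destruct (annulus_periodic_left D F p Hann) as [Hper Hp].
    destruct (periodic_max_point D F p HD Hp Hper) as (x & Hx0 & Horb & Hrad).
    assert (Hxx : xs < x).
    { destruct (Rlt_dec xs x) as [|Hn]; auto. exfalso. apply (HW _ Horb).
      assert (Hle : 0 <= 1 - exp (- x) <= u0).
      { unfold u0. split.
        - assert (exp (- x) <= 1) by (apply exp_nonpos_le; lra). lra.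
        - assert (exp (- xs) <= exp (- x)) by (apply exp_le_compat; lra). lra. }
      unfold poincare. cbv [fst snd]. split; [unfold Rdiv; ring|]. split.
      - apply Rmult_le_pos; [lra|]. left. apply Rinv_0_lt_compat, sqrt_lt_R0. nra.
      - now apply div_sqrt_le. }
    assert (Hamp : r0 <= amp D F xs).
    { assert (HFx : Rabs F * xs <= 1 / 2).
      { apply Rle_trans with (1 / (2 * xs) * xs).
        - apply Rmult_le_compat_r; lra.
        - right. field. lra. }
      assert (HV := potential_right_ge D F d xs (proj1 Hd) HDb (ltac:(lra)) HFx).
      replace (d / 6 * (xs - 1)) with (r0 * r0 / 2) in HV by (unfold xs; field; lra).
      assert (Hs := amp_sqr D F xs HD). assert (Ha := amp_pos D F xs HD (ltac:(lra))).
      apply Rsqr_incr_0_var; [unfold Rsqr|]; lra. }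
    assert (Hlt1 := amp_increasing D F xs x HD Hxx).
    assert (Hlt2 := amp_increasing D F x (x + 1) HD (ltac:(lra))).
    (* The radius equals [amp x], so [x + 1] certifies that it is strictly inside the range of
       [amp], also when [F < 0]. *)
    apply (not_critical_of_growth D F r0 c (x + 1)); auto.
    + intros r1 r2. apply (Hgrow D F HDb (ltac:(lra))).
    + apply Hann.
    + lra.
Qed.
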